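(* Let $X$ be an infinite-dimensional uniformly convex real Banach space whose norm is of class $C^1$ on $X\setminus\{0\}$. Let $c\in\mathbb R\setminus\{0\}$ and let $I_1,I_2\in C^1(X)$ be such that $I_1(0)=I_2(0)=0$, $I_2(u)>0$ for $u\in X\setminus\{0\}$, $I_2$ is $\alpha$-homogeneous for some $\alpha>1$, and $I_2'$ is completely continuous. Assume in addition that (F1) holds if $c>0$ (respectively that (F2) holds if $c<0$), that (F3) holds, and that $H$ is weakly lower semicontinuous if $c>0$ (respectively weakly upper semicontinuous if $c<0$). Then: (1) $\lambda_c$ has a ground state level (a least critical value), given by $\lambda_{1,c}:=\min_{u\in\mathcal S}\lambda_c(t_c(u)u)=\min_{u\in\mathcal N(\lambda_c)}\lambda_c(u)$. (2) If, in addition, $I_1,I_2$ are even, then $\lambda_c$ has a nondecreasing unbounded sequence of critical values, given by $\lambda_{n,c}:=\inf_{F\in\mathcal F_n}\sup_{u\in F}\lambda_c(t_c(u)u)$, $n\in\mathbb N$. In particular $\lambda_c$ has infinitely many pairs of critical points.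
   Context: $I_2$ is $\alpha$-homogeneous if $I_2(tu)=t^\alpha I_2(u)$ for all $t>0$, $u\in X\setminus\{0\}$. A map $X\to X^*$ is completely continuous if it sends weakly convergent sequences to norm convergent ones. Weak lower (upper) semicontinuity is understood along weakly convergent sequences. For $c\in\mathbb R$, $\lambda_c(u):=\dfrac{I_1(u)-c}{I_2(u)}$ for $u\in X\setminus\{0\}$, so $\lambda_c\in C^1(X\setminus\{0\})$; $\mathcal N(\lambda_c)=\{u\in X\setminus\{0\}:\lambda_c'(u)u=0\}$; $H(u):=I_1'(u)u-\alpha I_1(u)$ for $u\in X$. $\mathcal S$ is the unit sphere of $X$. For $u\neq0$, $t_c(u)>0$ denotes the unique critical point of $t\mapsto\lambda_c(tu)$ on $(0,\infty)$ (which exists and is unique under the hypotheses). $\mathcal F_n$ is the family of compact symmetric subsets $F\subset\mathcal S$ with Krasnoselskii genus $\gamma(F)\ge n$. (F1): for any $u\in X\setminus\{0\}$ there exists $s(u)\ge0$ such that $t\mapsto H(tu)$ is strictly increasing in $(0,s(u))$ and strictly decreasing in $(s(u),\infty)$. Moreover $\lim_{t\to\infty}H(tu)=-\infty$ uniformly on weakly compact subsets of $X\setminus\{0\}$. (F2): for any $u\in X\setminus\{0\}$ there exists $s(u)\ge0$ such that $t\mapsto H(tu)$ is strictly decreasing in $(0,s(u))$ and strictly increasing in $(s(u),\infty)$. Moreover $\lim_{t\to\infty}H(tu)=\infty$ uniformly on weakly compact subsets of $X\setminus\{0\}$. (F3): $I_1=J-K$, where $J,K\in C^1(X)$ are such that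 $K'$ is completely continuous, and there exist $C_1,C_2>0$, $\beta\ge\alpha$ and $\eta>1$ such that $J(u)\ge C_1\|u\|^\beta$ and $(J'(u)-J'(v))(u-v)\ge C_2(\|u\|^{\eta-1}-\|v\|^{\eta-1})(\|u\|-\|v\|)$ for all $u,v\in X$. Moreover, if (F2) holds then $\limsup_{\|u\|\to\infty}\frac{K(u)}{\|u\|^\alpha}\le0$. *)

(* Defs.v *)
From HB Require Import structures.
From mathcomp Require Import all_boot all_order all_algebra.
From mathcomp Require Import all_classical all_reals all_analysis.

Set Implicit Arguments.
Unset Strict Implicit.
Unset Printing Implicit Defensive.

Import Order.TTheory GRing.Theory Num.Theory.
Import numFieldNormedType.Exports.

Local Open Scope classical_set_scope.
Local Open Scope ring_scope.

Definition infinite_dimensional (R : realType) (X : normedModType R) : Prop :=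
  ~ exists (n : nat) (e : 'I_n -> X),
      forall x : X, exists a : 'I_n -> R, x = \sum_(i < n) a i *: e i.

Definition uniformly_convex (R : realType) (X : normedModType R) : Prop :=
  forall eps : R, 0 < eps -> exists2 delta : R, 0 < delta &
    forall x y : X, `|x| = 1 -> `|y| = 1 -> eps <= `|x - y| ->
      `|2^-1 *: (x + y)| <= 1 - delta.

Definition unit_sphere (R : realType) (X : normedModType R) : set X :=
  [set u | `|u| = 1].
Arguments unit_sphere {R} X.

(* Elements of X^* are represented by their underlying functions; the value is
   extended real so that it is not a default value on unbounded functions. *)
Definition dual_norm (R : realType) (X : normedModType R) (phi : X -> R) :
    \bar R :=
  ereal_sup [set (`|phi x|)%:E | x in [set x : X | `|x| <= 1]].

(* Continuously Frechet differentiable on the open set D; the derivative is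
   continuous as a map from D to X^* with the dual norm. *)
Definition C1_on (R : realType) (X : normedModType R) (D : set X)
    (f : X -> R) : Prop :=
  forall u, D u -> differentiable f u /\
    dual_norm (fun x => 'd f v x - 'd f u x) @[v --> u] --> 0%E.

Definition C1 (R : realType) (X : normedModType R) (f : X -> R) : Prop :=
  C1_on setT f.

Definition dual (R : realType) (X : normedModType R) : Type :=
  {phi : {linear X -> R} | continuous phi}.

Definition weak_topology (R : realType) (X : normedModType R) :
    topologicalType :=
  initial_topology
    (fun x : X => (fun phi : dual X => sval phi x) : {ptws dual X -> R}).

Definition weakly_compact (R : realType) (X : normedModType R) (A : set X) :
    Prop :=
  compact (A : set (weak_topology X)).

Definition weak_cvg (R : realType) (X : normedModType R) (u_ : nat -> X)
    (u : X) : Prop :=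
  forall phi : dual X, sval phi (u_ n) @[n --> \oo] --> sval phi u.

Lemma weak_cvgP (R : realType) (X : normedModType R) (u_ : nat -> X) (u : X) :
  weak_cvg u_ u <-> u_ @ \oo --> (u : weak_topology X).
Proof.
pose j (x : X) : {ptws dual X -> R} := fun phi => sval phi x.
have jE : weak_cvg u_ u <-> (j \o u_) @ \oo --> j u.
  split=> [h|h phi].
    apply/cvg_sup => phi U [/= _ [[V oV <-] /= Vu]] /filterS; apply.
    by have /h : nbhs (sval phi u) V by exact: open_nbhs_nbhs.
  have /cvg_sup/(_ phi) {}h := h.
  move=> A uA.
  pose ev (f : dual X -> R) := f phi.
  exact: (h _ (@initial_continuous _ _ ev (j u) A uA)).
rewrite jE; split=> [h A|h].
  rewrite nbhsE => -[B [[C oC <-] Bu] BA].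
  have : nbhs (j u) C by rewrite nbhsE; exists C.
  move=> /h hC; change (\forall n \near \oo, A (u_ n)).
  have {}hC : \forall n \near \oo, C (j (u_ n)) by exact: hC.
  by apply: filterS hC => n Cn; apply: BA.
by move=> A uA; exact: (h _ (@initial_continuous _ _ j u A uA)).
Qed.

(* T sends each u to (the underlying function of) an element of X^*. *)
Definition completely_continuous (R : realType) (X : normedModType R)
    (T : X -> X -> R) : Prop :=
  forall (u_ : nat -> X) (u : X), weak_cvg u_ u ->
    dual_norm (fun x => T (u_ n) x - T u x) @[n --> \oo] --> 0%E.

Definition weakly_lsc (R : realType) (X : normedModType R) (f : X -> R) :
    Prop :=
  forall (u_ : nat -> X) (u : X), weak_cvg u_ u ->
    ((f u)%:E <= limn_einf (fun n => (f (u_ n))%:E))%E.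

Definition weakly_usc (R : realType) (X : normedModType R) (f : X -> R) :
    Prop :=
  forall (u_ : nat -> X) (u : X), weak_cvg u_ u ->
    (limn_esup (fun n => (f (u_ n))%:E) <= (f u)%:E)%E.

Definition critical_point (R : realType) (X : normedModType R) (f : X -> R) :
    set X :=
  [set u | u != 0 /\ differentiable f u /\ forall v, 'd f u v = 0].

Definition critical_value (R : realType) (X : normedModType R) (f : X -> R) :
    set R :=
  f @` critical_point f.

Definition is_min (R : realType) (A : set R) (m : R) : Prop :=
  A m /\ lbound A m.

Definition symmetric_set (R : realType) (X : normedModType R) (F : set X) :
    Prop :=
  forall u, F u -> F (- u).

(* Krasnoselskii genus of a closed symmetric F not containing 0: the least k
   admitting an odd continuous map F -> R^k \ {0}, and +oo if there is none.
   As R^0 \ {0} is empty, only the empty set has genus 0. *)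
Definition genus (R : realType) (X : normedModType R) (F : set X) : \bar R :=
  ereal_inf [set (k%:R)%:E | k in [set k : nat |
    exists h : X -> 'rV[R]_k, {within F, continuous h} /\
      forall u, F u -> h (- u) = - h u /\ h u != 0]].

Definition genus_family (R : realType) (X : normedModType R) (n : nat) :
    set (set X) :=
  [set F | [/\ compact F, symmetric_set F, F `<=` unit_sphere X &
               ((n%:R)%:E <= genus F)%E]].
Arguments genus_family {R} X n.

(* [lambda_c] is only meaningful off 0. *)
Definition lambda (R : realType) (X : normedModType R) (I1 I2 : X -> R)
    (c : R) (u : X) : R :=
  (I1 u - c) / I2 u.

Definition Nehari (R : realType) (X : normedModType R) (f : X -> R) : set X :=
  [set u | u != 0 /\ 'd f u u = 0].

Definition Hfun (R : realType) (X : normedModType R) (alpha : R)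
    (I1 : X -> R) (u : X) : R :=
  'd I1 u u - alpha * I1 u.

Definition fiber_critical (R : realType) (X : normedModType R)
    (f : X -> R) (u : X) : set R :=
  [set t : R | 0 < t /\ is_derive t (1 : R) (fun s : R => f (s *: u)) 0].

(* The critical point t_c(u); [get] picks it, and is meaningful when
   [fiber_critical] is a singleton. *)
Definition tcrit (R : realType) (X : normedModType R) (I1 I2 : X -> R)
    (c : R) (u : X) : R :=
  get (fiber_critical (lambda I1 I2 c) u).

Definition fiber_lambda (R : realType) (X : normedModType R) (I1 I2 : X -> R)
    (c : R) (u : X) : R :=
  lambda I1 I2 c (tcrit I1 I2 c u *: u).

Definition minimax (R : realType) (X : normedModType R) (I1 I2 : X -> R)
    (c : R) (n : nat) : \bar R :=
  ereal_inf [set ereal_sup [set (fiber_lambda I1 I2 c u)%:E | u in F]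
            | F in genus_family X n].

Definition homogeneous (R : realType) (X : normedModType R) (alpha : R)
    (f : X -> R) : Prop :=
  forall (t : R) (u : X), 0 < t -> u != 0 -> f (t *: u) = t `^ alpha * f u.

Definition F1 (R : realType) (X : normedModType R) (alpha : R)
    (I1 : X -> R) : Prop :=
  (forall u : X, u != 0 -> exists s : R, [/\ 0 <= s,
     {in `]0, s[ &, {homo (fun t => Hfun alpha I1 (t *: u)) : x y / x < y}} &
     {in `]s, +oo[ &,
        {homo (fun t => Hfun alpha I1 (t *: u)) : x y /~ x < y}}]) /\
  (forall A : set X, weakly_compact A -> ~ A 0 ->
     forall M : R, \forall t \near +oo,
       forall u, A u -> Hfun alpha I1 (t *: u) < M).

Definition F2 (R : realType) (X : normedModType R) (alpha : R)
    (I1 : X -> R) : Prop :=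
  (forall u : X, u != 0 -> exists s : R, [/\ 0 <= s,
     {in `]0, s[ &, {homo (fun t => Hfun alpha I1 (t *: u)) : x y /~ x < y}} &
     {in `]s, +oo[ &,
        {homo (fun t => Hfun alpha I1 (t *: u)) : x y / x < y}}]) /\
  (forall A : set X, weakly_compact A -> ~ A 0 ->
     forall M : R, \forall t \near +oo,
       forall u, A u -> M < Hfun alpha I1 (t *: u)).

Definition norm_infty (R : realType) (X : normedModType R) : set_system X :=
  filter_from setT (fun M : R => [set u : X | M < `|u|]).
Arguments norm_infty {R} X.

Definition F3 (R : realType) (X : normedModType R) (alpha : R)
    (I1 : X -> R) : Prop :=
  exists J K : X -> R,
    [/\ C1 J, C1 K, (forall u, I1 u = J u - K u),
        completely_continuous (fun u => 'd K u : X -> R) &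
    (exists c1 c2 beta eta : R,
      [/\ 0 < c1, 0 < c2, alpha <= beta & 1 < eta] /\
      (forall u, c1 * `|u| `^ beta <= J u) /\
      (forall u v, c2 * (`|u| `^ (eta - 1) - `|v| `^ (eta - 1)) * (`|u| - `|v|)
                   <= 'd J u (u - v) - 'd J v (u - v))) /\
    (F2 alpha I1 ->
      (limf_esup (fun u => (K u / `|u| `^ alpha)%:E) (norm_infty X) <= 0)%E)].

(* Main.v *)
Require Import Defs.
From HB Require Import structures.
From mathcomp Require Import all_boot all_order all_algebra.
From mathcomp Require Import all_classical all_reals all_analysis.
From mathcomp Require Import ring lra.

(** The derivative of [lambda] along a ray through [u] has the sign of
    [H (t *: u) + alpha * c], and the shape of [H] makes this change sign exactly
    once, at [tcrit u].  So the reduced functional [fiber_lambda] is a maximum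
    over the ray when [c] is positive and a minimum when [c] is negative;
    multiplying [H] by the sign of [c] lets both cases be treated together.
    [H] is merely continuous, so [tcrit] need not be differentiable.  However,
    an extremum over the ray can be compared at two points through a single
    multiple ([Lam_increment]); together with the continuity of [tcrit] this
    yields [descent]: the reduced functional decreases along a direction of
    positive [slope] at the rate given by the differential of [lambda].  Being
    0-homogeneous, it needs no Lagrange multiplier on the unit sphere: where
    the slope vanishes in every direction, [tcrit u *: u] is a critical point of
    [lambda].

    Compactness comes from weak sequential compactness of balls
    ([weak_subseq]).  Uniform convexity makes every functional attain its norm
    on a closed subspace, and smoothness of the norm identifies the functional
    with a derivative of the norm at such a point; so countably many of these
    derivatives decide weak convergence of a given sequence, and almost shortest
    points in the hulls of its tails converge to the limit.  On sublevel sets of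
    the reduced functional in the sphere, [I2] is bounded away from 0
    ([I2_sublevel]).  This bounds [tcrit] and gives the Palais-Smale condition
    [palais_smale]: testing the equation with the difference to the weak limit
    and using the monotonicity of the differential of [J] turns weak convergence
    into convergence of norms.

    The ground state is obtained from Ekeland's principle on the sphere.  For
    the minimax levels the same principle is applied to the complete metric space
    of odd continuous maps from a compact symmetric set [F] to the sphere, whose
    images all have genus at least that of [F].  At an almost minimal map, an odd
    descent field glued by a partition of unity would lower the maximum of the
    reduced functional by one common step ([almost_critical]).
    The levels are finite because spheres of finite-dimensional subspaces have
    large genus.  They are unbounded because on a sublevel set finitely many of
    the functionals ['d I2 w] have no common zero ([I2_separating]), which bounds
    its genus.  An unbounded set of critical values gives infinitely many pairs.

    The lower bound on the genus is the Borsuk-Ulam theorem [borsuk_ulam], proved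
    by pairing, modulo 2, finely subdivided hemispheres with cup products of
    coboundaries: for any odd sign functions the pairing is 1 ([hemis_cup]), so
    in some small simplex all coordinates of an odd map change sign. *)

Set Implicit Arguments.
Unset Strict Implicit.
Unset Printing Implicit Defensive.

Import Order.TTheory GRing.Theory Num.Theory.
Import numFieldNormedType.Exports.

Local Open Scope classical_set_scope.
Local Open Scope ring_scope.

(** * Finite sums of limits *)

Lemma cvg_bigsum (K : numFieldType) (W : normedModType K) (T I : Type)
    (F : set_system T) {FF : Filter F} (r : seq I) (f : I -> T -> W)
    (a : I -> W) : (forall i, f i x @[x --> F] --> a i) ->
  \sum_(i <- r) f i x @[x --> F] --> \sum_(i <- r) a i.
Proof.
move=> fa; elim: r => [|i r IH].
  by rewrite big_nil; under eq_fun do rewrite big_nil; exact: cvg_cst.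
by rewrite big_cons; under eq_fun do rewrite big_cons; exact: cvgD.
Qed.

(** * Chains mod 2 of lists of points *)

Section Chains.
Variable V : Type.
Implicit Types (s : seq V) (c : seq (seq V)) (chi : seq V -> bool).

(** A chain mod 2 is a list of simplices, and only its pairing [ev] with cochains
    matters; identities between chains are stated as equalities of pairings. *)
Definition ev c chi : bool := \big[addb/false]_(s <- c) chi s.

(** The linear extension of an operator from simplices to chains. *)
Definition ext (f : seq V -> seq (seq V)) c := flatten [seq f s | s <- c].

(** The boundary is augmented: that of a vertex is the empty simplex, so that the
    boundary formula for a cone holds in every dimension. *)
Fixpoint bd s : seq (seq V) :=
  if s is v :: s' then s' :: [seq v :: t | t <- bd s'] else [::].

Lemma ev_cat c1 c2 chi : ev (c1 ++ c2) chi = ev c1 chi (+) ev c2 chi.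
Proof. exact: big_cat. Qed.

Lemma ev_map f c chi : ev [seq f s | s <- c] chi = ev c (chi \o f).
Proof. exact: big_map. Qed.

Lemma ev_cons s c chi : ev (s :: c) chi = chi s (+) ev c chi.
Proof. exact: big_cons. Qed.

Lemma ev_ext f c chi : ev (ext f c) chi = ev c (fun s => ev (f s) chi).
Proof. by rewrite /ev /ext big_flatten/= big_map. Qed.

Lemma ev_add c chi1 chi2 :
  ev c (fun s => chi1 s (+) chi2 s) = ev c chi1 (+) ev c chi2.
Proof. exact: big_split. Qed.

Lemma eq_ev c chi1 chi2 : chi1 =1 chi2 -> ev c chi1 = ev c chi2.
Proof. by move=> h; apply: eq_bigr => s _; exact: h. Qed.

Lemma ev_false c : ev c (fun=> false) = false.
Proof. by rewrite /ev big1_eq. Qed.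

Lemma ev_bd_cons v s chi :
  ev (bd (v :: s)) chi = chi s (+) ev (bd s) (chi \o cons v).
Proof. by rewrite /= ev_cons ev_map. Qed.

Lemma ev_ext_bd_cone v c chi :
  ev (ext bd [seq v :: t | t <- c]) chi =
  ev c chi (+) ev (ext bd c) (chi \o cons v).
Proof.
rewrite ev_ext ev_map -[RHS]/(_ (+) _) [in RHS]ev_ext -ev_add.
by apply: eq_ev => s; rewrite /= ev_cons ev_map.
Qed.

Lemma bdbd s chi : ev (ext bd (bd s)) chi = false.
Proof.
elim: s chi => [|v s IH] chi; first by rewrite /ev /ext big_nil.
rewrite /= -cat1s /ext map_cat flatten_cat ev_cat /= cats0.
by rewrite -/(ext bd _) ev_ext_bd_cone IH addbF addbb.
Qed.

End Chains.

Lemma all_bd (V : Type) (P : pred V) (s : seq V) :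
  all P s -> all (all P) (bd s).
Proof.
elim: s => [|v s IH] //= /andP[Pv Ps].
rewrite Ps all_map /=; apply: sub_all (IH Ps) => t Pt /=.
by rewrite Pv Pt.
Qed.

Lemma size_bd (V : eqType) (s t : seq V) : t \in bd s -> size s = (size t).+1.
Proof.
elim: s t => [|v s IH] t //=; rewrite inE => /orP[/eqP->//|].
by case/mapP => u /IH -> ->.
Qed.

Lemma ev_witness (V : eqType) (c : seq (seq V)) (chi : seq V -> bool) :
  ev c chi -> exists2 s, s \in c & chi s.
Proof.
elim: c => [|s c IH]; first by rewrite /ev big_nil.
rewrite ev_cons; case: (boolP (chi s)) => [chis _|_ /= /IH[t tc chit]].
  by exists s; rewrite ?mem_head.
by exists t => //; rewrite inE tc orbT.
Qed.

Lemma eq_ev_in (V : eqType) (c : seq (seq V)) (chi1 chi2 : seq V -> bool) :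
  {in c, chi1 =1 chi2} -> ev c chi1 = ev c chi2.
Proof. by move=> h; apply: eq_big_seq. Qed.

(** * Barycentric subdivision of the hemispheres of a cross-polytope *)

Section Subdivision.
Variables (R : realType) (V : lmodType R).
Implicit Types (s : seq V) (c : seq (seq V)).

Definition bary s : V := (size s)%:R^-1 *: \sum_(v <- s) v.

(** [n] is the number of vertices of the simplex to be subdivided. *)
Fixpoint sd (n : nat) s : seq (seq V) :=
  if n is m.+1 then [seq bary s :: t | t <- ext (sd m) (bd s)] else [:: s].

(** The subdivision is a chain map: the boundary of the cone from the
    barycentre over the subdivided boundary is its base, the rest being a
    subdivided double boundary. *)
Lemma bd_sd n s chi : size s = n.+1 ->
  ev (ext (@bd V) (sd n.+1 s)) chi = ev (ext (sd n) (bd s)) chi.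
Proof.
elim: n s chi => [|n IH] s chi ss.
  by case: s ss => [//|v [|//]] _ /=; rewrite /ext /ev /= !big_cons !big_nil.
rewrite [sd n.+2 s]/= ev_ext_bd_cone -[RHS]addbF; congr (_ (+) _).
rewrite 2!ev_ext.
rewrite (@eq_ev_in _ _ _
    (fun t => ev (bd t) (fun u => ev (sd n u) (chi \o cons (bary s))))).
  by rewrite -ev_ext bdbd.
move=> t /size_bd; rewrite ss => -[st].
by rewrite -ev_ext IH// ev_ext.
Qed.

Definition opps s := [seq - v | v <- s].

Lemma oppsK : involutive opps.
Proof. by move=> s; rewrite /opps -map_comp map_id_in// => v _ /=; rewrite opprK. Qed.

Lemma bary_opps s : bary (opps s) = - bary s.
Proof. by rewrite /bary size_map big_map sumrN scalerN. Qed.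

Lemma bd_opps s : bd (opps s) = [seq opps t | t <- bd s].
Proof.
by elim: s => [|v s IH] //=; rewrite IH -!map_comp.
Qed.

Lemma ext_map (f : seq V -> seq (seq V)) g c :
  ext f [seq g s | s <- c] = ext (f \o g) c.
Proof. by rewrite /ext -map_comp. Qed.

Lemma map_ext (f : seq V -> seq (seq V)) g c :
  [seq g s | s <- ext f c] = ext (fun s => [seq g t | t <- f s]) c.
Proof. by rewrite /ext map_flatten -map_comp. Qed.

Lemma sd_opps n s : sd n (opps s) = [seq opps t | t <- sd n s].
Proof.
elim: n s => [|n IH] s //=.
rewrite bary_opps bd_opps ext_map -map_comp map_ext map_ext.
congr flatten; apply: eq_map => t /=.
by rewrite IH -map_comp.
Qed.

Variable e : nat -> V.

(** Together with its antipode, the [n]-th hemisphere is the boundary of the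
    next one, which is the cone over this sphere. *)
Fixpoint hemi (n : nat) : seq (seq V) :=
  if n is m.+1 then
    [seq e n :: s | s <- hemi m ++ [seq opps s | s <- hemi m]]
  else [:: [:: e 0%N]].

Definition hemis (r n : nat) := iter r (ext (sd n.+1)) (hemi n).

Lemma hemisS r n : hemis r.+1 n = ext (sd n.+1) (hemis r n).
Proof. by []. Qed.

Lemma ext_cat f c1 c2 : ext f (c1 ++ c2) = ext f c1 ++ ext f c2 :> seq (seq V).
Proof. by rewrite /ext map_cat flatten_cat. Qed.

Lemma hemiS n :
  hemi n.+1 = [seq e n.+1 :: s | s <- hemi n ++ [seq opps s | s <- hemi n]].
Proof. by []. Qed.

(** The apex of the cone contributes the boundary of the sphere, which vanishes
    because antipodal contributions cancel. *)
Lemma bd_hemi n chi : ev (ext (@bd V) (hemi n.+1)) chi =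
  ev (hemi n) chi (+) ev (hemi n) (chi \o opps).
Proof.
elim: n chi => [|n IH] chi.
  rewrite /= /ext /ev /= !big_cons !big_nil /=.
  by case: (chi [:: e 0]); case: (chi [:: - e 0]); case: (chi _).
rewrite (hemiS n.+1) ev_ext_bd_cone (ev_cat (hemi n.+1)) (ev_map opps (hemi n.+1)).
set chi' := chi \o cons (e n.+2).
have bdN c : ev (ext (@bd V) [seq opps s | s <- c]) chi' =
    ev (ext (@bd V) c) (chi' \o opps).
  rewrite ext_map !ev_ext; apply: eq_ev => s.
  by rewrite /comp bd_opps ev_map.
rewrite ext_cat [ev _ chi']ev_cat bdN !IH.
rewrite (@eq_ev _ (hemi n) ((_ \o opps) \o opps) chi'); last first.
  by move=> s /=; rewrite oppsK.
by rewrite (addbC (ev (hemi n) (_ \o opps))) addbb addbF.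
Qed.

Lemma size_sd n s t : size s = n -> t \in sd n s -> size t = n.
Proof.
elim: n s t => [|n IH] s t ss /=; first by rewrite inE => /eqP->.
case/mapP => u /flattenP[_ /mapP[w /size_bd ws ->] uw] -> /=.
by rewrite (IH w)//; move: ws; rewrite ss => -[].
Qed.

Lemma size_hemi n s : s \in hemi n -> size s = n.+1.
Proof.
elim: n s => [|n IH] s /=; first by rewrite inE => /eqP->.
case/mapP => t; rewrite mem_cat => /orP[/IH st ->|/mapP[u /IH su ->] ->] /=.
  by rewrite st.
by rewrite size_map su.
Qed.

Lemma size_hemis r n s : s \in hemis r n -> size s = n.+1.
Proof.
elim: r s => [|r IH] s; first exact: size_hemi.
by case/flattenP => _ /mapP[t /IH st ->]; exact: size_sd.
Qed.

Lemma bd_hemis r n chi : ev (ext (@bd V) (hemis r n.+1)) chi =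
  ev (hemis r n) chi (+) ev (hemis r n) (chi \o opps).
Proof.
elim: r chi => [|r IH] chi; first exact: bd_hemi.
rewrite hemisS [LHS]ev_ext ev_ext.
rewrite (@eq_ev_in _ _ _ (fun t => ev (bd t) (fun u => ev (sd n.+1 u) chi))).
  rewrite -ev_ext IH hemisS !ev_ext; congr (_ (+) _).
  by apply: eq_ev => s; rewrite /comp sd_opps ev_map.
by move=> s /size_hemis ss; rewrite -ev_ext bd_sd// ev_ext.
Qed.

Lemma hemis0 r : hemis r 0 = [:: [:: e 0%N]].
Proof.
elim: r => [|r IH] //; rewrite hemisS IH /=.
by rewrite /ext /= /bary /= big_seq1 invr1 scale1r.
Qed.

(** The cup product of the coboundaries of [p (i.-1), ..., p 0]. *)
Fixpoint cup (p : nat -> V -> bool) (i : nat) s : bool :=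
  if i is j.+1 then
    if s is x :: s' then
      (p j x (+) p j (head x s')) && cup p j s'
    else false
  else true.

Lemma cup_true p i s j : cup p i s -> size s = i.+1 -> (j < i)%N ->
  exists x y, [/\ x \in s, y \in s & p j x != p j y].
Proof.
elim: i s => [//|i IH] [//|x s] /= /andP[pxy ps] [ss].
rewrite ltnS leq_eqVlt => /orP[/eqP->|ji].
  exists x, (head x s); split; rewrite ?mem_head//.
    by case: s {pxy ps} ss => [//|y s] _; rewrite !inE eqxx orbT.
  by move: pxy; do 2 case: (p i _).
have [y [z [ys zs pyz]]] := IH s ps ss ji.
by exists y, z; rewrite !inE ys zs !orbT.
Qed.

(** The cup product of the 0-cochain [p i] with [cup p i]. *)
Definition capc (p : nat -> V -> bool) i s : bool :=
  p i (head 0 s) && cup p i s.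

Lemma ev_andb b c (chi : seq V -> bool) :
  ev c (fun s => b && chi s) = b && ev c chi.
Proof. by case: b => //=; rewrite ev_false. Qed.

(** Leibniz's rule, by induction: the coboundary of [capc p i] is [cup p i.+1]
    because that of [cup p i], a coboundary itself, vanishes. *)
Lemma cobd_cup p i s : size s = i.+2 ->
  ev (bd s) (cup p i) = false /\ ev (bd s) (capc p i) = cup p i.+1 s.
Proof.
have step i' s' : size s' = i'.+2 -> ev (bd s') (cup p i') = false ->
    ev (bd s') (capc p i') = cup p i'.+1 s'.
  case: s' => [//|x [//|y s']] [ss']; rewrite !(ev_bd_cons x) => /eqP h.
  rewrite (@eq_ev _ _ (capc p i' \o cons x)
    (fun u => p i' x && (cup p i' \o cons x) u)); last by move=> u.
  rewrite ev_andb; move: h; rewrite eqbF_neg.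
  rewrite /capc [cup _ _.+1 _]/= [head _ _]/=.
  by case: (cup p i' (y :: s')); case: (ev _ _); case: (p i' x); case: (p i' y).
elim: i s => [|i IH] s ss.
  have h : ev (bd s) (cup p 0) = false.
    by case: s ss => [//|x [//|y [|//]]] _; rewrite /ev !big_cons big_nil.
  by split=> //; exact: step.
have h : ev (bd s) (cup p i.+1) = false.
  rewrite (@eq_ev_in _ _ _ (fun t => ev (bd t) (capc p i))).
    by rewrite -ev_ext bdbd.
  by move=> t /size_bd; rewrite ss => -[st]; rewrite (IH t _).2.
by split=> //; exact: step.
Qed.

Lemma cup_opps p i s (C : pred V) :
    (forall j v, C v -> p j (- v) = ~~ p j v) -> size s = i.+1 -> all C s ->
  cup p i (opps s) = cup p i s.
Proof.
move=> pN; elim: i s => [//|i IH] [//|x [//|y s]] [ss] /andP[Cx Cs].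
have Cy : C y by case/andP: Cs.
have -> : cup p i.+1 (opps [:: x, y & s]) =
  (p i (- x) (+) p i (- y)) && cup p i (opps (y :: s)) by [].
by rewrite (pN _ _ Cx) (pN _ _ Cy) IH ?addNb ?addbN ?negbK//= ss.
Qed.

(** The cup product of [n.+1] coboundaries is the coboundary of [capc p n], whose
    values on a simplex and on its antipode add up to the cup product of [n]
    coboundaries; so the pairing does not depend on [n], and it is 1 for [n = 0]. *)
Lemma hemis_cup p r n (C : pred V) :
    (forall j v, C v -> p j (- v) = ~~ p j v) ->
    (forall i s, (i <= n)%N -> s \in hemis r i -> all C s) ->
  ev (hemis r n) (cup p n).
Proof.
move=> pN; elim: n => [|n IH] HC; first by rewrite hemis0 /ev big_seq1.
rewrite (@eq_ev_in _ _ _ (fun t => ev (bd t) (capc p n))); last first.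
  by move=> t /size_hemis st; rewrite (cobd_cup _ _).2.
rewrite -ev_ext bd_hemis -ev_add.
rewrite (@eq_ev_in _ _ _ (cup p n)).
  by apply: IH => i s lin; apply: HC; exact: leqW.
move=> s sin; have ss := size_hemis sin.
have Cs : all C s by exact: (HC n).
rewrite /capc /= (cup_opps pN ss Cs).
case: s sin ss Cs => [//|x s] _ _ /= /andP[Cx _]; rewrite pN//.
by case: (p n x); case: (cup _ _ _).
Qed.

Definition bary_closed (C : pred V) :=
  forall s, s != [::] -> all C s -> C (bary s).

Lemma sd_all (C : pred V) n s t : bary_closed C -> size s = n -> all C s ->
  t \in sd n s -> all C t.
Proof.
move=> Cb; elim: n s t => [|n IH] s t ss Cs /=; first by rewrite inE => /eqP->.
case/mapP => u /flattenP[_ /mapP[w ws ->] uw] -> /=.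
rewrite Cb//; last by case: s ss {Cs ws}.
rewrite (IH w)//; last by exact: (allP (all_bd Cs)).
by have := size_bd ws; rewrite ss => -[].
Qed.

End Subdivision.

Section Mesh.
Variables (R : realType) (V : normedModType R).
Implicit Types s t : seq V.

Lemma ball_bary_closed (b : V) (d : R) :
  bary_closed (fun v => `|b - v| <= d).
Proof.
move=> s s0 /allP bs; rewrite /bary.
have n0 : (size s)%:R != 0 :> R by rewrite pnatr_eq0 size_eq0.
have -> : b = (size s)%:R^-1 *: \sum_(v <- s) b.
  rewrite big_const_seq count_predT iter_addr_0 -[b *+ _]scaler_nat scalerA.
  by rewrite mulVf// scale1r.
rewrite -scalerBr -sumrB normrZ ger0_norm ?invr_ge0//.
rewrite ler_pdivrMl; last by rewrite lt_neqAle eq_sym n0 ler0n.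
apply: le_trans (ler_norm_sum _ _ _) _.
apply: (@le_trans _ _ (\sum_(v <- s) d)).
  by rewrite big_seq [leRHS]big_seq; apply: ler_sum => v /bs.
by rewrite big_const_seq count_predT iter_addr_0 mulr_natl.
Qed.

(** The vertex itself contributes nothing to the average of the differences. *)
Lemma bary_dist s v (d : R) : v \in s ->
  (forall x y, x \in s -> y \in s -> `|x - y| <= d) ->
  `|bary s - v| <= (1 - (size s)%:R^-1) * d.
Proof.
move=> vs ds.
have n0 : (size s)%:R != 0 :> R.
  by rewrite pnatr_eq0 size_eq0; case: s vs {ds}.
have n1 : 0 < (size s)%:R :> R by rewrite lt_neqAle eq_sym n0 ler0n.
have -> : bary s - v = (size s)%:R^-1 *: \sum_(w <- s) (w - v).
  rewrite sumrB big_const_seq count_predT iter_addr_0 scalerBr.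
  by rewrite -[v *+ _]scaler_nat scalerA mulVf// scale1r.
rewrite normrZ ger0_norm ?invr_ge0// ler_pdivrMl// mulrA mulrBr mulr1 mulfV//.
rewrite (perm_big _ (perm_to_rem vs)) big_cons /= subrr add0r.
apply: le_trans (ler_norm_sum _ _ _) _.
apply: (@le_trans _ _ (\sum_(w <- rem v s) d)).
  rewrite big_seq [leRHS]big_seq; apply: ler_sum => w /mem_rem ws.
  exact: ds.
rewrite big_const_seq count_predT iter_addr_0 size_rem//.
by case: s n1 {vs ds n0} => [|x s]; rewrite ?ltxx//= -natr1 addrK mulr_natl.
Qed.

Lemma sd_mesh n s t (d : R) : size s = n -> t \in sd n s -> 0 <= d ->
  (forall x y, x \in s -> y \in s -> `|x - y| <= d) ->
  forall x y, x \in t -> y \in t -> `|x - y| <= (1 - n%:R^-1) * d.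
Proof.
elim: n s t => [|n IH] s t ss.
  by case: s ss => //= _; rewrite inE => /eqP->.
case/mapP => u /flattenP[_ /mapP[w ws ->] uw] -> d0 ds.
have sw : size w = n by have := size_bd ws; rewrite ss => -[].
have sub z : z \in w -> z \in s.
  have : all [in s] s by exact/allP.
  by move=> /all_bd/allP/(_ _ ws)/allP; apply.
have bd_u z : z \in u -> `|bary s - z| <= (1 - n.+1%:R^-1) * d.
  have : all (fun z => `|bary s - z| <= (1 - n.+1%:R^-1) * d) w.
    by apply/allP => v /sub vs; rewrite -ss; exact: bary_dist.
  by move=> /(sd_all (@ball_bary_closed _ _) sw)/(_ uw)/allP; apply.
have c0 : 0 <= (1 - n.+1%:R^-1) * d :> R.
  by rewrite mulr_ge0// subr_ge0 invf_le1// ler1n.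
move=> x y; rewrite !inE => /orP[/eqP->|xu] /orP[/eqP->|yu].
- by rewrite subrr normr0.
- exact: bd_u.
- by rewrite distrC; exact: bd_u.
- apply: le_trans (IH w u sw uw d0 _ x y xu yu) _.
    by move=> a b /sub ? /sub ?; exact: ds.
  rewrite ler_wpM2r// lerB//.
  have /=: size u = n by exact: size_sd uw.
  case: n {IH bd_u c0 sw uw ss} => [|n]; first by case: u xu {yu}.
  by move=> _; rewrite lef_pV2 ?posrE// ler_nat.
Qed.

End Mesh.

(** * The Borsuk-Ulam theorem *)

Section BorsukUlam.
Variables (R : realType) (n : nat).
Local Notation V := 'rV[R]_n.+1.

Definition l1sphere : set V := [set v | \sum_(j < n.+1) `|v ord0 j| = 1].

Lemma l1sphereN v : l1sphere v -> l1sphere (- v).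
Proof.
by rewrite /l1sphere /= => <-; apply: eq_bigr => j _; rewrite mxE normrN.
Qed.

Lemma l1sphere_neq0 v : l1sphere v -> v != 0.
Proof.
apply: contraPneq => ->; rewrite /l1sphere /= big1.
  by move/eqP; rewrite eq_sym oner_eq0.
by move=> j _; rewrite mxE normr0.
Qed.

Lemma compact_l1sphere : compact l1sphere.
Proof.
apply: bounded_closed_compact.
  exists 1; split => // M M1 v /= v1; apply: le_trans (ltW M1).
  rewrite [leLHS]/Num.Def.normr /= mx_normrE; apply: bigmax_le => // -[i j] _ /=.
  by rewrite ord1 -v1 (bigD1 j)//= lerDl sumr_ge0.
have cf : continuous (fun v : V => \sum_(j < n.+1) `|v ord0 j|).
  move=> v; apply: (@cvg_bigsum _ _ _ _ (nbhs v)) => j; apply: cvg_norm.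
  exact: coord_continuous.
exact: ((continuous_closedP _).1 cf [set x | x = 1] (@closed_eq _ 1)).
Qed.

(** The face of the cross-polytope given by a choice of signs; its convexity keeps
    subdivided simplices on the sphere. *)
Definition orthant (sg : 'I_n.+1 -> bool) : pred V := fun v =>
  [forall j, 0 <= (-1) ^+ sg j * v ord0 j] &&
  (\sum_(j < n.+1) (-1) ^+ sg j * v ord0 j == 1).

Lemma orthant_sphere sg v : orthant sg v -> l1sphere v.
Proof.
case/andP => /forallP sgv /eqP sv; rewrite /l1sphere /= -[RHS]sv.
apply: eq_bigr => j _.
by rewrite -[RHS]ger0_norm// normrM normr_sign mul1r.
Qed.

Lemma orthant_bary sg : bary_closed (orthant sg).
Proof.
move=> s s0 /allP Cs; have n0 : (size s)%:R != 0 :> R by rewrite pnatr_eq0 size_eq0.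
have E j : (-1) ^+ sg j * bary s ord0 j =
    (size s)%:R^-1 * \sum_(v <- s) (-1) ^+ sg j * v ord0 j.
  by rewrite /bary mxE summxE mulrCA mulr_sumr.
apply/andP; split.
  apply/forallP => j; rewrite E mulr_ge0 ?invr_ge0// big_seq sumr_ge0// => v vs.
  by have /andP[/forallP] := Cs _ vs.
apply/eqP; under eq_bigr do rewrite E.
rewrite -mulr_sumr exchange_big /=.
rewrite (eq_big_seq (fun=> 1)) => [|v /Cs/andP[_ /eqP->]//].
by rewrite big_const_seq count_predT iter_addr_0 mulVf.
Qed.

Definition vertex (j : nat) : V := delta_mx ord0 (inord j).

Lemma orthant_opps sg s : all (orthant sg) s ->
  all (orthant (fun j => ~~ sg j)) (opps s).
Proof.
rewrite all_map; apply: sub_all => v /andP[/forallP sgv /eqP sv] /=.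
have E j : (-1) ^+ (~~ sg j) * (- v) ord0 j = (-1) ^+ sg j * v ord0 j.
  by rewrite signrN mxE mulrNN.
apply/andP; split; first by apply/forallP => j; rewrite E.
by under eq_bigr do rewrite E; rewrite sv.
Qed.

(** The second part lets the sign of the next coordinate be chosen freely. *)
Lemma orthant_hemi i s : (i <= n)%N -> s \in hemi vertex i ->
  exists sg, all (orthant sg) s /\
    forall v, v \in s -> forall j : 'I_n.+1, (i < j)%N -> v ord0 j = 0.
Proof.
have vertexP i' (sg : 'I_n.+1 -> bool) : (i' <= n)%N -> sg (inord i') = false ->
    orthant sg (vertex i').
  move=> i'n sgi; apply/andP; split.
    apply/forallP => j; rewrite mxE eqxx/=.
    by case: eqP => [->|_]; rewrite ?sgi ?mulr0// expr0 mul1r.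
  rewrite (bigD1 (inord i'))//= big1 => [|j /negbTE ji].
    by rewrite mxE !eqxx sgi expr0 mul1r addr0.
  by rewrite mxE ji andbF mulr0.
have coord0 i' (j : 'I_n.+1) : (i' < j)%N -> vertex i' ord0 j = 0.
  move=> ij; have i'n := ltn_trans ij (ltn_ord j).
  by rewrite mxE eqxx/=; case: eqP ij => // ->; rewrite inordK ?ltnn.
elim: i s => [|i IH] s.
  move=> _; rewrite inE => /eqP ->; exists (fun=> false) => /=.
  split; first by rewrite andbT; exact: vertexP.
  by move=> v; rewrite inE => /eqP -> j; exact: coord0.
move=> lin; rewrite hemiS => /mapP[t tin ->].
have [sg [Ct t0]] : exists sg, all (orthant sg) t /\
    forall v, v \in t -> forall j : 'I_n.+1, (i < j)%N -> v ord0 j = 0.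
  move: tin; rewrite mem_cat => /orP[|/mapP[u]] /(IH _ (ltnW lin))[sg [Cu u0]].
    by exists sg.
  move=> ->; exists (fun j => ~~ sg j); split; first exact: orthant_opps.
  by move=> _ /mapP[w wu ->] j ij; rewrite mxE (u0 w)// oppr0.
pose sg' j := if j == inord i.+1 then false else sg j.
exists sg'; split; last first.
  move=> v; rewrite inE => /orP[/eqP-> j|vt j ij]; first exact: coord0.
  by apply: t0 => //; exact: ltn_trans ij.
rewrite /= vertexP//=; last by rewrite /sg' eqxx.
apply/allP => v vt; have /andP[/forallP Cv sv] := allP Ct v vt.
have E j : (-1) ^+ sg' j * v ord0 j = (-1) ^+ sg j * v ord0 j.
  rewrite /sg'; case: eqP => // ->.
  by rewrite (t0 v vt) ?mulr0// inordK.
apply/andP; split; first by apply/forallP => j; rewrite E.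
by under eq_bigr do rewrite E.
Qed.

Lemma hemi_diam i s x y : (i <= n)%N -> s \in hemi vertex i ->
  x \in s -> y \in s -> `|x - y| <= 2.
Proof.
move=> lin sin xs ys; have [sg [/allP Cs _]] := orthant_hemi lin sin.
have n1 z : z \in s -> `|z| <= 1.
  move=> /Cs/orthant_sphere z1.
  rewrite [leLHS]/Num.Def.normr /= mx_normrE; apply: bigmax_le => // -[k j] _ /=.
  by rewrite ord1 -z1 (bigD1 j)//= lerDl sumr_ge0.
by rewrite (le_trans (ler_normB _ _))// (natrD _ 1 1) lerD// n1.
Qed.

Lemma hemis_mesh r i s : (i <= n)%N -> s \in hemis vertex r i ->
  (exists sg, all (orthant sg) s) /\
  forall x y, x \in s -> y \in s -> `|x - y| <= 2 * (1 - n.+1%:R^-1) ^+ r.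
Proof.
move=> lin; have th0 : 0 <= 1 - n.+1%:R^-1 :> R.
  by rewrite subr_ge0 invf_le1// ler1n.
elim: r s => [|r IH] s.
  move=> sin; split; last by rewrite expr0 mulr1 => x y; exact: hemi_diam sin.
  by have [sg [Cs _]] := orthant_hemi lin sin; exists sg.
rewrite hemisS => /flattenP[_ /mapP[t tin ->] st].
have st' := size_hemis tin.
have [[sg Ct] dt] := IH _ tin; split.
  by exists sg; exact: (sd_all (@orthant_bary sg) st').
move=> x y xs ys; rewrite exprS mulrCA.
apply: le_trans (sd_mesh st' st _ dt xs ys) _; first by rewrite mulr_ge0 ?exprn_ge0.
rewrite ler_wpM2r ?mulr_ge0 ?exprn_ge0// lerB// lef_pV2 ?posrE// ler_nat.
by rewrite ltnS.
Qed.

(** One point of every antipodal pair, chosen to break ties where a coordinate of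
    an odd map vanishes. *)
Definition selected (v : V) : bool := v == get [set w | w = v \/ w = - v].

Lemma selectedN v : v != 0 -> selected (- v) = ~~ selected v.
Proof.
move=> v0; rewrite /selected opprK.
have -> : [set w | w = - v \/ w = v] = [set w | w = v \/ w = - v].
  by apply/seteqP; split => w /= [->|->]; [right|left|right|left].
have vN : v != - v.
  rewrite -subr_eq0 opprK -mulr2n -scaler_nat scaler_eq0 negb_or v0 andbT.
  by rewrite pnatr_eq0.
have /= : [set w | w = v \/ w = - v] (get [set w | w = v \/ w = - v]).
  by apply: getPex; exists v; left.
case=> ->; rewrite eqxx; last by rewrite (negbTE vN).
by apply/negbTE; rewrite eq_sym.
Qed.

(** The sign functions of the coordinates of an odd map all change within some
    simplex of every subdivision, and by compactness the map would have a
    coordinate of constant sign on any simplex of small diameter. *)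
Lemma borsuk_ulam k (G : V -> 'rV[R]_k) : (k <= n)%N ->
    {within l1sphere, continuous G} ->
    (forall v, l1sphere v -> G (- v) = - G v) ->
  exists2 v, l1sphere v & G v = 0.
Proof.
move=> kn cG oddG; apply: contrapT => /forall2NP G0.
pose p j v := match insub j with
  | Some i => (0 < G v ord0 i) || ((G v ord0 i == 0) && selected v)
  | None => selected v end.
have pN j v : `[< l1sphere v >] -> p j (- v) = ~~ p j v.
  move/asboolP => v1; rewrite /p; have vs := selectedN (l1sphere_neq0 v1).
  case: insubP => [i _ _|_] //; rewrite oddG// mxE vs oppr_gt0 oppr_eq0.
  by case: ltgtP => //=.
pose d r : R := 2 * (1 - n.+1%:R^-1) ^+ r.
have d0 : d r @[r --> \oo] --> 0.
  rewrite -(mulr0 2); apply: cvgMl_tmp; apply: cvg_expr.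
  by rewrite ger0_norm ?subr_ge0 ?invf_le1 ?ler1n// ltrBlDr ltrDl invr_gt0.
have [/compact_near_coveringP/near_covering_withinP T_cov _] :
  compact l1sphere /\ True by split=> //; exact: compact_l1sphere.
pose good r x := exists (j : 'I_k) (b : bool), forall y, l1sphere y ->
  `|x - y| <= d r -> p j y = b.
have /T_cov : forall x, l1sphere x ->
    \forall x' \near x & r \near \oo, l1sphere x' -> good r x'.
  move=> x x1; have [//|/eqP/rV0Pn[j Gj0]] := G0 x.
  pose a := `|G x ord0 j|.
  have a0 : 0 < a by rewrite normr_gt0.
  have cGj : (fun y => G y ord0 j) @ within l1sphere (nbhs x) --> G x ord0 j.
    apply: (@cvg_comp _ _ _ _ (fun M : 'rV_k => M ord0 j) _ (nbhs (G x))).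
      by move/subspace_continuousP: cG; apply.
    exact: coord_continuous.
  have /cvgrPdist_lt/(_ _ a0) := cGj.
  rewrite near_withinE => /nbhs_ballP[e /= e0 he].
  have e2 : 0 < e / 2 by rewrite divr_gt0.
  have /cvgrPdist_lt/(_ _ e2) de := d0.
  exists (ball x (e / 2), [set r | `|0 - d r| < e / 2]) => /=.
    by split=> //; exact: nbhsx_ballx.
  move=> [x' r] /= [xx' dr] x'1; exists j, (0 < G x ord0 j) => y y1 x'y.
  have : ball x e y.
    apply: (@ball_splitr _ _ x'); first exact: ball_sym.
    rewrite -ball_normE /= (le_lt_trans x'y)//; move: dr.
    by rewrite sub0r normrN; apply: le_lt_trans; exact: ler_norm.
  move=> /he/(_ y1) /=; rewrite /a /p => Ga.
  rewrite (_ : insub _ = Some j) ?valK//.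
  have [G0'|G0'|G0'] := ltgtP (G x ord0 j) 0; last by rewrite G0' eqxx in Gj0.
    have : G y ord0 j < 0.
      by move: Ga; rewrite (ltr0_norm G0') ltr_norml; lra.
    by case: ltgtP.
  have : 0 < G y ord0 j.
    by move: Ga; rewrite (gtr0_norm G0') ltr_norml; lra.
  by case: ltgtP.
case=> r _ /(_ r (leqnn r)) goodr.
have /ev_witness[s sin /cup_true ps] : ev (hemis vertex r k) (cup p k).
  apply: (hemis_cup (C := fun v => `[< l1sphere v >])) => // i s ik sin.
  have [[sg] + _] := hemis_mesh (leq_trans ik kn) sin.
  by apply: sub_all => v /orthant_sphere ?; exact/asboolP.
have [[sg /allP Cs] ds] := hemis_mesh kn sin.
have ss := size_hemis sin.
have [x xs] : exists x, x \in s.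
  by case: s ss {sin ps Cs ds} => [//|x s] _; exists x; rewrite mem_head.
have [j [b jb]] := goodr x (orthant_sphere (Cs _ xs)).
have [y [z [ys zs]]] := ps j ss (ltn_ord j).
by rewrite !jb ?eqxx//; by [exact: ds|apply: orthant_sphere (Cs _ _)].
Qed.

End BorsukUlam.

(** * Sequences and directional derivatives *)

Section Sequences.
Variable R : realType.

Lemma cvgseqP (V : normedModType R) (u : nat -> V) (l : V) :
  u n @[n --> \oo] --> l <->
  forall e : R, 0 < e -> exists N, forall n, (N <= n)%N -> `|u n - l| < e.
Proof.
split=> [/cvgrPdist_lt h e /h [N _ hN]|h].
  by exists N => n /hN /=; rewrite distrC.
apply/cvgrPdist_lt => e /h [N hN]; exists N => // n /= /hN.
by rewrite distrC.
Qed.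

Lemma cauchyseq_cvg (V : completeNormedModType R) (u : nat -> V) :
  (forall e : R, 0 < e -> exists N, forall n m, (N <= n)%N -> (N <= m)%N ->
     `|u n - u m| < e) ->
  exists l : V, u n @[n --> \oo] --> l.
Proof.
move=> h; apply/cvg_ex; apply: cauchy_cvg; apply: cauchy_exP => e e0.
have [N hN] := h e e0; exists (u N); exists N => // n /= Nn.
by rewrite -ball_normE /=; exact: hN.
Qed.

Lemma incr_lt (f : nat -> nat) m n :
  increasing_seq f -> (m < n)%N -> (f m < f n)%N.
Proof. by move=> fi; rewrite !ltnNge -(fi n m) leEnat. Qed.

Lemma incr_ge (f : nat -> nat) n : increasing_seq f -> (n <= f n)%N.
Proof.
move=> fi; elim: n => // n IH; apply: leq_ltn_trans IH _.
by have /increasing_seqP/(_ n) := fi.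
Qed.

Lemma cvg_subseq (V : normedModType R) (u : nat -> V) (l : V) f :
  increasing_seq f -> u n @[n --> \oo] --> l -> u (f n) @[n --> \oo] --> l.
Proof.
move=> fi /cvgseqP h; apply/cvgseqP => e /h[N hN]; exists N => n Nn.
by apply: hN; exact: leq_trans (incr_ge n fi).
Qed.

Lemma increasing_comp (f g : nat -> nat) :
  increasing_seq f -> increasing_seq g -> increasing_seq (f \o g).
Proof.
move=> fi gi; apply/increasing_seqP => n /=.
by apply: incr_lt => //; exact: incr_lt.
Qed.

Lemma bounded_cvg_subseq (a : nat -> R) (M : R) : (forall n, `|a n| <= M) ->
  exists2 f, increasing_seq f & exists l : R, a (f n) @[n --> \oo] --> l.
Proof.
move=> aM; have [|f fi /cvg_ex fl] := @bolzano_weierstrass R a.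
  exists M; split; first exact: num_real.
    by move=> x Mx n _ /=; exact: le_trans (ltW Mx).
by exists f.
Qed.

(** Subsequences are refined successively, one row at a time, and the [n]-th term
    is taken from the [n]-th refinement. *)
Lemma diagonal_subseq (a : nat -> nat -> R) (M : R) :
  (forall i n, `|a i n| <= M) ->
  exists2 f, increasing_seq f &
    forall i, exists l : R, a i (f n) @[n --> \oo] --> l.
Proof.
move=> aM.
have /choice[S HS] : forall ig : nat * (nat -> nat), exists f : nat -> nat,
    increasing_seq f /\ exists l : R, a ig.1 (ig.2 (f n)) @[n --> \oo] --> l.
  move=> [i g]; have [|f fi fl] := @bounded_cvg_subseq (a i \o g) M.
    by move=> n; exact: aM.
  by exists f.
pose F := fix F i := if i is j.+1 then F j \o S (i, F j) else S (0%N, id).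
have Fi i : increasing_seq (F i).
  elim: i => [|i IH]; first exact: (HS (0%N, id)).1.
  by apply: increasing_comp => //; exact: (HS (i.+1, F i)).1.
exists (fun n => F n n).
  apply/increasing_seqP => n /=; apply: incr_lt => //.
  by apply: incr_ge; exact: (HS (n.+1, F n)).1.
have Fl i : exists l : R, a i (F i n) @[n --> \oo] --> l.
  by case: i => [|i]; [have [_] := HS (0%N, id)|have [_] := HS (i.+1, F i)].
move=> i; have [l /cvgseqP il] := Fl i; exists l; apply/cvgseqP => e /il[N hN].
have Fk n : (i <= n)%N -> forall m, exists2 k, (m <= k)%N & F n m = F i k.
  move=> /subnK <-; elim: (n - i)%N => [|d IH] m; first by exists m.
  have [k mk Ek] := IH (S ((d + i).+1, F (d + i)%N) m).
  exists k => //; apply: leq_trans mk; apply: incr_ge.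
  exact: (HS (_, F (d + i)%N)).1.
exists (maxn N i) => n; rewrite geq_max => /andP[Nn iln].
by have [k nk ->] := Fk n iln n; apply: hN; exact: leq_trans nk.
Qed.

Lemma diff_dir (V : normedModType R) (f : V -> R) (u v : V) (e : R) :
  differentiable f u -> 0 < e ->
  exists2 d : R, 0 < d & forall h : R, `|h| < d ->
    `|f (u + h *: v) - f u - h * 'd f u v| <= e * `|h|.
Proof.
move=> df e0; have := derivable_nbhs (diff_derivable (v := v) df).
rewrite deriveE// => /eqaddoP/(_ e e0)/nbhs_ballP[d /= d0 hd].
exists d => // h hd'; have := hd h; rewrite /ball /= sub0r normrN => /(_ hd').
by rewrite !fctE /= opprD addrA [h *: v + u]addrC.
Qed.

Lemma linear_scale (V : lmodType R) (f : {linear V -> R}) (a : R) x :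
  f (a *: x) = a * f x.
Proof. exact: linearZ. Qed.

Lemma linear_line (V : lmodType R) (f : {linear V -> R}) x (a : R) y :
  f (x + a *: y) = f x + a * f y.
Proof. by rewrite linearD linear_scale. Qed.

(** The form in which convergence in the dual norm is used. *)
Lemma dual_norm_cvg0 (V : normedModType R) (T : Type) (F : set_system T)
    {FF : Filter F} (phi : T -> V -> R) :
    (forall t a x, phi t (a *: x) = a * phi t x) ->
    dual_norm (phi t) @[t --> F] --> 0%E ->
  forall e : R, 0 < e -> \forall t \near F, forall x, `|phi t x| <= e * `|x|.
Proof.
move=> phiZ phi0 e e0.
have : \forall t \near F, (dual_norm (phi t) < e%:E)%E.
  have : nbhs 0%E [set y : \bar R | (y < e%:E)%E].
    by apply: open_nbhs_nbhs; split; [exact: open_ereal_lt_ereal|rewrite /= lte_fin].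
  by move/phi0.
apply: filterS => t te x.
have [->|x0] := eqVneq x 0.
  by rewrite normr0 mulr0 -(scale0r 0) phiZ mul0r normr0.
have nx : 0 < `|x| by rewrite normr_gt0.
have : (`|phi t (`|x|^-1 *: x)|%:E <= dual_norm (phi t))%E.
  apply: ereal_sup_ubound; exists (`|x|^-1 *: x) => //=.
  by rewrite normrZ ger0_norm ?invr_ge0// mulVf// gt_eqF.
move=> /le_lt_trans/(_ te); rewrite lte_fin phiZ normrM ger0_norm ?invr_ge0//.
by rewrite mulrC ltr_pdivrMr// => /ltW.
Qed.

End Sequences.

(** * Uniformly convex spaces *)

Section UniformlyConvex.
Variables (R : realType) (X : completeNormedModType R).
Hypothesis ucX : uniformly_convex X.

(** Two points whose midpoint is almost on the sphere are almost on the sphere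
    themselves, so normalising them moves them little. *)
Lemma uc_ball (eps : R) : 0 < eps -> exists2 delta : R, 0 < delta &
  forall x y : X, `|x| <= 1 -> `|y| <= 1 -> 1 - delta < `|2^-1 *: (x + y)| ->
    `|x - y| < eps.
Proof.
move=> e0; have e2 : 0 < eps / 2 by rewrite divr_gt0.
have [d0 d0gt0 hd0] := ucX e2.
(* Normalising moves each point by at most [2 * d]: the midpoint then has norm
   above [1 - 3 * d], and the distance changes by at most [4 * d]. *)
pose d := Num.min (d0 / 3) (Num.min (eps / 8) (1 / 4)).
have dgt0 : 0 < d by rewrite !lt_min !divr_gt0.
have [dd0 [de d1]] : d <= d0 / 3 /\ d <= eps / 8 /\ d <= 1 / 4.
  by rewrite /d !ge_min !lexx ?orbT.
exists d => // x y x1 y1 xy.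
have near1 (a b : X) : `|a| <= 1 -> `|b| <= 1 -> 1 - d < `|2^-1 *: (a + b)| ->
    [/\ a != 0, `| `|a|^-1 *: a| = 1 & `|a - `|a|^-1 *: a| <= 2 * d].
  move=> a1 b1; rewrite normrZ ger0_norm ?invr_ge0// => ab.
  have aab := ler_normD a b.
  have ageq : 1 - 2 * d <= `|a| by lra.
  have agt0 : 0 < `|a| by lra.
  have an : `|a| != 0 by rewrite gt_eqF.
  split; first by rewrite -normr_gt0.
    by rewrite normrZ ger0_norm ?invr_ge0// mulVf.
  rewrite -{1}[a]scale1r -scalerBl normrZ -{2}[`|a|]ger0_norm// -normrM.
  by rewrite mulrBl mul1r mulVf// ler0_norm; lra.
have [x0 nx dx] := near1 x y x1 y1 xy.
have [y0 ny dy] : [/\ y != 0, `| `|y|^-1 *: y| = 1 & `|y - `|y|^-1 *: y| <= 2 * d].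
  by apply: (near1 y x) => //; rewrite (addrC y).
set x' := _ *: x in nx dx; set y' := _ *: y in ny dy.
have x'y' : `|x' - y'| < eps / 2.
  rewrite ltNge; apply/negP => /(hd0 x' y' nx ny).
  have : `|2^-1 *: (x + y)| <= `|2^-1 *: (x' + y')| + 2 * d.
    have -> : 2^-1 *: (x + y) = 2^-1 *: (x' + y') + 2^-1 *: ((x - x') + (y - y')).
      by rewrite -scalerDr addrACA !subrKC.
    apply: le_trans (ler_normD _ _) _; rewrite lerD2l normrZ ger0_norm ?invr_ge0//.
    by have := ler_normD (x - x') (y - y'); lra.
  by lra.
have -> : x - y = (x' - y') + (x - x') + - (y - y').
  by rewrite (addrAC x') subrKC opprB addrA subrK.
have := ler_normD ((x' - y') + (x - x')) (- (y - y')).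
have := ler_normD (x' - y') (x - x'); rewrite normrN; lra.
Qed.

(** Scaled into the unit ball, two late terms have a midpoint of norm close to 1,
    so they are close by uniform convexity. *)
Lemma uc_cvg (p : nat -> X) (d : R) :
  (forall e : R, 0 < e -> exists N, forall n m, (N <= n)%N -> (N <= m)%N ->
     `|p n| <= d + e /\ d - e <= `|2^-1 *: (p n + p m)|) ->
  exists l : X, p n @[n --> \oo] --> l.
Proof.
move=> hp; apply: cauchyseq_cvg => eps eps0.
have [d0|d0] := leP d 0.
  have e2 : 0 < eps / 4 by rewrite divr_gt0.
  have [N hN] := hp _ e2; exists N => n m Nn Nm.
  have [pn _] := hN n m Nn Nm; have [pm _] := hN m n Nm Nn.
  by have := ler_normB (p n) (p m); lra.
have ed : 0 < eps / (2 * d) by rewrite divr_gt0// mulr_gt0.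
have [dl dl0 hdl] := uc_ball ed.
pose e := Num.min d (dl * d / 4).
have e0 : 0 < e by rewrite lt_min d0 divr_gt0// mulr_gt0.
have [ed' edl] : e <= d /\ e <= dl * d / 4 by rewrite /e !ge_min !lexx orbT.
have [N hN] := hp _ e0; exists N => n m Nn Nm.
have [pn pnm] := hN n m Nn Nm; have [pm _] := hN m n Nm Nn.
have s0 : 0 < d + e by rewrite addr_gt0.
have sn : 0 <= (d + e)^-1 by rewrite invr_ge0 ltW.
have : `|(d + e)^-1 *: p n - (d + e)^-1 *: p m| < eps / (2 * d).
  apply: hdl.
  - by rewrite normrZ ger0_norm// ler_pdivrMl// mulr1.
  - by rewrite normrZ ger0_norm// ler_pdivrMl// mulr1.
  - rewrite -scalerDr scalerA mulrC -scalerA normrZ ger0_norm//.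
    rewrite mulrC ltr_pdivlMr//; apply: lt_le_trans pnm.
    by rewrite -subr_gt0; nra.
rewrite -scalerBr normrZ ger0_norm// ltr_pdivrMl// => /lt_le_trans; apply.
rewrite mulrA ler_pdivrMr ?mulr_gt0//; nra.
Qed.

End UniformlyConvex.

Section WeakCompactness.
Variables (R : realType) (X : completeNormedModType R).
Hypothesis ucX : uniformly_convex X.
Hypothesis normC1 : C1_on [set u : X | u != 0] (fun u : X => `|u|).

Definition dnorm (v : X) : {linear X -> R} := 'd (fun u : X => `|u|) v.

Lemma diff_norm v : v != 0 -> differentiable (fun u : X => `|u|) v.
Proof. by move=> /normC1[]. Qed.

Lemma dnorm_continuous v : v != 0 -> continuous (dnorm v).
Proof. by move=> /diff_norm; exact: diff_continuous. Qed.

Lemma le_addeps (a b : R) : (forall e : R, 0 < e -> a <= b + e) -> a <= b.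
Proof. by move=> h; apply/ler_addgt0Pr. Qed.

Lemma dnorm_le v x : v != 0 -> `|dnorm v x| <= `|x|.
Proof.
move=> v0; apply: le_addeps => e e0.
have [d d0 hd] := diff_dir x (diff_norm v0) e0.
have d2 : 0 < d / 2 by rewrite divr_gt0.
have := hd (d / 2); rewrite gtr0_norm// => /(_ _)/wrap[]; first by lra.
rewrite -/(dnorm v) => h.
have h1 : `| `|v + (d / 2) *: x| - `|v| | <= (d / 2) * `|x|.
  apply: le_trans (ler_dist_dist _ _) _.
  by rewrite addrAC subrr add0r normrZ gtr0_norm.
have : (d / 2) * `|dnorm v x| <= (d / 2) * (`|x| + e).
  rewrite -[d / 2 in leLHS]gtr0_norm// -normrM.
  move: h h1; rewrite !ler_norml; lra.
by rewrite ler_pM2l.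
Qed.

Lemma dnorm_self v : v != 0 -> dnorm v v = `|v|.
Proof.
move=> v0; apply/eqP; rewrite -subr_eq0 -normr_eq0 eq_le normr_ge0 andbT.
apply: le_addeps => e e0; rewrite add0r.
have [d d0 hd] := diff_dir v (diff_norm v0) e0.
have d2 : 0 < d / 2 by rewrite divr_gt0.
have := hd (d / 2); rewrite gtr0_norm// => /(_ _)/wrap[]; first by lra.
rewrite -/(dnorm v) -{1}[v]scale1r -scalerDl normrZ ger0_norm; last by lra.
have -> : (1 + d / 2) * `|v| - `|v| - d / 2 * dnorm v v =
  d / 2 * (`|v| - dnorm v v) by ring.
by rewrite normrM gtr0_norm// mulrC distrC ler_pM2r.
Qed.

Definition dnorm_dual v (v0 : v != 0) : dual X :=
  exist _ (dnorm v) (dnorm_continuous v0).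

(** The function [r * `|w + t *: x| - phi (w + t *: x)] of [t] has a minimum at 0. *)
Lemma support_dnorm (phi : {linear X -> R}) (r : R) (w x : X) :
    0 < r -> w != 0 -> phi w = r * `|w| ->
    (forall t : R, phi (w + t *: x) <= r * `|w + t *: x|) ->
  phi x = r * dnorm w x.
Proof.
move=> r0 w0 phiw hle.
suff key (e : R) : 0 < e -> `|phi x - r * dnorm w x| <= 0 + e.
  by apply/eqP; rewrite -subr_eq0 -normr_eq0 eq_le normr_ge0 andbT le_addeps.
move=> e0; rewrite add0r.
have er : 0 < e / r by rewrite divr_gt0.
have [d d0 hd] := diff_dir x (diff_norm w0) er.
have d2 : 0 < d / 2 by rewrite divr_gt0.
have hp := hd (d / 2); have hm := hd (- (d / 2)).
move: hp hm; rewrite normrN gtr0_norm// -/(dnorm w).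
move=> /(_ _)/wrap[]; first by lra.
move=> hp /(_ _)/wrap[]; first by lra.
move=> hm; have lp := hle (d / 2); have lm := hle (- (d / 2)).
rewrite !(linear_line phi) phiw in lp lm.
have rer : r * (e / r) = e by rewrite mulrC divfK// gt_eqF.
rewrite -(ler_pM2l d2) -{1}[d / 2]gtr0_norm// -normrM.
move: hp hm; set q := e / r in er rer *; set D := dnorm w x => hp hm.
have hp' : `|w + (d / 2) *: x| <= `|w| + (d / 2) * D + q * (d / 2).
  by move: hp; rewrite ler_norml; lra.
have hm' : `|w + - (d / 2) *: x| <= `|w| - (d / 2) * D + q * (d / 2).
  by move: hm; rewrite ler_norml; lra.
have {}hp' := ler_wpM2l (ltW r0) hp'; have {}hm' := ler_wpM2l (ltW r0) hm'.
have Ep : r * (`|w| + (d / 2) * D + q * (d / 2)) =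
  r * `|w| + d / 2 * (r * D) + d / 2 * e by rewrite -rer; ring.
have Em : r * (`|w| - (d / 2) * D + q * (d / 2)) =
  r * `|w| - d / 2 * (r * D) + d / 2 * e by rewrite -rer; ring.
rewrite Ep in hp'; rewrite Em in hm'; rewrite mulrBr.
by rewrite ler_norml; lra.
Qed.

Section RationalSpan.
Variable u : nat -> X.

Definition qcomb (s : seq rat) : X := \sum_(i < size s) ratr (nth 0 s i) *: u i.

Lemma qcombE s N : (size s <= N)%N ->
  qcomb s = \sum_(i < N) ratr (nth 0 s i) *: u i.
Proof.
move=> sN; rewrite /qcomb (big_ord_widen N (fun i => ratr (nth 0 s i) *: u i))//.
rewrite big_mkcond /=; apply: eq_bigr => i _.
by case: ltnP => // si; rewrite nth_default// rmorph0 scale0r.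
Qed.

Lemma qcombDZ s t (q : rat) : exists s', qcomb s' = qcomb s + ratr q *: qcomb t.
Proof.
pose N := maxn (size s) (size t).
exists (mkseq (fun i => nth 0 s i + q * nth 0 t i) N).
rewrite (@qcombE s N) ?leq_maxl// (@qcombE t N) ?leq_maxr//.
rewrite (@qcombE _ N) ?size_mkseq// scaler_sumr -big_split /=.
apply: eq_bigr => i _; rewrite nth_mkseq// rmorphD rmorphM scalerDl.
by rewrite scalerA.
Qed.

Lemma qcomb_u n : exists s, qcomb s = u n.
Proof.
exists (rcons (nseq n 0) 1); rewrite (@qcombE _ n.+1) ?size_rcons ?size_nseq//.
rewrite big_ord_recr /= nth_rcons size_nseq ltnn eqxx rmorph1 scale1r.
rewrite big1 ?add0r// => i _.
by rewrite nth_rcons size_nseq ltn_ord nth_nseq ltn_ord rmorph0 scale0r.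
Qed.

Lemma qcomb0 : qcomb [::] = 0. Proof. by rewrite /qcomb big_ord0. Qed.

(** By density of the rationals. *)
Lemma qcomb_line (phi : dual X) (r : R) s t (a : R) : 0 <= r ->
    (forall s, sval phi (qcomb s) <= r * `|qcomb s|) ->
  sval phi (qcomb s + a *: qcomb t) <= r * `|qcomb s + a *: qcomb t|.
Proof.
move=> r0 hphi; set f := sval phi; apply: le_addeps => e e0.
pose K := `|f (qcomb t)| + r * `|qcomb t| + 1.
have K0 : 0 < K by rewrite ltr_wpDl// addr_ge0// mulr_ge0.
have eK : 0 < e / K by rewrite divr_gt0.
have [q] : exists q : rat, ratr q \in `]a, a + e / K[%R.
  by apply: rat_in_itvoo; rewrite ltrDl.
rewrite in_itv/= => /andP[aq qa].
have [s' Es'] := qcombDZ s t q.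
have := hphi s'; rewrite Es' -/f !(linear_line f) => h.
have : r * `|qcomb s + ratr q *: qcomb t| <=
    r * (`|qcomb s + a *: qcomb t| + (ratr q - a) * `|qcomb t|).
  rewrite ler_wpM2l//.
  have -> : qcomb s + ratr q *: qcomb t =
      (qcomb s + a *: qcomb t) + (ratr q - a) *: qcomb t.
    by rewrite scalerBl -addrA subrKC.
  apply: le_trans (ler_normD _ _) _.
  by rewrite lerD2l normrZ ger0_norm// subr_ge0 ltW.
have qK : (ratr q - a) * K <= e.
  by rewrite -ler_pdivlMr//; lra.
have qa0 : 0 <= ratr q - a by rewrite subr_ge0 ltW.
have fn : - f (qcomb t) <= `|f (qcomb t)| by rewrite -normrN ler_norm.
have := ler_wpM2l qa0 fn.
move: qK; rewrite /K; lra.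
Qed.

End RationalSpan.

(** A maximising sequence of a functional on the rational span converges, by
    uniform convexity, to a point where it attains its norm; so on the span the
    functional is a multiple of a derivative of the norm, and these depend
    continuously on the point. *)
Lemma qcomb_dense (u : nat -> X) (phi : dual X) (e : R) : 0 < e ->
  (forall n, sval phi (u n) = 0) \/
  exists (r : R) s, qcomb u s != 0 /\ forall n,
    `|sval phi (u n) - r * dnorm (`|qcomb u s|^-1 *: qcomb u s) (u n)| <=
      e * `|u n|.
Proof.
move=> e0; set f := sval phi.
have fc : continuous f by exact: (svalP phi).
have [k k0 fk] : exists2 k : R, 0 < k & forall x, `|f x| <= k * `|x|.
  have [k [kr hk]] := (linear_boundedP _).1 ((linear_bounded_continuous _).2 fc).
  exists (Num.max k 0 + 1); first by rewrite ltr_wpDl// le_max lexx orbT.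
  by apply: hk; rewrite ltr_pwDr// le_max lexx.
case: (pselect (forall s, f (qcomb u s) = 0)) => [f0|/existsNP[s0 fs0]].
  by left => n; have [s <-] := qcomb_u u n.
right; pose S := [set x : R | exists s, qcomb u s != 0 /\ x = f (qcomb u s) / `|qcomb u s|].
have f0 : f 0 = 0 by rewrite -(scale0r 0) linear_scale mul0r.
have [s1 fs1] : exists s, 0 < f (qcomb u s).
  have [lt0|gt0|//] := ltgtP (f (qcomb u s0)) 0; last by exists s0.
  have [s Es] := qcombDZ u [::] s0 (-1); exists s.
  by rewrite Es (linear_line f) qcomb0 f0 add0r rmorphN1 mulN1r oppr_gt0.
have qn0 s : 0 < f (qcomb u s) -> qcomb u s != 0.
  by apply: contraTneq => ->; rewrite f0 ltxx.
have supS : has_sup S.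
  split; first by exists (f (qcomb u s1) / `|qcomb u s1|), s1; split=> //; exact: qn0.
  exists k => _ [s [qs ->]]; rewrite ler_pdivrMr ?normr_gt0//.
  exact: le_trans (ler_norm _) (fk _).
pose r := sup S.
have r0 : 0 < r.
  apply: (@lt_le_trans _ _ (f (qcomb u s1) / `|qcomb u s1|)).
    by rewrite divr_gt0// normr_gt0 qn0.
  by apply: sup_upper_bound => //; exists s1; split=> //; exact: qn0.
have fr s : f (qcomb u s) <= r * `|qcomb u s|.
  have [->|q0] := eqVneq (qcomb u s) 0; first by rewrite f0 normr0 mulr0.
  rewrite -ler_pdivrMr ?normr_gt0//; apply: sup_upper_bound => //.
  by exists s.
have /choice[s Hs] : forall m : nat, exists s,
    qcomb u s != 0 /\ r - @harmonic R m < f (qcomb u s) / `|qcomb u s|.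
  move=> m; have m0 : 0 < @harmonic R m by rewrite invr_gt0.
  by have [_ [s [qs ->]] hs] := sup_adherent m0 supS; exists s.
pose q m := qcomb u (s m); pose w m := `|q m|^-1 *: q m.
have nq m : 0 < `|q m| by rewrite normr_gt0 (Hs m).1.
have w1 m : `|w m| = 1.
  by rewrite normrZ ger0_norm ?invr_ge0// mulVf// gt_eqF.
have fw m : r - @harmonic R m < f (w m) by rewrite linear_scale mulrC (Hs m).2.
have line m t a : f (w m + a *: qcomb u t) <= r * `|w m + a *: qcomb u t|.
  have -> : w m + a *: qcomb u t = `|q m|^-1 *: (q m + (a * `|q m|) *: qcomb u t).
    by rewrite scalerDr scalerA mulrCA mulVf ?mulr1// gt_eqF.
  rewrite linear_scale normrZ ger0_norm ?invr_ge0// mulrCA ler_pM2l ?invr_gt0//.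
  exact: qcomb_line (ltW r0) fr.
have inv_small (x : R) : 0 < x -> exists N, forall n, (N <= n)%N -> @harmonic R n < x.
  move=> x0; have [N hN] := (cvgseqP _ _).1 (@cvg_harmonic R) x x0.
  by exists N => n /hN; rewrite subr0 ger0_norm ?invr_ge0.
have [l wl] : exists l : X, w n @[n --> \oo] --> l.
  apply: (uc_cvg ucX (d := 1)) => e' e'0.
  have [N hN] := inv_small _ (mulr_gt0 r0 e'0); exists N => n m Nn Nm.
  split; first by rewrite w1 lerDl ltW.
  rewrite -(ler_pM2l r0); have := line n (s m) (`|q m|^-1).
  rewrite -/(q m) -/(w m) => h.
  have {}h : f (w n) + f (w m) <= r * `|w n + w m| by rewrite -linearD.
  rewrite normrZ ger0_norm ?invr_ge0//.
  have := hN n Nn; have := hN m Nm; have := fw n; have := fw m; lra.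
have nl : `|l| = 1.
  have h : `|w n| @[n --> \oo] --> (1 : R).
    by under eq_fun do rewrite w1; exact: cvg_cst.
  exact: (cvg_unique _ (cvg_norm wl) h).
have l0 : l != 0 by rewrite -normr_gt0 nl.
have fwl : f (w n) @[n --> \oo] --> f l by apply: continuous_cvg => //; exact: fc.
have fl : f l = r.
  apply/eqP; rewrite eq_le; apply/andP; split; apply: le_addeps => e' e'0.
    have [N hN] := (cvgseqP _ _).1 fwl e' e'0; have := hN N (leqnn _).
    have := line N [::] 0; rewrite scale0r addr0 w1 mulr1 ltr_norml; lra.
  have e2 : 0 < e' / 2 by rewrite divr_gt0.
  have [N hN] := (cvgseqP _ _).1 fwl _ e2; have [N' hN'] := inv_small _ e2.
  have := hN _ (leq_maxl N N'); have := hN' _ (leq_maxr N N').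
  have := fw (maxn N N'); rewrite ltr_norml; lra.
have lline t a : f (l + a *: qcomb u t) <= r * `|l + a *: qcomb u t|.
  apply: le_addeps => e' e'0.
  have e2 : 0 < e' / (k + r) by rewrite divr_gt0// addr_gt0.
  have [N hN] := (cvgseqP _ _).1 wl _ e2; have {hN} hN := hN N (leqnn _).
  have fN := fk (l - w N).
  have h := line N t a.
  have E : l + a *: qcomb u t = (w N + a *: qcomb u t) + (l - w N).
    by rewrite addrAC subrKC.
  have E' : w N + a *: qcomb u t = (l + a *: qcomb u t) - (l - w N).
    by rewrite E addrK.
  have h1 : `|w N + a *: qcomb u t| <= `|l + a *: qcomb u t| + `|l - w N|.
    by rewrite E'; exact: ler_normB.
  have : f (l + a *: qcomb u t) <= f (w N + a *: qcomb u t) + k * `|l - w N|.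
    rewrite {1}E linearD lerD2l; exact: le_trans (ler_norm _) fN.
  move: hN; rewrite distrC ltr_pdivlMr ?addr_gt0// => hN.
  have := ler_wpM2l (ltW r0) h1; lra.
have [d0 dcv] := normC1 l0.
have er : 0 < e / r by rewrite divr_gt0.
have lin v a x : 'd (fun u : X => `|u|) v (a *: x) - 'd (fun u : X => `|u|) l (a *: x) =
    a * ('d (fun u : X => `|u|) v x - 'd (fun u : X => `|u|) l x).
  by rewrite (linear_scale (dnorm v)) (linear_scale (dnorm l)) mulrBr.
have nearl := @dual_norm_cvg0 _ _ _ _ _ _ lin dcv _ er.
have [N _ hN] := wl _ (nearl _).
exists r, (s N); split; first exact: (Hs N).1.
move=> n; have [t Et] := qcomb_u u n.
rewrite -Et (support_dnorm r0 l0 _ (lline t)); last by rewrite fl nl mulr1.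
rewrite -mulrBr normrM gtr0_norm// distrC.
have := hN N (leqnn _) (qcomb u t); rewrite /= -/(dnorm _) -/(dnorm l).
by rewrite -(ler_pM2l r0) mulrA (mulrCA r) mulfV ?gt_eqF// mulr1.
Qed.

(** A substitute for the convex hull of a tail: uniform convexity only sees
    midpoints. *)
Inductive mid_hull (u : nat -> X) (m : nat) : X -> Prop :=
| mid_base k : (m <= k)%N -> mid_hull u m (u k)
| mid_mid p q : mid_hull u m p -> mid_hull u m q ->
    mid_hull u m (2^-1 *: (p + q)).

Lemma mid_hull_sub u m n p : (m <= n)%N -> mid_hull u n p -> mid_hull u m p.
Proof.
move=> mn; elim=> [k nk|p' q' _ hp _ hq]; last exact: mid_mid.
by apply: mid_base; exact: leq_trans nk.
Qed.

Lemma mid_hull_close u m p (phi : {linear X -> R}) (l e : R) :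
  (forall k, (m <= k)%N -> `|phi (u k) - l| <= e) -> mid_hull u m p ->
  `|phi p - l| <= e.
Proof.
move=> h; elim=> [k /h//|p' q' _ hp _ hq].
rewrite linear_scale linearD; move: hp hq; rewrite !ler_norml; lra.
Qed.

(** Points of almost minimal norm in the hulls of the tails of the sequence
    form a Cauchy sequence by uniform convexity, and every functional that
    converges along the sequence has the same limit along these points. *)
Lemma weak_limit (u : nat -> X) (M : R) : (forall n, `|u n| <= M) ->
    (forall phi : dual X, exists l : R, sval phi (u n) @[n --> \oo] --> l) ->
  exists l, weak_cvg u l.
Proof.
move=> uM ul.
pose N m := [set `|p| | p in mid_hull u m].
have N0 m : N m !=set0 by exists `|u m|, (u m) => //; exact: mid_base.
have infN m : has_inf (N m).
  by split=> //; exists 0 => _ [p _ <-].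
pose d m := inf (N m).
have dle m p : mid_hull u m p -> d m <= `|p|.
  by move=> mp; apply: ge_inf; [exact: (infN m).2|exists p].
have dM m : d m <= M by apply: le_trans (uM m); apply: dle; exact: mid_base.
have dnd : {homo d : n m / (n <= m)%N >-> n <= m}.
  move=> n m nm; apply: lb_le_inf => // _ [p mp <-]; apply: dle.
  exact: mid_hull_sub mp.
have dcv : d n @[n --> \oo] --> sup (range d).
  apply: nondecreasing_cvgn => //; exists M => _ [n _ <-]; exact: dM.
have dsup n : d n <= sup (range d).
  apply: ub_le_sup; last by exists n.
  by exists M => _ [m _ <-]; exact: dM.
have /choice[p Hp] : forall m : nat, exists p, mid_hull u m p /\ `|p| < d m + @harmonic R m.
  move=> m; have m0 : 0 < @harmonic R m by rewrite invr_gt0.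
  by have [_ [p mp <-] hp] := inf_adherent m0 (infN m); exists p.
have [l pl] : exists l : X, p n @[n --> \oo] --> l.
  apply: (uc_cvg ucX (d := sup (range d))) => e e0.
  have [N1 h1] := (cvgseqP _ _).1 dcv e e0.
  have [N2 h2] := (cvgseqP _ _).1 (@cvg_harmonic R) e e0.
  exists (maxn N1 N2) => n m; rewrite !geq_max => /andP[n1 n2] /andP[m1 m2].
  split.
    have hn : harmonic n < e.
      by apply: le_lt_trans (h2 n n2); rewrite subr0; exact: ler_norm.
    by have := (Hp n).2; have := dsup n; move: hn; lra.
  have : d N1 <= `|2^-1 *: (p n + p m)|.
    apply: dle; apply: mid_mid.
      exact: mid_hull_sub (Hp n).1.
    exact: mid_hull_sub (Hp m).1.
  by have := h1 N1 (leqnn _); rewrite ltr_norml; lra.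
exists l => phi; have [y uy] := ul phi.
suff -> : sval phi l = y by [].
have phipl : sval phi (p n) @[n --> \oo] --> sval phi l.
  by apply: continuous_cvg => //; exact: (svalP phi).
suff phipy : sval phi (p n) @[n --> \oo] --> y.
  exact: (cvg_unique _ phipl phipy).
apply/cvgseqP => e e0; have e2 : 0 < e / 2 by rewrite divr_gt0.
have [N1 h1] := (cvgseqP _ _).1 uy _ e2; exists N1 => n n1.
apply: le_lt_trans (mid_hull_close (e := e / 2) _ (mid_hull_sub n1 (Hp n).1)) _.
  by move=> k /h1/ltW.
by rewrite ltr_pdivrMr// ltr_pMr// ltr1n.
Qed.

(** The derivatives of the norm at the countably many points of the rational span
    of the sequence suffice to test convergence by [qcomb_dense], and
    [diagonal_subseq] makes all of them converge. *)
Lemma weak_subseq (u : nat -> X) (M : R) : (forall n, `|u n| <= M) ->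
  exists2 f, increasing_seq f & exists l, weak_cvg (u \o f) l.
Proof.
move=> uM; have M0 : 0 <= M by exact: le_trans (uM 0%N).
pose a i n : R := if unpickle i is Some s then
  if qcomb u s == 0 then 0 else dnorm (`|qcomb u s|^-1 *: qcomb u s) (u n) else 0.
have nz s : qcomb u s != 0 -> `|qcomb u s|^-1 *: qcomb u s != 0.
  by move=> q0; rewrite scaler_eq0 negb_or invr_eq0 normr_eq0 q0.
have aM i n : `|a i n| <= M.
  rewrite /a; case: unpickle => [s|]; last by rewrite normr0.
  case: eqP => [_|/eqP q0]; first by rewrite normr0.
  by apply: le_trans (uM n); apply: dnorm_le; exact: nz.
have [f fi fa] := diagonal_subseq aM.
exists f => //; apply: (@weak_limit _ M) => [n|phi]; first exact: uM.
apply: cauchyseq_cvg => e e0.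
have M1 : 0 < M + 1 by rewrite ltr_wpDl.
have e4 : 0 < e / (4 * (M + 1)) by rewrite divr_gt0// mulr_gt0.
have [phi0|[r [s [qs hs]]]] := qcomb_dense u phi e4.
  by exists 0%N => n m _ _ /=; rewrite !phi0 subrr normr0.
have [l fl] := fa (pickle s).
have fl' : r * a (pickle s) (f n) @[n --> \oo] --> r * l by exact: cvgMl_tmp.
have e8 : 0 < e / 4 by rewrite divr_gt0.
have [N hN] := (cvgseqP _ _).1 fl' _ e8.
have close n : `|sval phi (u (f n)) - r * a (pickle s) (f n)| <= e / 4.
  have := hs (f n); rewrite /a pickleK (negbTE qs) => /le_trans; apply.
  have Mu := uM (f n).
  apply: (@le_trans _ _ (e / (4 * (M + 1)) * (M + 1))).
    by apply: ler_wpM2l; [exact: ltW|lra].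
  by rewrite invfM mulrA mulfVK// gt_eqF.
exists N => n m /hN hn /hN hm /=.
have := close n; have := close m; move: hn hm.
rewrite !ler_norml !ltr_norml; lra.
Qed.

(** The derivative of the norm at the limit is a functional of norm 1 that tends
    to 1 along the midpoints, so uniform convexity applies. *)
Lemma radon_riesz (u : nat -> X) l : (forall n, `|u n| = 1) -> `|l| = 1 ->
  weak_cvg u l -> u n @[n --> \oo] --> l.
Proof.
move=> u1 l1 ul; apply/cvgseqP => e e0.
have l0 : l != 0 by rewrite -normr_gt0 l1.
have [d d0 hd] := ucX e0.
have [N hN] := (cvgseqP _ _).1 (ul (dnorm_dual l0)) d d0.
exists N => n /hN /= hn; rewrite ltNge; apply/negP => /(hd _ _ (u1 n) l1).
have := dnorm_le (2^-1 *: (u n + l)) l0.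
rewrite linear_scale linearD; have := dnorm_self l0; rewrite l1 => Edl.
move: hn; rewrite Edl ltr_norml ler_norml; lra.
Qed.

End WeakCompactness.

(** * Calculus for functions of class C1 *)

Section C1Calculus.
Variables (R : realType) (X : normedModType R).
Implicit Types (f : X -> R) (u v w : X).

Lemma diff_scale f u (a : R) x : 'd f u (a *: x) = a * 'd f u x.
Proof. exact: (linear_scale ('d f u)). Qed.

Lemma diff_add f u x y : 'd f u (x + y) = 'd f u x + 'd f u y.
Proof. exact: (linearD ('d f u)). Qed.

Lemma diff_opp f u x : 'd f u (- x) = - 'd f u x.
Proof. exact: (linearN ('d f u)). Qed.

Lemma diff_sub f u x y : 'd f u (x - y) = 'd f u x - 'd f u y.
Proof. exact: (linearB ('d f u)). Qed.

Lemma diff_zero f u : 'd f u 0 = 0.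
Proof. exact: (linear0 ('d f u)). Qed.

Lemma C1_diff f u : C1 f -> differentiable f u.
Proof. by move=> /(_ u I)[]. Qed.

Lemma C1_continuous f : C1 f -> continuous f.
Proof. by move=> f1 u; apply: differentiable_continuous; exact: C1_diff. Qed.

Lemma C1_near f u (e : R) : C1 f -> 0 < e ->
  \forall v \near u, forall x, `|'d f v x - 'd f u x| <= e * `|x|.
Proof.
move=> /(_ u I)[_ h] e0; apply: (dual_norm_cvg0 _ h e0).
by move=> v a x; rewrite !diff_scale mulrBr.
Qed.

Lemma cvg_diff f (T : Type) (F : set_system T) {FF : Filter F} (g w : T -> X)
    (a b : X) : C1 f -> g t @[t --> F] --> a -> w t @[t --> F] --> b ->
  'd f (g t) (w t) @[t --> F] --> 'd f a b.
Proof.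
move=> f1 ga wb; have db : 'd f a (w t) @[t --> F] --> 'd f a b.
  by apply: continuous_cvg => //; apply: diff_continuous; exact: C1_diff.
suff d0 : 'd f (g t) (w t) - 'd f a (w t) @[t --> F] --> (0 : R).
  rewrite -[X in _ --> X]add0r; apply: cvg_trans (cvgD d0 db).
  by apply: near_eq_cvg; near=> t; rewrite /= subrK.
apply/cvgr0Pnorm_lt => e e0.
have wb1 : \forall t \near F, `|w t| < `|b| + 1.
  have /cvgrPdist_lt/(_ 1 ltr01) := wb.
  apply: filterS => t; rewrite distrC => h.
  by have := ler_normD (w t - b) b; rewrite subrK; lra.
have b1 : 0 < `|b| + 1 by rewrite ltr_wpDl.
have := C1_near a f1 (divr_gt0 e0 b1) => /ga {}ga.
near=> t; have h : `|'d f (g t) (w t) - 'd f a (w t)| <= e / (`|b| + 1) * `|w t|.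
  by move: (w t); near: t.
apply: le_lt_trans h _.
rewrite -[ltRHS](divfK (lt0r_neq0 b1)) ltr_pM2l ?divr_gt0//.
by near: t.
Unshelve. all: by end_near. Qed.

Lemma is_derive_line f u w (t : R) : differentiable f (u + t *: w) ->
  is_derive t 1 (fun s : R => f (u + s *: w)) ('d f (u + t *: w) w).
Proof.
move=> df.
have E : (fun h : R => h^-1 *: (((fun s : R => f (u + s *: w)) \o shift t)
      (h *: 1) - f (u + t *: w))) =
    (fun h : R => h^-1 *: ((f \o shift (u + t *: w)) (h *: w) - f (u + t *: w))).
  apply/funext => h /=; congr (_ *: (f _ - _)).
  by rewrite [h *: 1]mulr1 scalerDl addrCA.
have dv := diff_derivable (v := w) df.
split; first by rewrite /derivable E.
by rewrite /derive E -deriveE.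
Qed.

Lemma is_derive_ray f u (t : R) : differentiable f (t *: u) ->
  is_derive t 1 (fun s : R => f (s *: u)) ('d f (t *: u) u).
Proof.
move=> df; have := @is_derive_line f 0 u t; rewrite add0r => /(_ df).
by under eq_fun do rewrite add0r.
Qed.

Lemma is_derive_continuous (g : R -> R) (t dg : R) :
  is_derive t 1 g dg -> {for t, continuous g}.
Proof.
by move=> [dv _]; apply: differentiable_continuous; exact/derivable1_diffP.
Qed.

Lemma MVT_line f u w : (forall s : R, 0 <= s <= 1 -> differentiable f (u + s *: w)) ->
  exists2 s : R, 0 <= s <= 1 & f (u + w) - f u = 'd f (u + s *: w) w.
Proof.
move=> df.
have dg (s : R) : 0 <= s <= 1 ->
    is_derive s 1 (fun s : R => f (u + s *: w)) ('d f (u + s *: w) w).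
  by move=> s01; apply: is_derive_line; exact: df.
have dg' (s : R) : s \in `]0, 1[%R ->
    is_derive s 1 (fun s : R => f (u + s *: w)) ('d f (u + s *: w) w).
  by rewrite in_itv /= => /andP[/ltW s0 /ltW s1]; apply: dg; rewrite s0.
have cg : {within `[0, 1], continuous (fun s : R => f (u + s *: w))}.
  apply: continuous_in_subspaceT => s; rewrite inE /= in_itv /= => /dg.
  exact: is_derive_continuous.
have [s] := MVT ltr01 dg' cg.
rewrite in_itv /= => /andP[/ltW s0 /ltW s1] h; exists s; first by rewrite s0.
by move: h; rewrite scale1r scale0r addr0 subr0 mulr1.
Qed.

Lemma diff_even f u v : (forall x, f (- x) = f x) -> differentiable f u ->
  'd f (- u) v = - 'd f u v /\ differentiable f (- u).
Proof.
move=> fN df; have fE : f = f \o -%R by apply/funext => x /=; rewrite fN.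
have dN (x : X) : is_diff x (-%R : X -> X) -%R.
  by have := @is_diffN R X X id id x; apply; exact: is_diff_id.
have dfN : differentiable f (- u).
  rewrite fE; apply: differentiable_comp; first exact: (@ex_diff _ _ _ _ _ _ _ (dN (- u))).
  by rewrite opprK.
split=> //.
have := diff_comp (@ex_diff _ _ _ _ _ _ _ (dN u)) dfN.
rewrite -fE (diff_val (is_diff_def := dN u)) => /(congr1 (@^~ v)) /= ->.
by rewrite diff_opp opprK.
Qed.

Lemma euler_identity (alpha : R) f u : homogeneous alpha f -> u != 0 ->
  differentiable f u -> 'd f u u = alpha * f u.
Proof.
move=> fh u0 df.
have d1 : is_derive (1 : R) 1 (fun s : R => f (s *: u)) ('d f u u).
  by have := @is_derive_ray f u 1; rewrite scale1r; apply.
have d2 : is_derive (1 : R) 1 (fun s : R => s `^ alpha * f u) (alpha * f u).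
  have -> : (fun s : R => s `^ alpha * f u) = f u *: (fun s : R => s `^ alpha).
    by apply/funext => s; rewrite fctE mulrC.
  have dp : is_derive (1 : R) 1 (fun s : R => s `^ alpha) alpha.
    split; first by apply: derivable_powR; rewrite in_itv/= ltr01.
    have := @powR_derive1 _ alpha (1 : R); rewrite in_itv/= ltr01 => /(_ isT).
    by rewrite derive1E powR1 mulr1.
  by have := is_deriveZ (f u) dp; rewrite [_ *: _]mulrC.
have [dv1 <-] := d1; have [dv2 <-] := d2.
apply: near_eq_derive; near=> s; apply: fh => //.
by near: s; exact: lt_nbhsr.
Unshelve. all: by end_near. Qed.

End C1Calculus.

(** * Weak convergence *)

(** A neighbourhood of the limit contains all but finitely many terms. *)
Lemma cvg_range_compact (T : topologicalType) (u : nat -> T) (l : T) :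
  u n @[n --> \oo] --> l -> compact ([set l] `|` range u).
Proof.
move=> ul; apply/compact_near_coveringP => I F P FF cov.
have [|[U V] [/= Ul FV] UVP] := cov l; first by left.
have [N _ hN] := ul _ Ul.
have key m : \forall i \near F, forall n, (n < m)%N -> P i (u n).
  elim: m => [|m IH]; first exact: nearW.
  have [|[U' V'] [/= U'm FV'] UVP'] := cov (u m); first by right; exists m.
  near=> i => n; rewrite ltnS leq_eqVlt => /orP[/eqP->|].
    apply: (UVP' (u m, i)); split; first exact: nbhs_singleton.
    by near: i.
  by move: n; near: i.
near=> i; move=> x [->|[n _ <-]].
  by apply: (UVP (l, i)); split; [exact: nbhs_singleton|near: i].
have [nN|Nn] := ltnP n N; first by move: n nN; near: i; exact: key.
by apply: (UVP (u n, i)); split=> /=; [exact: hN|near: i].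
Unshelve. all: by end_near. Qed.

Lemma cvg_powR (R : realType) (x : nat -> R) (t p : R) : 0 < t ->
  x n @[n --> \oo] --> t -> x n `^ p @[n --> \oo] --> t `^ p.
Proof.
move=> t0 xt.
have dp : derivable (fun s : R => s `^ p) t 1.
  by apply: derivable_powR; rewrite in_itv /= t0.
have cp : {for t, continuous (fun s : R => s `^ p)}.
  by apply: differentiable_continuous; exact/derivable1_diffP.
exact: (cvg_comp _ _ xt cp).
Qed.

Lemma eq_ler (R : realType) (x y : R) : x = y -> x <= y.
Proof. by move=> ->. Qed.

Lemma limr_ge_seq (R : realType) (x : nat -> R) (l r : R) :
  x n @[n --> \oo] --> l -> (forall n, r <= x n) -> r <= l.
Proof.
move=> xl rx; apply/ler_addgt0Pr => e e0.
have [N hN] := (cvgseqP _ _).1 xl e e0; have := hN N (leqnn _); have := rx N.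
by rewrite ltr_norml; lra.
Qed.

Section WeakConvergence.
Variables (R : realType) (X : normedModType R).
Implicit Types (u : nat -> X) (l : X).

Definition diff_dual (f : X -> R) (u : X) (df : differentiable f u) : dual X :=
  exist _ (('d f u : {linear X -> R})) (diff_continuous df).

Lemma weak_cvg_diff (f : X -> R) (v : X) u l : differentiable f v ->
  weak_cvg u l -> 'd f v (u n) @[n --> \oo] --> 'd f v l.
Proof. by move=> df /(_ (diff_dual df)). Qed.

Lemma weak_cvg_subseq u l f : increasing_seq f -> weak_cvg u l ->
  weak_cvg (u \o f) l.
Proof. by move=> fi ul phi; exact: (cvg_subseq fi (ul phi)). Qed.

Lemma weak_cvgZ u l (t : nat -> R) (s : R) : t n @[n --> \oo] --> s ->
  weak_cvg u l -> weak_cvg (fun n => t n *: u n) (s *: l).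
Proof.
move=> ts ul phi.
under eq_fun do rewrite (linear_scale (sval phi)).
by rewrite (linear_scale (sval phi)); apply: cvgM => //; exact: ul.
Qed.

Lemma weak_cvg_mid u l (s : nat -> R) : (forall n, 0 <= s n <= 1) ->
  weak_cvg u l -> weak_cvg (fun n => l + s n *: (u n - l)) l.
Proof.
move=> s1 ul phi; apply/cvgseqP => e /((cvgseqP _ _).1 (ul phi))[N hN].
exists N => n /hN; apply: le_lt_trans.
rewrite (linear_line (sval phi)) addrC addKr normrM.
rewrite (linearB (sval phi)); have /andP[s0 s1'] := s1 n.
by rewrite ger0_norm// ler_piMl.
Qed.

Lemma cc_near (f : X -> R) u l (e : R) :
  completely_continuous (fun v : X => 'd f v : X -> R) -> weak_cvg u l -> 0 < e ->
  exists N, forall n, (N <= n)%N -> forall x,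
    `|'d f (u n) x - 'd f l x| <= e * `|x|.
Proof.
move=> fc ul e0; have [N _ hN] : \forall n \near \oo,
    forall x, `|'d f (u n) x - 'd f l x| <= e * `|x|.
  apply: (dual_norm_cvg0 _ (fc u l ul) e0).
  by move=> n a x; rewrite !diff_scale mulrBr.
by exists N.
Qed.

(** The differentials along [u] converge in the dual norm, so on a bounded sequence
    they behave like the differential at the limit. *)
Lemma cc_cvg (f : X -> R) u l (w : nat -> X) (M : R) : C1 f ->
    completely_continuous (fun v : X => 'd f v : X -> R) -> weak_cvg u l ->
    (forall n, `|w n| <= M) -> 'd f l (w n) @[n --> \oo] --> (0 : R) ->
  'd f (u n) (w n) @[n --> \oo] --> (0 : R).
Proof.
move=> f1 fc ul wM w0; apply/cvgseqP => e e0.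
have M0 : 0 <= M by exact: le_trans (wM 0%N).
have M1 : 0 < M + 1 by rewrite ltr_wpDl.
have e2 : 0 < e / 2 by rewrite divr_gt0.
have [N1 h1] := cc_near fc ul (divr_gt0 e2 M1).
have [N2 h2] := (cvgseqP _ _).1 w0 _ e2.
exists (maxn N1 N2) => n; rewrite geq_max => /andP[/h1 n1 /h2 n2].
have : `|'d f (u n) (w n) - 'd f l (w n)| <= e / 2.
  apply: le_trans (n1 (w n)) _; rewrite -[leRHS](divfK (lt0r_neq0 M1)).
  rewrite ler_wpM2l ?divr_ge0 1?ltW//.
  by have := wM n; lra.
move: n2; rewrite !subr0 ler_norml !ltr_norml; lra.
Qed.

(** The mean value theorem writes the increment as a differential at points that
    converge weakly to the same limit. *)
Lemma weakly_continuous (f : X -> R) u l (M : R) : C1 f ->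
    completely_continuous (fun v : X => 'd f v : X -> R) ->
    (forall n, `|u n| <= M) -> weak_cvg u l ->
  f (u n) @[n --> \oo] --> f l.
Proof.
move=> f1 fc uM ul.
have /choice[s Hs] : forall n, exists s : R, 0 <= s <= 1 /\
    f (u n) - f l = 'd f (l + s *: (u n - l)) (u n - l).
  move=> n; have [|s s1 Es] := @MVT_line R X f l (u n - l).
    by move=> s _; exact: C1_diff.
  by exists s; split=> //; rewrite -Es subrKC.
suff h : f (u n) - f l @[n --> \oo] --> (0 : R).
  apply/cvgseqP => e /((cvgseqP _ _).1 h)[N hN]; exists N => n /hN.
  by rewrite subr0.
under eq_fun do rewrite (Hs _).2.
apply: (cc_cvg (M := M + `|l|) f1 fc (weak_cvg_mid _ ul)).
- by move=> n; exact: (Hs n).1.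
- by move=> n; rewrite (le_trans (ler_normB _ _))// lerD2r.
- under eq_fun do rewrite diff_sub.
  rewrite -(subrr ('d f l l)); apply: cvgB; last exact: cvg_cst.
  by apply: weak_cvg_diff => //; exact: C1_diff.
Qed.

End WeakConvergence.

(** * Ekeland's variational principle *)

(** Starting from any point one moves repeatedly to a point from which the value
    can hardly be decreased further, among those reachable at a decrease of at
    least [eps] times the distance; the limit cannot be improved at all. *)
Lemma ekeland (R : realType) (T : Type) (d : T -> T -> R) (phi : T -> R)
    (B eps : R) (x0 : T) : 0 < eps ->
    (forall x y, 0 <= d x y) -> (forall x, d x x = 0) ->
    (forall x y, d x y = d y x) -> (forall x y z, d x z <= d x y + d y z) ->
    (forall x, B <= phi x) ->
    (forall s : nat -> T,
       (forall e : R, 0 < e -> exists N, forall n m, (N <= n)%N -> (N <= m)%N ->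
          d (s n) (s m) < e) ->
       exists x, forall e : R, 0 < e -> exists N, forall n, (N <= n)%N ->
          d (s n) x < e) ->
    (forall (s : nat -> T) x (L : R),
       (forall e : R, 0 < e -> exists N, forall n, (N <= n)%N -> d (s n) x < e) ->
       (exists N, forall n, (N <= n)%N -> phi (s n) <= L) -> phi x <= L) ->
  exists x, phi x <= phi x0 /\ forall y, phi x <= phi y + eps * d x y.
Proof.
move=> eps0 d0 dxx dC dtri phiB complete lsc.
pose S x := [set y | phi y + eps * d x y <= phi x].
have Sxx x : S x x by rewrite /S /= dxx mulr0 addr0.
have Strans x y z : S x y -> S y z -> S x z.
  rewrite /S /= => xy yz; have := dtri x y z.
  by rewrite -(ler_pM2l eps0) mulrDr; lra.
have /choice[nxt Hn] : forall x, exists y, S x y /\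
    forall z, S x z -> 2 * phi y <= phi x + phi z.
  move=> x; pose A := [set phi y | y in S x].
  have infA : has_inf A.
    by split; [exists (phi x), x|exists B => _ [y _ <-]].
  have lbA z : S x z -> inf A <= phi z.
    by move=> Sz; apply: ge_inf; [exact: infA.2|exists z].
  have [xA|Ax] := leP (phi x) (inf A).
    by exists x; split => // z /lbA; lra.
  have e0 : 0 < (phi x - inf A) / 2 by rewrite divr_gt0// subr_gt0.
  have [_ [y Sy <-] hy] := inf_adherent e0 infA.
  by exists y; split => // z /lbA; lra.
pose s n := iter n nxt x0.
have Ss n m : (n <= m)%N -> S (s n) (s m).
  move=> /subnK <-; elim: (m - n)%N => [|k IH] //=.
  by apply: Strans IH _; exact: (Hn _).1.
have snd : {homo (phi \o s) : n m / (n <= m)%N >-> m <= n}.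
  move=> n m /Ss; rewrite /S /=; have := mulr_ge0 (ltW eps0) (d0 (s n) (s m)).
  lra.
have [l sl] : exists l : R, phi (s n) @[n --> \oo] --> l.
  apply/cvg_ex; apply: nonincreasing_is_cvgn => //.
  by exists B => _ [n _ <-]; exact: phiB.
have sC (e : R) : 0 < e -> exists N, forall n m, (N <= n)%N -> (N <= m)%N ->
    `|phi (s n) - phi (s m)| < e.
  move=> e0; have e2 : 0 < e / 2 by rewrite divr_gt0.
  have [N hN] := (cvgseqP _ _).1 sl _ e2; exists N => n m /hN hn /hN hm.
  by move: hn hm; rewrite !ltr_norml; lra.
have [x sx] : exists x, forall e : R, 0 < e -> exists N, forall n, (N <= n)%N ->
    d (s n) x < e.
  apply: complete => e e0; have [N hN] := sC _ (mulr_gt0 eps0 e0).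
  exists N => n m Nn Nm; rewrite -(ltr_pM2l eps0).
  wlog nm : n m Nn Nm / (n <= m)%N.
    by move=> wl; have [/wl|/ltnW/wl] := leqP n m; [|rewrite dC]; exact.
  have := Ss n m nm; have := hN n m Nn Nm; rewrite /S /= ltr_norml; lra.
have Sx n : S (s n) x.
  rewrite /S /=; apply/ler_addgt0Pr => e e0.
  rewrite -lerBrDr; apply: (lsc s x _ sx).
  have [N hN] := sx _ (divr_gt0 e0 eps0).
  exists (maxn N n) => m; rewrite geq_max => /andP[/hN Nm /Ss]; rewrite /S /=.
  have := dtri (s n) (s m) x.
  rewrite -(ler_pM2l eps0) mulrDr => h1 h2.
  have : eps * d (s m) x < e by rewrite mulrC -ltr_pdivlMr.
  lra.
exists x; split.
  have := Sx 0%N; rewrite /S /= /s /=.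
  by have := mulr_ge0 (ltW eps0) (d0 x0 x); lra.
move=> y; rewrite leNgt; apply/negP => Sy.
have : phi x <= phi y.
  apply/ler_addgt0Pr => e e0; have [N hN] := sC e e0.
  have SNy : S (s N) y by apply: Strans (Sx N) _; rewrite /S /= ltW.
  have := (Hn (s N)).2 y SNy; have := hN N N.+1 (leqnn _) (leqnSn _).
  have := Sx N.+1; rewrite /S /= ltr_norml.
  have := mulr_ge0 (ltW eps0) (d0 (nxt (s N)) x); rewrite /s /=; lra.
by have := mulr_ge0 (ltW eps0) (d0 x y); lra.
Qed.

(** * Continuous selections *)

Section Selection.
Variables (R : realType) (X : normedModType R).

Definition convex (C : set X) := forall (x y : X) (t : R), 0 <= t <= 1 ->
  C x -> C y -> C (t *: x + (1 - t) *: y).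

Lemma convex_wsum (C : set X) (I : eqType) (r : seq I) (th : I -> R)
    (v : I -> X) : convex C -> (forall i, 0 <= th i) ->
    (forall i, i \in r -> 0 < th i -> C (v i)) -> 0 < \sum_(i <- r) th i ->
  C ((\sum_(i <- r) th i)^-1 *: \sum_(i <- r) th i *: v i).
Proof.
move=> Cc th0; elim: r => [|i r IH] Cv; first by rewrite big_nil ltxx.
rewrite !big_cons => S0.
have Cr j : j \in r -> 0 < th j -> C (v j).
  by move=> jr; apply: Cv; rewrite inE jr orbT.
have [ti|ti] := eqVneq (th i) 0.
  by rewrite ti !add0r scale0r add0r in S0 *; exact: IH.
have {}ti : 0 < th i by rewrite lt_neqAle eq_sym ti th0.
have Ci : C (v i) by apply: Cv => //; exact: mem_head.
have [W0|W0] := eqVneq (\sum_(j <- r) th j) 0.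
  have -> : \sum_(j <- r) th j *: v j = 0.
    rewrite big_seq big1// => j jr.
    have : th j <= \sum_(j <- r) th j.
      rewrite (perm_big _ (perm_to_rem jr)) big_cons /= lerDl.
      by rewrite sumr_ge0.
    rewrite W0 => tj; have -> : th j = 0 by apply/eqP; rewrite eq_le tj th0.
    by rewrite scale0r.
  by rewrite W0 !addr0 scalerA mulVf ?scale1r// gt_eqF.
have {}W0 : 0 < \sum_(j <- r) th j by rewrite lt_neqAle eq_sym W0 sumr_ge0.
set W := \sum_(j <- r) th j in S0 W0 IH *; set Z := \sum_(j <- r) _.
have -> : (th i + W)^-1 *: (th i *: v i + Z) =
    (th i / (th i + W)) *: v i + (1 - th i / (th i + W)) *: (W^-1 *: Z).
  rewrite scalerDr !scalerA [_^-1 * th i]mulrC; congr (_ + _ *: _).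
  by field; rewrite !gt_eqF.
apply: Cc => //; last exact: IH.
rewrite divr_ge0 ?(ltW ti) ?(ltW S0)//= ler_pdivrMr// mul1r lerDl ltW//.
Qed.

(** A partition of unity glues locally constant selections. *)
Lemma convex_selection (G : set X) (P : X -> set X) : compact G ->
    (forall u, convex (P u)) ->
    (forall u, G u -> exists v, \forall u' \near u, P u' v) ->
  exists V : X -> X, forall u, G u -> {for u, continuous V} /\ P u (V u).
Proof.
move=> cG Pc Pl.
have /choice[p Hp] : forall u, exists p : R * X, G u -> 0 < p.1 /\
    forall u', `|u' - u| < p.1 -> P u' p.2.
  move=> u; have [Gu|nGu] := pselect (G u); last by exists (0, 0).
  have [v /nbhs_ballP[r /= r0 hr]] := Pl u Gu.
  exists (r, v) => _; split=> // u' uu'; apply: hr.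
  by rewrite -ball_normE /= distrC.
have := cG; rewrite compact_cover => /(_ X G (fun u => ball u (p u).1)).
case.
- by move=> u _; exact: ball_open.
- by move=> u Gu; exists u => //; apply: ballxx; exact: (Hp u Gu).1.
move=> D' DG Dcov; pose D : seq X := finmap.enum_fset D'.
(* Twice the positive part of the radius minus the distance. *)
pose th (i u : X) : R := `|(p i).1 - `|u - i| | + ((p i).1 - `|u - i|).
have th0 i u : 0 <= th i u.
  by rewrite /th; have := ler_norm (- ((p i).1 - `|u - i|)); rewrite normrN; lra.
have thgt i u : 0 < th i u -> `|u - i| < (p i).1.
  by rewrite /th; case: ger0P; lra.
have thc i : continuous (th i).
  move=> u; have h : (p i).1 - `|u' - i| @[u' --> u] --> (p i).1 - `|u - i|.
    apply: cvgB; first exact: cvg_cst.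
    by apply: cvg_norm; apply: cvgB; [exact: cvg_id|exact: cvg_cst].
  by apply: cvgD => //; exact: cvg_norm.
pose Th u := \sum_(i <- D) th i u.
have Thc : continuous Th.
  by move=> u; apply: (@cvg_bigsum _ _ _ _ (nbhs u)) => i; exact: thc.
have Thgt u : G u -> 0 < Th u.
  move=> /Dcov[i /= iD iu]; rewrite /Th (perm_big _ (perm_to_rem iD)) big_cons /=.
  rewrite ltr_pwDl ?sumr_ge0// /th; move: iu; rewrite -ball_normE /= distrC => iu.
  by rewrite gtr0_norm ?subr_gt0//; lra.
exists (fun u => (Th u)^-1 *: \sum_(i <- D) th i u *: (p i).2) => u Gu.
split.
  apply: cvgZ; first by apply: cvgV; [rewrite gt_eqF// Thgt|exact: Thc].
  apply: (@cvg_bigsum _ _ _ _ (nbhs u)) => i.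
  by apply: cvgZr_tmp; exact: thc.
apply: convex_wsum => //; last exact: Thgt.
move=> i iD /thgt; apply: (Hp i _).2.
by have := DG i iD; rewrite inE.
Qed.

End Selection.

(** * The Krasnoselskii genus *)

Section Genus.
Variables (R : realType) (X : normedModType R).

Lemma within_comp (S T U : topologicalType) (A : set S) (B : set T)
    (f : S -> T) (g : T -> U) : {within A, continuous f} ->
    (forall x, A x -> B (f x)) -> {within B, continuous g} ->
  {within A, continuous (g \o f)}.
Proof.
move=> /subspace_continuousP cf AB /subspace_continuousP cg.
apply/subspace_continuousP => x Ax W Wx.
have h : nbhs x (fun y => A y -> B (f y) -> W (g (f y))) :=
  cf x Ax _ (cg _ (AB x Ax) W Wx).
suff : nbhs x (fun y => A y -> W (g (f y))) by [].
by apply: filterS h => y h Ay; apply: h => //; exact: AB.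
Qed.

(** An odd map on the image pulls back to an odd map on the source. *)
Lemma genus_image (F : set X) (g : X -> X) : {within F, continuous g} ->
    (forall u, F u -> g (- u) = - g u) -> (genus F <= genus (g @` F))%E.
Proof.
move=> cg gN; apply: ereal_inf_le_tmp => _ [k [h [ch hN]] <-].
exists k => //; exists (h \o g); split.
  by apply: within_comp ch => // u Fu; exists u.
by move=> u Fu /=; rewrite gN//; apply: hN; exists u.
Qed.

Lemma genus_le (F : set X) (k : nat) (h : X -> 'rV[R]_k) :
    {within F, continuous h} ->
    (forall u, F u -> h (- u) = - h u /\ h u != 0) ->
  (genus F <= k%:R%:E)%E.
Proof. by move=> ch hN; apply: ereal_inf_lbound; exists k => //; exists h. Qed.

Lemma row_continuous (k : nat) (f : 'I_k -> X -> R) :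
  (forall i, continuous (f i)) -> continuous (fun u => \row_i f i u).
Proof.
move=> fc u; apply/cvgrPdist_lt => e e0.
have : \forall v \near u, forall i, `|f i u - f i v| < e.
  by apply: filter_forall => i; exact: ((cvgrPdist_lt _ _).1 (fc i u)).
apply: filterS => v hv.
rewrite [ltLHS]/Num.Def.normr /= mx_normrE; apply/bigmax_ltP; split=> //.
by move=> [i j] _ /=; rewrite !mxE.
Qed.

Definition free_up_to (n : nat) (e : nat -> X) := forall a : nat -> R,
  \sum_(i < n) a i *: e i = 0 -> forall i, (i < n)%N -> a i = 0.

Lemma exists_free (n : nat) : infinite_dimensional X ->
  exists e, free_up_to n e.
Proof.
move=> infX; elim: n => [|n [e he]]; first by exists (fun=> 0).
have [x hx] : exists x, forall a : nat -> R, x <> \sum_(i < n) a i *: e i.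
  apply: contrapT => /forallNP h; apply: infX; exists n, (fun i : 'I_n => e i) => x.
  have /existsNP[a /contrapT ->] := h x.
  by exists (fun i : 'I_n => a i).
exists (fun i => if (i < n)%N then e i else x) => a.
rewrite big_ord_recr /= ltnn.
under eq_bigr do rewrite ltn_ord.
move=> S0; have an : a n = 0.
  apply/eqP; apply: contraT => an; exfalso.
  apply: (hx (fun i => - (a n)^-1 * a i)).
  under eq_bigr do rewrite -scalerA.
  rewrite -scaler_sumr; move/eqP: S0; rewrite addrC addr_eq0 => /eqP E.
  by rewrite scaleNr -scalerN -E scalerA mulVf// scale1r.
rewrite an scale0r addr0 in S0.
by move=> i; rewrite ltnS leq_eqVlt => /orP[/eqP->//|]; exact: he.
Qed.

Lemma sphere_proj_norm (x : X) : x != 0 -> `| `|x|^-1 *: x| = 1.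
Proof.
by move=> x0; rewrite normrZ ger0_norm ?invr_ge0// mulVf// normr_eq0.
Qed.

Lemma sphere_proj_continuous (x : X) : x != 0 ->
  {for x, continuous (fun x : X => `|x|^-1 *: x)}.
Proof.
move=> x0; apply: cvgZ; last exact: cvg_id.
by apply: cvgV; [rewrite normr_eq0|apply: cvg_norm; exact: cvg_id].
Qed.

(** The witness is the unit sphere of a subspace of dimension [n.+1]; an odd map
    from it into a space of lower dimension has a zero by Borsuk-Ulam. *)
Lemma exists_genus_family (n : nat) : infinite_dimensional X ->
  exists F : set X, genus_family X n.+1 F.
Proof.
move=> infX; have [e he] := exists_free n.+1 infX.
pose L (v : 'rV[R]_n.+1) : X := \sum_(i < n.+1) v ord0 i *: e i.
have Lc : continuous L.
  move=> v; apply: (@cvg_bigsum _ _ _ _ (nbhs v)) => i.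
  by apply: cvgZr_tmp; exact: coord_continuous.
have LN v : L (- v) = - L v.
  by rewrite /L -sumrN; apply: eq_bigr => i _; rewrite mxE scaleNr.
have L0 v : v != 0 -> L v != 0.
  apply: contraNneq => Lv0; apply/eqP/rowP => j; rewrite mxE.
  have := he (fun i => v ord0 (inord i)); rewrite -/(L _).
  have -> : \sum_(i < n.+1) v ord0 (inord i) *: e i = 0.
    by rewrite -[RHS]Lv0; apply: eq_bigr => i _; rewrite inord_val.
  by move=> /(_ erefl j (ltn_ord j)); rewrite inord_val.
pose N (v : 'rV[R]_n.+1) : X := `|L v|^-1 *: L v.
have Nc : {within @l1sphere R n, continuous N}.
  apply: continuous_in_subspaceT => v; rewrite inE => /l1sphere_neq0/L0 Lv.
  by apply: (@continuous_comp _ _ _ L (fun x => `|x|^-1 *: x));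
    [exact: Lc|exact: sphere_proj_continuous].
have NN v : N (- v) = - N v by rewrite /N LN normrN scalerN.
exists (N @` @l1sphere R n); split.
- by apply: continuous_compact => //; exact: compact_l1sphere.
- by move=> _ [v v1 <-]; exists (- v); [exact: l1sphereN|rewrite NN].
- by move=> _ [v v1 <-]; apply: sphere_proj_norm; exact: (L0 _ (l1sphere_neq0 v1)).
- apply: le_ereal_inf_tmp => _ [k [h [ch hN]] <-].
  rewrite lee_fin ler_nat ltnNge; apply/negP => kn.
  have [||v v1] := @borsuk_ulam R n k (h \o N) kn.
  + by apply: within_comp ch => // v v1; exists v.
  + by move=> v v1 /=; rewrite NN; apply: (hN _ _).1; exists v.
  + by move=> /=; apply/eqP; apply: (hN _ _).2; exists v.
Qed.

End Genus.

(** * Fibre maps *)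

Section RealFunctions.
Variable R : realType.

Lemma right_limit_ge (g : R -> R) (x0 x1 B : R) : {for x0, continuous g} ->
  x0 < x1 -> (forall x, x0 < x < x1 -> B <= g x) -> B <= g x0.
Proof.
move=> gc x01 gB; rewrite leNgt; apply/negP => gx0.
have /cvgrPdist_lt/(_ (B - g x0)) := gc.
rewrite subr_gt0 => /(_ gx0)/nbhs_ballP[d /= d0 hd].
pose x := x0 + Num.min (d / 2) ((x1 - x0) / 2).
have m0 : 0 < Num.min (d / 2) ((x1 - x0) / 2).
  by rewrite lt_min !divr_gt0// subr_gt0.
have [m1 m2] : Num.min (d / 2) ((x1 - x0) / 2) <= d / 2 /\
    Num.min (d / 2) ((x1 - x0) / 2) <= (x1 - x0) / 2.
  by rewrite !ge_min !lexx orbT.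
have := hd x; rewrite -ball_normE /= => /(_ _)/wrap[].
  by rewrite /x opprD addNKr normrN gtr0_norm//; lra.
have := gB x; rewrite /x => /(_ _)/wrap[]; first by lra.
by move=> h; rewrite ltr_norml; lra.
Qed.

(** Where it increases the function is nonnegative, so a negative level can only
    be crossed where it decreases. *)
Lemma unimodal_level (g : R -> R) (a s t1 : R) : continuous g -> g 0 = 0 ->
    0 < a -> 0 <= s ->
    {in `]0, s[ &, {homo g : x y / x < y}} ->
    {in `]s, +oo[ &, {homo g : x y /~ x < y}} ->
    0 < t1 -> g t1 < - a ->
  exists T, [/\ 0 < T, g T = - a, (forall t, 0 < t < T -> - a < g t) &
               forall t, T < t -> g t < - a].
Proof.
move=> gc g0 a0 s0 ginc gdec t10 gt1.
have [||T] := @IVT R g 0 t1 (- a) (ltW t10).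
- by apply: continuous_subspaceT.
- by rewrite ge_min le_max (ltW gt1) orbT g0 oppr_le0 ltW.
rewrite in_itv /= => /andP[T0 Tt1] gT.
have {}T0 : 0 < T.
  by rewrite lt_neqAle T0 andbT; apply: contra_eq_neq gT => <-; rewrite g0; lra.
have inc t : 0 < t < s -> 0 <= g t.
  move=> /andP[t0 ts]; rewrite -g0.
  have [c0|//] := ltP (g t) (g 0).
  have : - g t <= - g 0.
    apply: (@right_limit_ge (fun x => - g x) 0 t) => //.
      by apply: continuousN; exact: gc.
    move=> x /andP[x0 xt]; rewrite lerN2 ltW//; apply: ginc => //.
      by rewrite in_itv/= x0 (lt_trans xt).
    by rewrite in_itv/= t0.
  by lra.
have dec x y : s <= x -> x < y -> g y < g x.
  move=> sx xy; have xm : x < (x + y) / 2 by lra.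
  have my : (x + y) / 2 < y by lra.
  apply: (@lt_le_trans _ _ (g ((x + y) / 2))).
    by apply: gdec => //; rewrite in_itv/= andbT; lra.
  apply: (right_limit_ge (gc x) xm) => z /andP[xz zm]; apply: ltW.
  by apply: gdec => //; rewrite in_itv/= andbT; lra.
have sT : s <= T.
  by rewrite leNgt; apply/negP => Ts; have := inc T; rewrite T0 Ts gT; lra.
exists T; split=> // [t /andP[t0 tT]|t Tt]; last by rewrite -gT dec.
have [ts|st] := ltP t s; last by rewrite -gT dec.
by have := inc t; rewrite t0 ts; lra.
Qed.

End RealFunctions.

Section Fibre.
Variables (R : realType) (X : completeNormedModType R) (c alpha : R).
Variables (I1 I2 : X -> R).
Hypothesis c_neq0 : c != 0.
Hypothesis alpha_gt0 : 0 < alpha.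
Hypotheses (I1_C1 : C1 I1) (I2_C1 : C1 I2) (I1_0 : I1 0 = 0).
Hypothesis I2_gt0 : forall u : X, u != 0 -> 0 < I2 u.
Hypothesis I2_hom : homogeneous alpha I2.

(** Multiplying by the sign of [c] turns the case of negative [c] into that of
    positive [c]. *)
Definition sH (u : X) : R := Num.sg c * Hfun alpha I1 u.

Hypothesis sH_unimodal : forall u : X, u != 0 -> exists s : R, [/\ 0 <= s,
  {in `]0, s[ &, {homo (fun t => sH (t *: u)) : x y / x < y}} &
  {in `]s, +oo[ &, {homo (fun t => sH (t *: u)) : x y /~ x < y}}].
Hypothesis sH_diverges : forall A : set X, weakly_compact A -> ~ A 0 ->
  forall M : R, \forall t \near +oo, forall u, A u -> sH (t *: u) < M.

Local Notation lam := (lambda I1 I2 c).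
Local Notation tc := (tcrit I1 I2 c).
Local Notation Lam := (fiber_lambda I1 I2 c).
Local Notation a := (alpha * `|c|).

Lemma a_gt0 : 0 < a. Proof. by rewrite mulr_gt0// normr_gt0. Qed.

Lemma sH_continuous : continuous sH.
Proof.
move=> u; apply: cvgMl_tmp; apply: cvgB.
  by apply: cvg_diff => //; exact: cvg_id.
by apply: cvgMl_tmp; exact: C1_continuous.
Qed.

Lemma sH0 : sH 0 = 0.
Proof. by rewrite /sH /Hfun diff_zero I1_0 mulr0 subrr mulr0. Qed.

Lemma sHE u : Hfun alpha I1 u + alpha * c = Num.sg c * (sH u + a).
Proof.
rewrite /sH mulrDr mulrA -expr2 sqr_sg c_neq0 mul1r; congr (_ + _).
by rewrite mulrCA -numEsg.
Qed.

Lemma lam_diff u : u != 0 -> differentiable lam u.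
Proof.
move=> u0; rewrite /lambda.
apply: (@differentiableM _ _ (fun u => I1 u - c) (fun u => (I2 u)^-1)).
  apply: (@differentiableB _ _ _ I1 (cst c)); first exact: C1_diff.
  exact: differentiable_cst.
apply: differentiableV; first exact: C1_diff.
by rewrite gt_eqF// I2_gt0.
Qed.

Lemma dlamE u v : u != 0 ->
  'd lam u v = ('d I1 u v - lam u * 'd I2 u v) / I2 u.
Proof.
move=> u0; have d1 : differentiable (fun u => I1 u - c) u.
  apply: (@differentiableB _ _ _ I1 (cst c)); first exact: C1_diff.
  exact: differentiable_cst.
have I2n : I2 u != 0 by rewrite gt_eqF// I2_gt0.
have d2 : differentiable I2 u by exact: C1_diff.
have d2' : differentiable (fun u => (I2 u)^-1) u by exact: differentiableV.
have E1 : 'd lam u v = (I1 u - c) * 'd (fun u => (I2 u)^-1) u v +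
    (I2 u)^-1 * 'd (fun u => I1 u - c) u v.
  exact: (congr1 (fun F : X -> R => F v) (diffM d1 d2')).
have E2 : 'd (fun u => (I2 u)^-1) u v = - I2 u ^- 2 * 'd I2 u v.
  exact: (congr1 (fun F : X -> R => F v) (diffV d2 I2n)).
have E3 : 'd (fun u => I1 u - c) u v = 'd I1 u v - 0.
  rewrite -[X in _ - X](congr1 (fun F : X -> R => F v) (diff_cst c u)).
  exact: (congr1 (fun F : X -> R => F v)
    (derive.diffB (C1_diff u I1_C1) (differentiable_cst c u))).
apply: (etrans E1).
apply: (etrans (congr2 (fun x y => (I1 u - c) * x + (I2 u)^-1 * y) E2 E3)).
have key p q : (I1 u - c) * (- I2 u ^- 2 * q) + (I2 u)^-1 * (p - 0) =
    (p - (I1 u - c) / I2 u * q) / I2 u by field.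
exact: key.
Qed.

Lemma dI1E u v : u != 0 -> 'd I1 u v = I2 u * 'd lam u v + lam u * 'd I2 u v.
Proof.
move=> u0; have I2n : I2 u != 0 by rewrite gt_eqF// I2_gt0.
have key (p q l i x : R) : i != 0 -> x = (p - l * q) / i -> p = i * x + l * q.
  by move=> i0 ->; field.
exact: key I2n (dlamE v u0).
Qed.

Lemma near_neq0 (u : X) : u != 0 -> \forall v \near u, v != 0.
Proof.
move=> u0; apply/nbhs_ballP; exists `|u|; first by rewrite /= normr_gt0.
move=> v; rewrite -ball_normE /=; apply: contraTneq => ->.
by rewrite subr0 ltxx.
Qed.

Lemma scaled_neq0 (t : R) (u : X) : 0 < t -> u != 0 -> t *: u != 0.
Proof. by move=> t0 u0; rewrite scaler_eq0 negb_or u0 gt_eqF. Qed.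

Lemma dlam_self u : u != 0 -> 'd lam u u = (Hfun alpha I1 u + alpha * c) / I2 u.
Proof.
move=> u0; have I2n : I2 u != 0 by rewrite gt_eqF// I2_gt0.
apply: (etrans (dlamE u u0)).
have -> : 'd I2 u u = alpha * I2 u.
  by apply: euler_identity => //; exact: C1_diff.
have key p : (p - (I1 u - c) / I2 u * (alpha * I2 u)) / I2 u =
    (p - alpha * I1 u + alpha * c) / I2 u by field.
exact: key.
Qed.

Lemma is_derive_fibre u (t : R) : u != 0 -> 0 < t ->
  is_derive t 1 (fun s : R => lam (s *: u))
    (Num.sg c * (sH (t *: u) + a) / (t * I2 (t *: u))).
Proof.
move=> u0 t0; have tu0 := scaled_neq0 t0 u0.
rewrite -sHE; have := dlam_self tu0; rewrite diff_scale => h.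
suff <- : 'd lam (t *: u) u =
    (Hfun alpha I1 (t *: u) + alpha * c) / (t * I2 (t *: u)).
  exact: is_derive_ray (lam_diff tu0).
apply: (mulfI (lt0r_neq0 t0)); rewrite h.
have I2n : I2 (t *: u) != 0 by rewrite gt_eqF// I2_gt0.
by field; rewrite I2n gt_eqF.
Qed.

Lemma fiber_criticalP u (t : R) : u != 0 ->
  fiber_critical lam u t <-> 0 < t /\ sH (t *: u) = - a.
Proof.
move=> u0; split=> -[t0 h]; split=> //.
  have [_ h1] := is_derive_fibre u0 t0; have [_ h2] := h.
  move: h1; rewrite h2 => /esym/eqP.
  rewrite !mulf_eq0 invr_eq0 mulf_eq0 sgr_eq0 (negbTE c_neq0) (gt_eqF t0).
  rewrite (gt_eqF (I2_gt0 (scaled_neq0 t0 u0))) !orbF /=.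
  by rewrite addr_eq0 => /eqP.
by have := is_derive_fibre u0 t0; rewrite h addNr mulr0 mul0r.
Qed.

Lemma fibre_level u : u != 0 -> exists T : R, [/\ 0 < T, sH (T *: u) = - a,
  (forall t, 0 < t < T -> - a < sH (t *: u)) &
  forall t, T < t -> sH (t *: u) < - a].
Proof.
move=> u0; have [s [s0 inc dec]] := sH_unimodal u0.
have cg : continuous (fun t : R => sH (t *: u)).
  move=> t; apply: (@continuous_comp _ _ _ (fun t : R => t *: u) sH).
    exact: scalel_continuous.
  exact: sH_continuous.
have g0 : sH ((0 : R) *: u) = 0 by rewrite scale0r sH0.
have nA : ~ [set u] (0 : X) by move=> /= h; rewrite -h eqxx in u0.
have cA : weakly_compact [set u] by exact: compact_set1.
have [B [Br hB]] := sH_diverges cA nA (- a).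
pose t1 := Num.max B 0 + 1.
have t10 : 0 < t1 by rewrite ltr_wpDl// le_max lexx orbT.
have Bt1 : B < t1 by rewrite ltr_pwDr// le_max lexx.
by have := unimodal_level cg g0 a_gt0 s0 inc dec t10 (hB _ Bt1 _ erefl).
Qed.

Lemma exists_unique_critical u : u != 0 ->
  exists! t : R, fiber_critical lam u t.
Proof.
move=> u0; have [T [T0 hT lt gt]] := fibre_level u0.
exists T; split; first exact/fiber_criticalP.
move=> t /(fiber_criticalP t u0)[t0 ht].
have [tT|Tt|//] := ltgtP T t.
  by have := gt _ tT; rewrite ht ltxx.
by have := lt t; rewrite t0 Tt ht ltxx => /(_ isT).
Qed.

Lemma tcP u : u != 0 -> [/\ 0 < tc u, sH (tc u *: u) = - a,
  (forall t, 0 < t < tc u -> - a < sH (t *: u)) &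
  forall t, tc u < t -> sH (t *: u) < - a].
Proof.
move=> u0; have [T [T0 hT lt gt]] := fibre_level u0.
have /fiber_criticalP[//|t0 ht] : fiber_critical lam u (tc u).
  by apply: (@getPex _ (fiber_critical lam u)); exists T; exact/fiber_criticalP.
suff -> : tc u = T by split.
have [tT|Tt|//] := ltgtP (tc u) T.
  by have := lt (tc u); rewrite t0 tT ht ltxx => /(_ isT).
by have := gt _ Tt; rewrite ht ltxx.
Qed.

Lemma tc_gt0 u : u != 0 -> 0 < tc u. Proof. by move/tcP => []. Qed.

Lemma tc_unique u (t : R) : u != 0 -> 0 < t -> sH (t *: u) = - a -> tc u = t.
Proof.
move=> u0 t0 ht; have [_ _ lt gt] := tcP u0.
have [tT|Tt|//] := ltgtP (tc u) t; first by have := gt _ tT; rewrite ht ltxx.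
by have := lt t; rewrite t0 Tt ht ltxx => /(_ isT).
Qed.

Lemma tc_scale u (b : R) : u != 0 -> 0 < b -> tc (b *: u) = tc u / b.
Proof.
move=> u0 b0; have [t0 ht _ _] := tcP u0.
apply: tc_unique; [exact: scaled_neq0|by rewrite divr_gt0|].
by rewrite scalerA divfK// gt_eqF.
Qed.

Lemma Lam_scale u (b : R) : u != 0 -> 0 < b -> Lam (b *: u) = Lam u.
Proof.
by move=> u0 b0; rewrite /fiber_lambda tc_scale// scalerA divfK// gt_eqF.
Qed.

(** Only the signs of [sH + a] on both sides of the critical point are used: they
    persist nearby. *)
Lemma tc_continuous u : u != 0 -> {for u, continuous tc}.
Proof.
move=> u0; have [t0 ht lt gt] := tcP u0.
apply/cvgrPdist_lt => e e0; pose d := Num.min (e / 2) (tc u / 2).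
have d0 : 0 < d by rewrite lt_min !divr_gt0.
have [de dt] : d <= e / 2 /\ d <= tc u / 2 by rewrite /d !ge_min !lexx orbT.
have ch (t : R) : {for u, continuous (fun v => sH (t *: v))}.
  apply: (@continuous_comp _ _ _ (fun v : X => t *: v) sH).
    exact: scaler_continuous.
  exact: sH_continuous.
have h1 : - a < sH ((tc u - d) *: u) by apply: lt; lra.
have h2 : sH ((tc u + d) *: u) < - a by apply: gt; lra.
near=> v; have v0 : v != 0.
  by near: v; exact: near_neq0.
have [vt0 vh vlt vgt] := tcP v0.
have l1 : - a < sH ((tc u - d) *: v) by near: v; exact: (cvgr_gt _ (ch _) _ h1).
have l2 : sH ((tc u + d) *: v) < - a by near: v; exact: (cvgr_lt _ (ch _) _ h2).
have m1 : tc u - d < tc v.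
  rewrite ltNge le_eqVlt; apply/negP => /orP[/eqP E|/vgt]; last lra.
  by move: l1; rewrite -E vh ltxx.
have m2 : tc v < tc u + d.
  rewrite ltNge le_eqVlt; apply/negP => /orP[/eqP E|E].
    by move: l2; rewrite E vh ltxx.
  have := vlt (tc u + d); rewrite E => /(_ _)/wrap[]; first by lra.
  by lra.
rewrite ltr_norml; lra.
Unshelve. all: by end_near. Qed.

Lemma lam_continuous u : u != 0 -> {for u, continuous lam}.
Proof. by move=> u0; apply: differentiable_continuous; exact: lam_diff. Qed.

Lemma Lam_continuous u : u != 0 -> {for u, continuous Lam}.
Proof.
move=> u0; apply: (@continuous_comp _ _ _ (fun u => tc u *: u) lam).
  by apply: cvgZ; [exact: tc_continuous|exact: cvg_id].
by apply: lam_continuous; apply: scaled_neq0 => //; exact: tc_gt0.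
Qed.

(** The derivative along the fibre changes sign at the critical point, from the
    sign of [c] to the opposite one: the reduced functional is a maximum for
    positive [c] and a minimum for negative [c]. *)
Lemma Lam_extremal u (t : R) : u != 0 -> 0 < t ->
  0 <= Num.sg c * (Lam u - lam (t *: u)).
Proof.
move=> u0 t0; have [tc0 ht lt gt] := tcP u0.
have cts (x y : R) : 0 < x -> {within `[x, y], continuous (fun s => lam (s *: u))}.
  move=> x0; apply: continuous_in_subspaceT => s; rewrite inE /= in_itv /=.
  move=> /andP[xs _]; apply: is_derive_continuous; apply: is_derive_fibre => //.
  exact: lt_le_trans xs.
have I2p s : 0 < s -> 0 < s * I2 (s *: u).
  by move=> s0; rewrite mulr_gt0// I2_gt0// scaled_neq0.
have dv (x y s : R) : 0 < x -> s \in `]x, y[%R ->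
    is_derive s 1 (fun s : R => lam (s *: u))
      (Num.sg c * (sH (s *: u) + a) / (s * I2 (s *: u))).
  rewrite in_itv /= => x0 /andP[xs _].
  by apply: is_derive_fibre => //; exact: lt_trans xs.
have sgK (x y z : R) : Num.sg c * (Num.sg c * x / y * z) = x / y * z.
  by rewrite !mulrA -expr2 sqr_sg c_neq0 mul1r.
have [tT|Tt|->] := ltgtP t (tc u); last by rewrite subrr mulr0.
  have [s] := MVT tT (fun s => @dv _ _ s t0) (cts _ _ t0).
  rewrite in_itv /= => /andP[ts sT]; have s0 := lt_trans t0 ts.
  rewrite /fiber_lambda => ->; rewrite sgK.
  rewrite mulr_ge0 ?divr_ge0 ?(ltW (I2p _ s0)) ?subr_ge0 ?(ltW tT)//.
  by have := lt s; rewrite s0 sT => /(_ isT); lra.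
have [s] := MVT Tt (fun s => @dv _ _ s tc0) (cts _ _ tc0).
rewrite in_itv /= => /andP[Ts st]; have s0 := lt_trans tc0 Ts.
move=> E; have -> : Lam u - lam (t *: u) = - (lam (t *: u) - lam (tc u *: u)).
  by rewrite opprB.
rewrite E mulrN sgK -!mulNr.
rewrite mulr_ge0 ?divr_ge0 ?(ltW (I2p _ s0)) ?subr_ge0 ?(ltW Tt)//.
by have := gt _ Ts; lra.
Qed.

(** Since [Lam] is a maximum or a minimum over the fibre, its increments are
    bounded above by increments of [lam] along one suitable multiple. *)
Lemma Lam_increment u v : u != 0 -> v != 0 -> exists2 t : R,
  t = tc u \/ t = tc v & Lam v - Lam u <= lam (t *: v) - lam (t *: u).
Proof.
move=> u0 v0; have [c0|c0] := leP 0 c.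
  exists (tc v); first by right.
  have := Lam_extremal u0 (tc_gt0 v0).
  rewrite gtr0_sg ?lt_neqAle ?(eq_sym 0) ?c_neq0// mul1r.
  by rewrite -/(Lam v); lra.
exists (tc u); first by left.
have := Lam_extremal v0 (tc_gt0 u0).
by rewrite ltr0_sg// mulN1r oppr_ge0 -/(Lam u); lra.
Qed.

(** The derivative of [Lam] in direction [v], for the 0-homogeneous extension
    of [Lam] from the unit sphere. *)
Definition slope (u v : X) : R := tc u * 'd lam (tc u *: u) v.

Lemma cvg_dlam (T : Type) (F : set_system T) {FF : Filter F} (g w : T -> X)
    (u v : X) : u != 0 -> g t @[t --> F] --> u -> w t @[t --> F] --> v ->
  'd lam (g t) (w t) @[t --> F] --> 'd lam u v.
Proof.
move=> u0 gu wv; rewrite dlamE//.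
have gn0 : \forall t \near F, g t != 0.
  exact: (gu _ (near_neq0 u0)).
apply: (@cvg_trans _ (('d I1 (g t) (w t) - lam (g t) * 'd I2 (g t) (w t)) /
    I2 (g t) @[t --> F])).
  by apply: near_eq_cvg; near=> t; rewrite dlamE//; near: t.
apply: cvgM.
  apply: cvgB; first exact: cvg_diff.
  apply: cvgM; last exact: cvg_diff.
  by apply: continuous_cvg => //; exact: lam_continuous.
apply: cvgV; first by rewrite gt_eqF// I2_gt0.
by apply: continuous_cvg => //; exact: C1_continuous.
Unshelve. all: by end_near. Qed.

Lemma cvg_slope (T : Type) (F : set_system T) {FF : Filter F} (g w : T -> X)
    (u v : X) : u != 0 -> g t @[t --> F] --> u -> w t @[t --> F] --> v ->
  slope (g t) (w t) @[t --> F] --> slope u v.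
Proof.
move=> u0 gu wv.
have tcg : tc (g t) @[t --> F] --> tc u.
  by apply: continuous_cvg => //; exact: tc_continuous.
apply: cvgM => //; apply: cvg_dlam => //; last exact: cvgZ.
by rewrite scaled_neq0// tc_gt0.
Qed.

(** The mean value theorem applied to the increment of [lam] provided by
    [Lam_increment]; the differential of [lam] is jointly continuous in the point,
    the multiple and the direction, and [tc] is continuous. *)
Lemma descent u0 v0 (m : R) : u0 != 0 -> m < slope u0 v0 ->
  exists2 r : R, 0 < r & forall u v (s : R), `|u - u0| < r -> `|v - v0| < r ->
    0 <= s -> s < r -> u - s *: v != 0 /\ Lam (u - s *: v) <= Lam u - s * m.
Proof.
move=> u00 msl.
have [r1 r10 h1] : exists2 r1 : R, 0 < r1 & forall (z : X) (t : R) (v : X),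
    `|z - u0| < r1 -> `|t - tc u0| < r1 -> `|v - v0| < r1 ->
    z != 0 /\ m < t * 'd lam (t *: z) v.
  pose F := nbhs (u0, tc u0, v0).
  have c1 : p.1.1 @[p --> F] --> u0.
    by apply: (cvg_comp fst fst); exact: cvg_fst.
  have c2 : p.1.2 @[p --> F] --> tc u0.
    by apply: (cvg_comp fst snd); [exact: cvg_fst|exact: cvg_snd].
  have c3 : p.2 @[p --> F] --> v0 by exact: cvg_snd.
  have h : \forall p \near F, p.1.1 != 0 /\ m < p.1.2 * 'd lam (p.1.2 *: p.1.1) p.2.
    near=> p; split; near: p.
      exact: (c1 _ (near_neq0 u00)).
    apply: (cvgr_gt _ _ _ msl); apply: cvgM => //; apply: cvg_dlam => //.
      by rewrite scaled_neq0// tc_gt0.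
    exact: cvgZ.
  have /nbhs_ballP[r /= r0 hr] := h.
  exists r => // z t v zu tu vv; apply: (hr (z, t, v)).
  by split; [split|]; rewrite -ball_normE /= distrC.
have [r2 r20 h2] : exists2 r2 : R, 0 < r2 & forall z : X, `|z - u0| < r2 ->
    `|tc z - tc u0| < r1.
  have /cvgrPdist_lt/(_ r1 r10)/nbhs_ballP[r2 /= r20 hr2] := tc_continuous u00.
  exists r2 => // z zu; rewrite distrC; apply: hr2.
  by rewrite -ball_normE /= distrC.
(* A step of length [s < r] moves the point by at most [r * (`|v0| + 1)]. *)
pose k := `|v0| + 3; have k0 : 0 < k by rewrite ltr_wpDl.
pose q := Num.min r1 r2.
have q0 : 0 < q by rewrite lt_min r10.
have [q1 q2] : q <= r1 /\ q <= r2 by rewrite /q !ge_min !lexx orbT.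
pose r := Num.min 1 (q / k).
have r0 : 0 < r by rewrite lt_min ltr01 divr_gt0.
have [rle1 rk] : r <= 1 /\ r <= q / k by rewrite /r !ge_min !lexx orbT.
have rq : r <= q.
  apply: le_trans rk _; rewrite ler_pdivrMr// ler_peMr ?ltW// /k.
  by have := normr_ge0 v0; lra.
exists r => // u v s uu0 vv0 s0 sr.
have nv : `|v| <= `|v0| + 1.
  by have := ler_normD (v - v0) v0; rewrite subrK; lra.
have close (x : R) : 0 <= x <= 1 -> `|u - (x * s) *: v - u0| < q.
  move=> /andP[x0 x1]; rewrite addrAC.
  apply: le_lt_trans (ler_normB _ _) _; rewrite normrZ normrM (ger0_norm x0) (ger0_norm s0).
  have xs : x * s * `|v| <= s * (`|v0| + 1).
    by rewrite -mulrA; apply: (@le_trans _ _ (s * `|v|)); 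
      [rewrite ler_piMl ?mulr_ge0|rewrite ler_wpM2l].
  have : r * k <= q by rewrite -ler_pdivlMr.
  have : s * (`|v0| + 1) <= r * (`|v0| + 1) by rewrite ler_wpM2r ?addr_ge0// ltW.
  by rewrite /k; lra.
have uq : `|u - u0| < q by apply: lt_le_trans uu0 rq.
have vr1 : `|v - v0| < r1 by lra.
have w1 : `|u - s *: v - u0| < q.
  by have := close 1; rewrite mul1r ler01 lexx => /(_ isT).
have tcu : `|tc u - tc u0| < r1 by apply: h2; lra.
have tcw : `|tc (u - s *: v) - tc u0| < r1 by apply: h2; lra.
have un0 : u != 0 by apply: (h1 u (tc u) v _ _ _).1; lra.
have wn0 : u - s *: v != 0 by apply: (h1 _ (tc u) v _ _ _).1 => //; lra.
split=> //.
have [t tE ht] := Lam_increment un0 wn0.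
have t1 : `|t - tc u0| < r1 by case: tE => ->.
have t0 : 0 < t by case: tE => ->; exact: tc_gt0.
rewrite -lerBlDl; apply: le_trans ht _.
pose w := - ((t * s) *: v).
have Ew (x : R) : t *: u + x *: w = t *: (u - (x * s) *: v).
  by rewrite /w scalerN scalerBr !scalerA mulrCA mulrA.
have [|x x01] := @MVT_line R X lam (t *: u) w.
  move=> x x01; rewrite Ew; apply: lam_diff; apply: scaled_neq0 => //.
  by apply: (h1 _ t v _ _ _).1 => //; have := close x x01; lra.
have -> : t *: u + w = t *: (u - s *: v).
  by have := Ew 1; rewrite scale1r mul1r.
move=> ->; rewrite Ew /w diff_opp diff_scale.
have [_ hm] := h1 _ _ _ (lt_le_trans (close x x01) q1) t1 vr1.
by rewrite lerN2 (mulrC t) -mulrA ler_wpM2l// ltW.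
Unshelve. all: by end_near. Qed.

(** * Compactness properties of the reduced functional *)

Hypothesis ucX : uniformly_convex X.
Hypothesis normC1 : C1_on [set u : X | u != 0] (fun u : X => `|u|).
Hypothesis I2_0 : I2 0 = 0.
Hypothesis dI2_cc : completely_continuous (fun u => 'd I2 u : X -> R).
Variables (J K : X -> R) (c1 c2 beta eta : R).
Hypotheses (J_C1 : C1 J) (K_C1 : C1 K) (I1E : forall u, I1 u = J u - K u).
Hypothesis dK_cc : completely_continuous (fun u => 'd K u : X -> R).
Hypotheses (c1_gt0 : 0 < c1) (c2_gt0 : 0 < c2).
Hypotheses (alpha_le_beta : alpha <= beta) (eta_gt1 : 1 < eta).
Hypothesis J_coercive : forall u, c1 * `|u| `^ beta <= J u.
Hypothesis J_monotone : forall u v,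
  c2 * (`|u| `^ (eta - 1) - `|v| `^ (eta - 1)) * (`|u| - `|v|)
    <= 'd J u (u - v) - 'd J v (u - v).
Hypothesis K_small : c < 0 -> forall e : R, 0 < e ->
  exists T : R, forall u : X, T < `|u| -> K u <= e * `|u| `^ alpha.

Lemma unit_neq0 (u : X) : `|u| = 1 -> u != 0.
Proof. by move=> u1; rewrite -normr_gt0 u1. Qed.

Lemma I2_scale u (t : R) : 0 < t -> u != 0 -> I2 (t *: u) = t `^ alpha * I2 u.
Proof. exact: I2_hom. Qed.

(** Monotonicity of the differential makes [J] lie above its tangent at 0. *)
Lemma J_tangent w : J 0 + 'd J 0 w <= J w.
Proof.
have [|s s01] := @MVT_line R X J 0 w; first by move=> s _; exact: C1_diff.
rewrite !add0r -lerBrDl => ->.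
have [->|s0] := eqVneq s 0; first by rewrite scale0r.
have {s01}s0 : 0 < s by rewrite lt_neqAle eq_sym s0; case/andP: s01.
have := J_monotone (s *: w) 0; rewrite subr0 normr0 powR0; last by rewrite subr_eq0 gt_eqF.
rewrite !subr0 !diff_scale -mulrBr => h.
rewrite -(ler_pM2l s0) -subr_ge0 -mulrBr; apply: le_trans h.
by rewrite !mulr_ge0 ?powR_ge0// ltW.
Qed.

(** Otherwise the values would blow up along a weakly convergent sequence. *)
Lemma cc_bounded (f : X -> R) (M : R) : C1 f ->
    completely_continuous (fun u => 'd f u : X -> R) ->
  exists B : R, forall u, `|u| <= M -> f u <= B.
Proof.
move=> f1 fc; apply: contrapT => /forallNP h.
have /choice[u Hu] : forall n : nat, exists u, `|u| <= M /\ n%:R < f u.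
  move=> n; have /existsNP[u /not_implyP[uM /negP]] := h n%:R.
  by rewrite -ltNge => fu; exists u.
have [g gi [l gl]] := weak_subseq ucX normC1 (fun n => (Hu n).1).
have /cvgseqP/(_ 1 ltr01)[N hN] :=
  weakly_continuous f1 fc (fun n => (Hu (g n)).1) gl.
have [n ln] : exists n : nat, f l + 1 < n%:R.
  exists (Num.bound `|f l + 1|).
  exact: le_lt_trans (ler_norm _) (archi_boundP (normr_ge0 _)).
have := hN (maxn N n) (leq_maxl _ _); have := (Hu (g (maxn N n))).2.
have : n%:R <= (g (maxn N n))%:R :> R.
  by rewrite ler_nat (leq_trans (leq_maxr N n))// incr_ge.
by rewrite ltr_norml /=; lra.
Qed.

Lemma weak_cvg0_bounded (v : nat -> X) (t : nat -> R) (T : R) :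
  (forall n, 0 <= t n <= T) -> weak_cvg v 0 -> weak_cvg (fun n => t n *: v n) 0.
Proof.
move=> tT v0 phi; have T0 : 0 <= T by have /andP[] := tT 0%N; exact: le_trans.
have phi0 : sval phi 0 = 0 by exact: (linear0 (sval phi)).
rewrite phi0; apply/cvgseqP => e e0; have T1 : 0 < T + 1 by rewrite ltr_wpDl.
have := v0 phi; rewrite phi0 => /cvgseqP/(_ _ (divr_gt0 e0 T1))[N hN].
exists N => n /hN; rewrite !subr0 (linear_scale (sval phi)) normrM => h.
have /andP[t0 tT'] := tT n; rewrite (ger0_norm t0).
rewrite ltr_pdivlMr// mulrC in h; apply: le_lt_trans h.
by rewrite ler_wpM2r// (le_trans tT')// lerDl.
Qed.

(** On bounded multiples of the vectors the denominator of [lam] tends to 0.  For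
    positive [c] some fixed large multiple makes the numerator at least 1, by
    coercivity of [J].  For negative [c] the numerator is at least a fraction of
    [- c] on bounded multiples, because [J] lies above its tangent, and it grows at
    least like the power [alpha] of the norm on large ones. *)
Lemma Lam_blowup (v : nat -> X) : (forall n, `|v n| = 1) -> weak_cvg v 0 ->
  exists2 k : R, 0 < k & exists N, forall n, (N <= n)%N ->
    k / I2 (v n) <= Lam (v n).
Proof.
move=> v1 v0; have vn0 n := unit_neq0 (v1 n); have I2v n := I2_gt0 (vn0 n).
have [c_lt0|c_gt0|c0] := ltgtP c 0; last by have := c_neq0; rewrite c0 eqxx.
- have [T1 hT1] := K_small c_lt0 (divr_gt0 c1_gt0 (ltr0Sn _ 1)).
  pose T := Num.max T1 1.
  have [TT1 T_ge1] : T1 <= T /\ 1 <= T by rewrite /T !le_max !lexx orbT.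
  have T0 : 0 < T by lra.
  have large w : T < `|w| -> c1 / 2 * `|w| `^ alpha <= I1 w.
    move=> Tw; have := hT1 w (le_lt_trans TT1 Tw); have := J_coercive w.
    rewrite I1E; have : `|w| `^ alpha <= `|w| `^ beta by rewrite ler_powR//; lra.
    by rewrite -(ler_pM2l c1_gt0); lra.
  (* Truncating the multiples keeps them bounded, so that these points still tend
     weakly to 0. *)
  pose w n := Num.min (tc (v n)) T *: v n.
  have tcv n := tc_gt0 (vn0 n).
  have w0 : weak_cvg w 0.
    apply: (@weak_cvg0_bounded v _ T) => // n.
    by rewrite le_min ge_min lexx orbT andbT !ltW.
  have wT n : `|w n| <= T.
    by rewrite normrZ v1 mulr1 ger0_norm ?ge_min ?lexx ?orbT// le_min !ltW.
  have lowJ : J 0 + 'd J 0 (w n) - K (w n) @[n --> \oo] --> (0 : R).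
    have E0 : J 0 + 'd J 0 0 - K 0 = 0 by rewrite diff_zero addr0 -I1E I1_0.
    rewrite -[X in _ --> X]E0; apply: cvgB.
      apply: cvgD; first exact: cvg_cst.
      by apply: weak_cvg_diff => //; exact: C1_diff.
    exact: (weakly_continuous K_C1 dK_cc wT w0).
  have c20 : 0 < - c / 2 by rewrite divr_gt0// oppr_gt0.
  have /cvgseqP/(_ _ c20)[N hN] := lowJ.
  have Ta : 0 < T `^ alpha by rewrite powR_gt0.
  exists (Num.min (c1 / 2) (- c / 2 / T `^ alpha)).
    by rewrite lt_min !divr_gt0// oppr_gt0.
  exists N => n /hN; rewrite subr0 => hn.
  have [tT|Tt] := leP (tc (v n)) T.
    apply: (@le_trans _ _ (- c / 2 / T `^ alpha / I2 (v n))).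
      by apply: ler_wpM2r; [rewrite invr_ge0 ltW|rewrite ge_min lexx orbT].
    have wE : w n = tc (v n) *: v n by rewrite /w min_l.
    have num : - c / 2 <= I1 (tc (v n) *: v n) - c.
      rewrite -wE I1E; have := J_tangent (w n).
      by move: hn; rewrite ltr_norml; lra.
    rewrite /fiber_lambda /lambda I2_scale// -mulrA -invfM.
    apply: ler_pM => //; first by rewrite divr_ge0// ltW// oppr_gt0.
      by rewrite invr_ge0 mulr_ge0 ?powR_ge0// ltW.
    rewrite lef_pV2 ?posrE ?mulr_gt0 ?powR_gt0//.
    by rewrite ler_wpM2r ?(ltW (I2v n))// ge0_ler_powR ?nnegrE// ltW.
  apply: (@le_trans _ _ (c1 / 2 / I2 (v n))).
    by apply: ler_wpM2r; [rewrite invr_ge0 ltW|rewrite ge_min lexx].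
  rewrite /fiber_lambda /lambda I2_scale//.
  have ta : 0 < tc (v n) `^ alpha by rewrite powR_gt0.
  have nt : `|tc (v n) *: v n| = tc (v n) by rewrite normrZ v1 mulr1 gtr0_norm.
  have := large (tc (v n) *: v n); rewrite nt => /(_ Tt) hl.
  rewrite invfM mulrA ler_wpM2r ?invr_ge0 ?(ltW (I2v n))//.
  by rewrite ler_pdivlMr//; lra.
- (* [B = t `^ alpha] is large enough for [J (t *: v n)] to exceed [K 0 + c + 2]. *)
  pose B := Num.max 1 ((K 0 + c + 2) / c1).
  have [B1 Bc] : 1 <= B /\ (K 0 + c + 2) / c1 <= B by rewrite /B !le_max !lexx orbT.
  have B0 : 0 < B by lra.
  pose t := B `^ alpha^-1.
  have ta : t `^ alpha = B by rewrite /t -powRrM mulVf ?gt_eqF// powRr1// ltW.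
  have t0 : 0 < t by rewrite powR_gt0.
  have t1 : 1 <= t by rewrite -(powRr0 B) ler_powR// invr_ge0 ltW.
  have w0 : weak_cvg (fun n => t *: v n) 0.
    by apply: (@weak_cvg0_bounded v _ t) => // n; rewrite lexx ltW.
  have wt n : `|t *: v n| <= t by rewrite normrZ v1 mulr1 gtr0_norm.
  have /cvgseqP/(_ 1 ltr01)[N hN] := weakly_continuous K_C1 dK_cc wt w0.
  exists B^-1; first by rewrite invr_gt0.
  exists N => n /hN hn.
  apply: (@le_trans _ _ (lam (t *: v n))); last first.
    by have := Lam_extremal (vn0 n) t0; rewrite gtr0_sg// mul1r subr_ge0.
  rewrite /lambda I2_scale// ta -invfM -[leLHS]mul1r.
  rewrite ler_wpM2r ?invr_ge0 ?mulr_ge0 1?ltW// I1E.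
  have : B <= t `^ beta by rewrite -ta ler_powR.
  have := J_coercive (t *: v n); rewrite normrZ v1 mulr1 gtr0_norm//.
  move: Bc; rewrite ler_pdivrMr// => Bc hJ tb.
  have : B * c1 <= c1 * t `^ beta by rewrite mulrC ler_pM2l.
  by move: hn; rewrite ltr_norml; lra.
Qed.

(** If [I2] tended to 0 along a sequence of the sublevel set, a weak limit would be
    a zero of [I2], hence 0, against [Lam_blowup]. *)
Lemma I2_sublevel (M : R) : exists2 d : R, 0 < d &
  forall u, `|u| = 1 -> Lam u <= M -> d <= I2 u.
Proof.
apply: contrapT => /forall2NP h.
have /choice[u Hu] : forall n : nat, exists u,
    [/\ `|u| = 1, Lam u <= M & I2 u < @harmonic R n].
  move=> n; have [] := h (@harmonic R n); first by rewrite invr_gt0.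
  move=> /existsNP[u /not_implyP[u1 /not_implyP[uM /negP]]].
  by rewrite -ltNge => ud; exists u.
have u1 n : `|u n| = 1 by have [] := Hu n.
have [g gi [l gl]] := weak_subseq ucX normC1 (fun n => eq_ler (u1 n)).
pose v := u \o g.
have v1 n : `|v n| = 1 by exact: u1.
have I2l := weakly_continuous I2_C1 dI2_cc (fun n => eq_ler (v1 n)) gl.
have I2v n : I2 (v n) < @harmonic R n.
  have [_ _ h2] := Hu (g n); apply: lt_le_trans h2 _.
  by rewrite /harmonic /= lef_pV2 ?posrE// ler_nat ltnS incr_ge.
have I2v0 n : 0 < I2 (v n) by apply: I2_gt0; exact: unit_neq0.
have har := (cvgseqP _ _).1 (@cvg_harmonic R).
have small e : 0 < e -> exists N, forall n, (N <= n)%N -> I2 (v n) < e.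
  move=> /har[N hN]; exists N => n /hN; apply: le_lt_trans.
  by rewrite subr0; apply: le_trans (ler_norm _); rewrite ltW// I2v.
have l0 : l = 0.
  apply/eqP; apply: contraT => /I2_gt0 I2l0.
  have e2 : 0 < I2 l / 2 by rewrite divr_gt0.
  have [N1 h1] := small _ e2; have [N2 h2] := (cvgseqP _ _).1 I2l _ e2.
  have := h1 _ (leq_maxl N1 N2); have := h2 _ (leq_maxr N1 N2).
  by rewrite ltr_norml /=; lra.
rewrite l0 in gl; have [k k0 [N hN]] := Lam_blowup v1 gl.
have M1 : 0 < `|M| + 1 by rewrite ltr_wpDl.
have [N' hN'] := small _ (divr_gt0 k0 M1).
have := hN _ (leq_maxl N N'); have := hN' _ (leq_maxr N N').
set n := maxn N N'; rewrite ltr_pdivlMr// ler_pdivrMr//.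
have [_ LM _] := Hu (g n); rewrite -/(v n) in LM.
have : Lam (v n) * I2 (v n) <= (`|M| + 1) * I2 (v n).
  rewrite ler_wpM2r ?(ltW (I2v0 n))//.
  by rewrite (le_trans LM)// (le_trans (ler_norm M))// lerDl.
by move: (Lam _) (I2 _) => x y; lra.
Qed.

(** Near 0 the function [sH] stays above the level at which [tc] is defined. *)
Lemma tc_lower : exists2 r : R, 0 < r & forall u, `|u| = 1 -> r <= tc u.
Proof.
have /cvgrPdist_lt/(_ a a_gt0)/nbhs_ballP[r /= r0 hr] := @sH_continuous 0.
exists r => // u u1; have [t0 ht _ _] := tcP (unit_neq0 u1).
rewrite leNgt; apply/negP => tr; have := hr (tc u *: u).
rewrite -ball_normE /= sub0r normrN normrZ u1 mulr1 gtr0_norm// => /(_ tr).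
by rewrite ht sH0 sub0r opprK ger0_norm ?ltxx// ltW// a_gt0.
Qed.

(** A weakly convergent sequence with nonzero limit forms, together with its limit,
    a weakly compact set on which [sH] diverges uniformly. *)
Lemma tc_sublevel (M : R) : exists T : R,
  forall u, `|u| = 1 -> Lam u <= M -> tc u <= T.
Proof.
have [d d0 hd] := I2_sublevel M.
apply: contrapT => /forallNP h.
have /choice[u Hu] : forall n : nat, exists u,
    [/\ `|u| = 1, Lam u <= M & n%:R < tc u].
  move=> n; have /existsNP[u /not_implyP[u1 /not_implyP[uM /negP]]] := h n%:R.
  by rewrite -ltNge => ud; exists u.
have u1 n : `|u n| = 1 by have [] := Hu n.
have [g gi [l gl]] := weak_subseq ucX normC1 (fun n => eq_ler (u1 n)).
have I2l := weakly_continuous I2_C1 dI2_cc (fun n => eq_ler (u1 (g n))) gl.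
have l0 : l != 0.
  apply/eqP => l0; have [N hN] := (cvgseqP _ _).1 I2l d d0.
  have [h1 h2 _] := Hu (g N); have := hN N (leqnn _); have := hd _ h1 h2.
  by rewrite l0 I2_0 subr0 /= ltr_norml; lra.
pose A : set X := [set l] `|` range (u \o g).
have cA : weakly_compact A.
  by apply: cvg_range_compact; apply/weak_cvgP.
have A0 : ~ A 0.
  case=> [/= E|[n _ /= E]]; first by rewrite -E eqxx in l0.
  by have := u1 (g n); rewrite E normr0 => /eqP; rewrite eq_sym oner_eq0.
have [T [_ hT]] := sH_diverges cA A0 (- a).
have [n Tn] : exists n : nat, T < n%:R.
  exists (Num.bound `|T|).
  exact: le_lt_trans (ler_norm _) (archi_boundP (normr_ge0 _)).
have [_ _ tcn] := Hu (g n).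
have [_ ht _ _] := tcP (unit_neq0 (u1 (g n))).
have gn : n%:R <= (g n)%:R :> R by rewrite ler_nat incr_ge.
have := hT (tc (u (g n))); rewrite (lt_trans Tn (le_lt_trans gn tcn)).
by move=> /(_ isT (u (g n)))/(_ (or_intror (ex_intro2 _ _ n I erefl))); rewrite ht ltxx.
Qed.

Lemma Lam_bounded_below : exists m : R, forall u, `|u| = 1 -> m <= Lam u.
Proof.
have [d d0 hd] := I2_sublevel 0; have [T hT] := tc_sublevel 0.
have [r r0 hr] := tc_lower; have [B hB] := cc_bounded T K_C1 dK_cc.
pose B' := `|B| + `|c|.
have rd : 0 < r `^ alpha * d by rewrite mulr_gt0// powR_gt0.
exists (- (B' / (r `^ alpha * d))) => u u1.
have B'0 : 0 <= B' by rewrite addr_ge0.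
have [Lu|/ltW Lu] := leP (Lam u) 0; last first.
  by apply: le_trans Lu; rewrite oppr_le0 divr_ge0// ltW.
have u0 := unit_neq0 u1; have tc0 := tc_gt0 u0.
have nt : `|tc u *: u| = tc u by rewrite normrZ u1 mulr1 gtr0_norm.
have := hB (tc u *: u); rewrite nt => /(_ (hT u u1 Lu)) Kw.
have Jw : 0 <= J (tc u *: u).
  by apply: le_trans (J_coercive _); rewrite mulr_ge0 ?powR_ge0// ltW.
have I2w : r `^ alpha * d <= I2 (tc u *: u).
  rewrite I2_scale//; apply: ler_pM; rewrite ?powR_ge0 ?(ltW d0)//; last exact: hd.
  by apply: ge0_ler_powR; rewrite ?nnegrE ?hr// ltW.
rewrite /fiber_lambda /lambda.
apply: (@le_trans _ _ (- B' / I2 (tc u *: u))).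
  rewrite mulNr lerN2 ler_wpM2l// lef_pV2 ?posrE//.
  exact: lt_le_trans I2w.
rewrite ler_wpM2r ?invr_ge0 ?(le_trans (ltW rd) I2w)// I1E.
by have := ler_norm B; have := ler_norm c; rewrite /B'; lra.
Qed.

(** The Palais-Smale condition: weak limits are nonzero by [I2_sublevel], and
    the monotonicity of the differential of [J], tested with the difference to
    the weak limit, forces convergence of the norms, hence strong convergence
    by uniform convexity. *)
Lemma palais_smale (u : nat -> X) (M l : R) :
    (forall n, `|u n| = 1) -> (forall n, Lam (u n) <= M) ->
    Lam (u n) @[n --> \oo] --> l ->
    (forall e : R, 0 < e -> exists N, forall n, (N <= n)%N ->
       forall x, `|slope (u n) x| <= e * `|x|) ->
  exists w, [/\ `|w| = 1, Lam w = l & forall x, slope w x = 0].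
Proof.
move=> u1 uM ul us; have [d d0 hd] := I2_sublevel M.
have [T hT] := tc_sublevel M; have [r r0 hr] := tc_lower.
have [g gi [w gw]] := weak_subseq ucX normC1 (fun n => eq_ler (u1 n)).
have tT n : `|tc (u (g n))| <= T.
  by rewrite gtr0_norm ?hT// tc_gt0// unit_neq0.
have [f fi [t ft]] := bounded_cvg_subseq tT.
pose v n := u (g (f n)).
have gfi : increasing_seq (g \o f) by exact: increasing_comp.
have v1 n : `|v n| = 1 by exact: u1.
have vn0 n := unit_neq0 (v1 n).
have vw : weak_cvg v w by exact: (weak_cvg_subseq fi gw).
have vl : Lam (v n) @[n --> \oo] --> l by exact: (cvg_subseq gfi ul).
have vs (e : R) : 0 < e -> exists N, forall n, (N <= n)%N ->
    forall x, `|slope (v n) x| <= e * `|x|.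
  move=> /us[N hN]; exists N => n Nn; apply: hN.
  exact: leq_trans (incr_ge n gfi).
have tr : r <= t.
  apply: limr_ge_seq ft _ => n; exact: hr.
have t0 : 0 < t by lra.
have w0 : w != 0.
  apply/eqP => w0; have I2l := weakly_continuous I2_C1 dI2_cc (fun n => eq_ler (v1 n)) vw.
  have [N hN] := (cvgseqP _ _).1 I2l d d0.
  have := hd _ (v1 N) (uM _); have := hN N (leqnn _).
  by rewrite w0 I2_0 subr0 ltr_norml; lra.
pose y n := tc (v n) *: v n; pose z := t *: w.
have yz : weak_cvg y z by exact: weak_cvgZ.
have tv n := tc_gt0 (vn0 n).
have ny n : `|y n| = tc (v n) by rewrite normrZ v1 mulr1 gtr0_norm.
have yT n : `|y n| <= T by rewrite ny hT//; exact: uM.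
have dT n : `|y n - z| <= T + `|z| by rewrite (le_trans (ler_normB _ _))// lerD2r.
have yn0 n : y n != 0 by exact: scaled_neq0.
have weak0 (h : X -> R) : C1 h -> 'd h z (y n - z) @[n --> \oo] --> (0 : R).
  move=> h1; under eq_fun do rewrite diff_sub.
  rewrite -(subrr ('d h z z)); apply: cvgB; last exact: cvg_cst.
  by apply: weak_cvg_diff => //; exact: C1_diff.
have dI2y := cc_cvg I2_C1 dI2_cc yz dT (weak0 _ I2_C1).
have dKy := cc_cvg K_C1 dK_cc yz dT (weak0 _ K_C1).
have dlamy : 'd lam (y n) (y n - z) @[n --> \oo] --> (0 : R).
  apply/cvgseqP => e e0.
  have T1 : 0 < T + `|z| + 1.
    by have := yT 0%N; have := normr_ge0 (y 0%N); have := normr_ge0 z; lra.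
  have [N hN] := vs _ (divr_gt0 (mulr_gt0 e0 r0) T1).
  exists N => n /hN/(_ (y n - z)); rewrite subr0 /slope -/(y n) normrM.
  rewrite (gtr0_norm (tv n)) => h.
  rewrite -(ltr_pM2l (tv n)); apply: le_lt_trans h _.
  apply: (@lt_le_trans _ _ (e * r / (T + `|z| + 1) * (T + `|z| + 1))).
    rewrite ltr_pM2l ?divr_gt0 ?mulr_gt0//.
    by have := dT n; lra.
  by rewrite divfK ?gt_eqF// mulrC ler_pM2r//; exact: hr.
have I2y := weakly_continuous I2_C1 dI2_cc yT yz.
have E0 (p q : R) : p * 0 + q * 0 = 0 by rewrite !mulr0 addr0.
have dI1y : 'd I1 (y n) (y n - z) @[n --> \oo] --> (0 : R).
  have -> : (fun n => 'd I1 (y n) (y n - z)) =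
      (fun n => I2 (y n) * 'd lam (y n) (y n - z) +
                Lam (v n) * 'd I2 (y n) (y n - z)).
    by apply/funext => n; exact: dI1E.
  rewrite -[X in _ --> X](E0 (I2 z) l).
  exact: (cvgD (cvgM I2y dlamy) (cvgM vl dI2y)).
have dJ x h : 'd J x h = 'd I1 x h + 'd K x h.
  have -> : J = I1 + K by apply/funext => x'; rewrite !fctE I1E subrK.
  exact: (congr1 (fun F : X -> R => F h)
    (derive.diffD (C1_diff x I1_C1) (C1_diff x K_C1))).
have dJy : 'd J (y n) (y n - z) - 'd J z (y n - z) @[n --> \oo] --> (0 : R).
  rewrite -[X in _ --> X](subr0 (0 : R)); apply: cvgB; last exact: weak0.
  have -> : (fun n => 'd J (y n) (y n - z)) =
      (fun n => 'd I1 (y n) (y n - z) + 'd K (y n) (y n - z)).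
    by apply/funext => n; exact: dJ.
  by rewrite -[X in _ --> X](addr0 (0 : R)); exact: (cvgD dI1y dKy).
have tvt : tc (v n) @[n --> \oo] --> t by exact: ft.
have mono : c2 * (t `^ (eta - 1) - `|z| `^ (eta - 1)) * (t - `|z|) <= 0.
  have lim : c2 * (tc (v n) `^ (eta - 1) - `|z| `^ (eta - 1)) * (tc (v n) - `|z|)
      @[n --> \oo] --> c2 * (t `^ (eta - 1) - `|z| `^ (eta - 1)) * (t - `|z|).
    apply: cvgM; last by apply: cvgB => //; exact: cvg_cst.
    apply: cvgMl_tmp; apply: cvgB; last exact: cvg_cst.
    exact: cvg_powR.
  apply: ler_cvg_to lim dJy _; apply: nearW => n.
  by rewrite -!ny; exact: J_monotone.
have tz : t = `|z|.
  have e0 : 0 < eta - 1 by rewrite subr_gt0.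
  have [tz|zt|//] := ltgtP t `|z|.
    have : t `^ (eta - 1) < `|z| `^ (eta - 1).
      by rewrite gt0_ltr_powR ?nnegrE// ltW.
    by move: mono; rewrite -mulrA pmulr_rle0//; nra.
  have : `|z| `^ (eta - 1) < t `^ (eta - 1).
    by rewrite gt0_ltr_powR ?nnegrE// ltW.
  by move: mono; rewrite -mulrA pmulr_rle0//; nra.
have w1 : `|w| = 1.
  move: tz; rewrite normrZ gtr0_norm// => /eqP.
  by rewrite -{1}[t]mulr1 => /eqP/(mulfI (lt0r_neq0 t0)).
have vw' : v n @[n --> \oo] --> w by exact: (radon_riesz ucX normC1 v1 w1 vw).
exists w; split=> //.
  apply: (cvg_unique _ _ vl) => //.
  by apply: continuous_cvg => //; exact: Lam_continuous.
move=> x; have sx : slope (v n) x @[n --> \oo] --> slope w x.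
  by apply: cvg_slope => //; exact: cvg_cst.
apply: (cvg_unique _ sx) => //; apply/cvgseqP => e e0.
have x1 : 0 < `|x| + 1 by rewrite ltr_wpDl.
have [N hN] := vs _ (divr_gt0 e0 x1); exists N => n /hN/(_ x).
rewrite subr0 => /le_lt_trans; apply.
by rewrite -[ltRHS](divfK (lt0r_neq0 x1)) ltr_pM2l ?divr_gt0// ltrDl.
Qed.

(** By complete continuity, finitely many of the functionals [dI2 w] have no
    common zero where [I2] is bounded away from 0: otherwise one could choose
    successively points killed by the functionals at all the previous ones,
    against Euler's identity at a weak cluster point. *)
Lemma I2_separating (d : R) : 0 < d -> exists ws : seq X,
  forall u, `|u| = 1 -> d <= I2 u -> exists2 w, w \in ws & 'd I2 w u != 0.
Proof.
move=> d0; apply: contrapT => /forallNP h.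
have /choice[pick Hp] : forall ws : seq X, exists u,
    [/\ `|u| = 1, d <= I2 u & forall w, w \in ws -> 'd I2 w u = 0].
  move=> ws; have /existsNP[u /not_implyP[u1 /not_implyP[ud hu]]] := h ws.
  exists u; split=> // w wws; apply/eqP; apply: contrapT => /negP hw.
  by apply: hu; exists w.
pose L := fix L n := if n is m.+1 then pick (L m) :: L m else [::].
pose u n := pick (L n).
have u1 n : `|u n| = 1 by have [] := Hp (L n).
have uL m n : (m < n)%N -> u m \in L n.
  elim: n => // n IH; rewrite ltnS leq_eqVlt => /orP[/eqP->|/IH] /=.
    by rewrite mem_head.
  by rewrite inE => ->; rewrite orbT.
have [g gi [l gl]] := weak_subseq ucX normC1 (fun n => eq_ler (u1 n)).
have e0 : 0 < alpha * d / 4 by rewrite divr_gt0// mulr_gt0.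
have [N hN] := cc_near dI2_cc gl e0.
have := hN N (leqnn _) (u (g N.+1)); have := hN N.+1 (leqnSn _) (u (g N.+1)).
have [_ dN hu] := Hp (L (g N.+1)).
rewrite /= u1 mulr1 (hu (u (g N))); last by apply: uL; exact: incr_lt.
rewrite (euler_identity I2_hom) ?unit_neq0//; last exact: C1_diff.
have : alpha * d <= alpha * I2 (u (g N.+1)) by rewrite ler_pM2l.
by rewrite !ler_norml; move: ('d I2 l _) (I2 _) => x y; lra.
Qed.

(** * Ground state and minimax levels *)

Hypothesis infX : infinite_dimensional X.

Local Notation S := (unit_sphere X).

Lemma slopeZ u (b : R) v : slope u (b *: v) = b * slope u v.
Proof. by rewrite /slope diff_scale mulrCA. Qed.

Lemma slopeD u v w : slope u (v + w) = slope u v + slope u w.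
Proof. by rewrite /slope diff_add mulrDr. Qed.

(** By homogeneity, and applying the bound to opposite directions. *)
Lemma slope_bound u (e : R) : (forall v, `|v| <= 1 -> slope u v <= e) ->
  forall x, `|slope u x| <= e * `|x|.
Proof.
move=> h x; have [->|x0] := eqVneq x 0.
  by rewrite -(scale0r 0) slopeZ mul0r scale0r !normr0 mulr0.
have nx : 0 < `|x| by rewrite normr_gt0.
have key (y : X) : `|y| = `|x| -> slope u y <= e * `|x|.
  move=> yx; have := h (`|x|^-1 *: y).
  rewrite normrZ ger0_norm ?invr_ge0// yx mulVf ?gt_eqF// => /(_ (lexx _)).
  by rewrite slopeZ mulrC ler_pdivrMr.
have := key (- x); rewrite normrN => /(_ erefl).
rewrite -scaleN1r slopeZ mulN1r => kN; have := key x erefl.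
by rewrite ler_norml; lra.
Qed.

Lemma critical_of_slope w : w != 0 -> (forall x, slope w x = 0) ->
  critical_point lam (tc w *: w).
Proof.
move=> w0 sw; have tw := tc_gt0 w0; have tw0 := scaled_neq0 tw w0.
split=> //; split; first exact: lam_diff.
by move=> v; apply: (mulfI (lt0r_neq0 tw)); rewrite mulr0; exact: sw.
Qed.

Lemma critical_Nehari u : critical_point lam u -> Nehari lam u.
Proof. by move=> [u0 [_ du]]; split. Qed.

(** A point of the Nehari set is the critical point of its own fibre. *)
Lemma Nehari_fibre u : Nehari lam u ->
  exists2 w, `|w| = 1 & Lam w = lam u.
Proof.
move=> [u0]; rewrite dlam_self// => /eqP.
rewrite mulf_eq0 invr_eq0 (gt_eqF (I2_gt0 u0)) orbF sHE mulf_eq0 sgr_eq0.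
rewrite (negbTE c_neq0) /= addr_eq0 => /eqP su.
have tu : tc u = 1 by apply: tc_unique => //; rewrite scale1r.
exists (`|u|^-1 *: u); first exact: sphere_proj_norm.
by rewrite Lam_scale ?invr_gt0 ?normr_gt0// /fiber_lambda tu scale1r.
Qed.

(** Normalising moves the point no further than the step did. *)
Lemma sphere_step (u v : X) (s : R) : `|u| = 1 -> `|v| <= 1 -> 0 <= s ->
  u - s *: v != 0 -> `|u - `|u - s *: v|^-1 *: (u - s *: v)| <= 2 * s.
Proof.
move=> u1 v1 s0; set w := u - s *: v => w0.
have uw : `|u - w| <= s.
  by rewrite /w opprB addrC subrK normrZ ger0_norm// ler_piMr.
have nw : 0 < `|w| by rewrite normr_gt0.
have : `|w - `|w|^-1 *: w| <= s.
  rewrite -{1}[w]scale1r -scalerBl normrZ -{2}[`|w|](gtr0_norm nw) -normrM.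
  rewrite mulrBl mul1r mulVf ?gt_eqF// -u1 distrC.
  exact: le_trans (ler_dist_dist _ _) uw.
have := ler_normD (u - w) (w - `|w|^-1 *: w).
by rewrite addrA subrK; lra.
Qed.

Lemma sphere_nonempty : exists u : X, `|u| = 1.
Proof.
have [e he] := exists_free 1 infX.
have e0 : e 0%N != 0.
  apply/eqP => e0; have := he (fun=> 1); rewrite big_ord1 e0 scaler0.
  by move=> /(_ erefl 0%N isT)/eqP; rewrite oner_eq0.
by exists (`|e 0%N|^-1 *: e 0%N); exact: sphere_proj_norm.
Qed.

(** Ekeland's principle on the sphere provides almost minimal points of small
    slope. *)
Lemma almost_minimum (u0 : X) (e : R) : `|u0| = 1 -> 0 < e ->
  exists u, [/\ `|u| = 1, Lam u <= Lam u0 & forall x, `|slope u x| <= e * `|x|].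
Proof.
move=> u01 e0; pose T := {u : X | `|u| = 1}.
have e3 : 0 < e / 3 by rewrite divr_gt0.
have [m hm] := Lam_bounded_below.
pose p (u : T) : X := sval u.
have p1 u : `|p u| = 1 by exact: (svalP u).
pose x0 : T := exist _ u0 u01.
have [] := @ekeland R T (fun u v => `|p u - p v|) (fun u => Lam (p u)) m (e / 3) x0 e3.
- by [].
- by move=> u; rewrite subrr normr0.
- by move=> u v; rewrite distrC.
- by move=> u v w; rewrite -(subrKA (p v) (p u) (- p w)); exact: ler_normD.
- by move=> u; exact: hm.
- move=> s /cauchyseq_cvg[l sl].
  have l1 : `|l| = 1.
    have nl : `|p (s n)| @[n --> \oo] --> `|l| by exact: cvg_norm.
    have l1' : `|p (s n)| @[n --> \oo] --> (1 : R).
      have -> : (fun n => `|p (s n)|) = cst 1 by apply/funext => n; exact: p1.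
      exact: cvg_cst.
    exact: (cvg_unique _ nl l1').
  by exists (exist _ l l1) => e' /((cvgseqP _ _).1 sl).
- move=> s u L /cvgseqP su [N hN]; apply/ler_addgt0Pr => e' e'0.
  have Lc : Lam (p (s n)) @[n --> \oo] --> Lam (p u).
    by apply: (cvg_comp _ _ su); apply: Lam_continuous; exact: unit_neq0.
  have [N' hN'] := (cvgseqP _ _).1 Lc _ e'0.
  have := hN' _ (leq_maxr N N'); have := hN _ (leq_maxl N N').
  by rewrite ltr_norml; lra.
move=> [u u1] /= [Lu hu]; exists u; split=> //; apply: slope_bound => v v1.
rewrite leNgt; apply/negP => /(descent (unit_neq0 u1))[r r0 hr].
have s0 : 0 < r / 2 by rewrite divr_gt0.
have uu (z : X) : `|z - z| < r by rewrite subrr normr0.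
have sr : r / 2 < r by lra.
have [w0 Lw] := hr u v (r / 2) (uu u) (uu v) (ltW s0) sr.
have := hu (exist _ _ (sphere_proj_norm w0)); rewrite /= Lam_scale//; last first.
  by rewrite invr_gt0 normr_gt0.
have := sphere_step u1 v1 (ltW s0) w0; rewrite -(ler_pM2l e3).
by move: Lw; move: (Lam _) (Lam u) => x y; nra.
Qed.

Lemma palais_smale_harmonic (u : nat -> X) (l : R) :
    (forall n, `|u n| = 1) -> (forall n, Lam (u n) <= l + @harmonic R n) ->
    (forall n, l - @harmonic R n <= Lam (u n)) ->
    (forall n x, `|slope (u n) x| <= @harmonic R n * `|x|) ->
  exists w, [/\ `|w| = 1, Lam w = l & forall x, slope w x = 0].
Proof.
move=> u1 uL lu su.
have har1 n : @harmonic R n <= 1 by rewrite invf_le1// ler1n.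
have har (e : R) : 0 < e -> exists N, forall n, (N <= n)%N -> @harmonic R n < e.
  move=> e0; have [N hN] := (cvgseqP _ _).1 (@cvg_harmonic R) e e0.
  exists N => n /hN; rewrite subr0; apply: le_lt_trans; exact: ler_norm.
apply: (@palais_smale u (l + 1) l u1).
- by move=> n; rewrite (le_trans (uL n))// lerD2l.
- apply/cvgseqP => e /har[N hN]; exists N => n /hN hn.
  by have := uL n; have := lu n; rewrite ltr_norml; lra.
- move=> e /har[N hN]; exists N => n /hN hn x.
  by apply: le_trans (su n x) _; rewrite ler_wpM2r// ltW.
Qed.

Lemma ground_state : exists w, [/\ `|w| = 1, forall x, slope w x = 0 &
  forall u, `|u| = 1 -> Lam w <= Lam u].
Proof.
have [m hm] := Lam_bounded_below; have [v0 v01] := sphere_nonempty.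
pose A := [set Lam u | u in S].
have infA : has_inf A.
  by split; [exists (Lam v0), v0|exists m => _ [u u1 <-]; exact: hm].
have lbA u : `|u| = 1 -> inf A <= Lam u.
  by move=> u1'; apply: ge_inf; [exact: infA.2|exists u].
have har0 n : 0 < @harmonic R n by rewrite invr_gt0.
have hle n : inf A - @harmonic R n <= inf A by rewrite gerBl ltW.
have /choice[u Hu] : forall n, exists u, [/\ `|u| = 1,
    Lam u < inf A + @harmonic R n & forall x, `|slope u x| <= @harmonic R n * `|x|].
  move=> n; have [_ [v v1 <-] Lv] := inf_adherent (har0 n) infA.
  have [u [u1' Lu su]] := almost_minimum v1 (har0 n).
  by exists u; split=> //; exact: le_lt_trans Lv.
have u1 n : `|u n| = 1 by have [] := Hu n.
have Lu n : Lam (u n) < inf A + @harmonic R n by have [] := Hu n.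
have su n x : `|slope (u n) x| <= @harmonic R n * `|x| by have [] := Hu n.
have [w [w1 Lw sw]] := palais_smale_harmonic u1 (fun n => ltW (Lu n))
  (fun n => le_trans (hle n) (lbA _ (u1 n))) su.
by exists w; split=> // v /lbA; rewrite Lw.
Qed.

Section Even.
Hypotheses (I1_even : forall u, I1 (- u) = I1 u) (I2_even : forall u, I2 (- u) = I2 u).

Lemma opp_neq0 (u : X) : u != 0 -> - u != 0. Proof. by rewrite oppr_eq0. Qed.

Lemma lam_even u : lam (- u) = lam u.
Proof. by rewrite /lambda I1_even I2_even. Qed.

Lemma dlam_odd u v : u != 0 -> 'd lam (- u) v = - 'd lam u v.
Proof. by move=> u0; have [] := diff_even v lam_even (lam_diff u0). Qed.

Lemma sH_even u : sH (- u) = sH u.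
Proof.
rewrite /sH /Hfun diff_opp I1_even.
by have [-> _] := diff_even u I1_even (C1_diff u I1_C1); rewrite opprK.
Qed.

Lemma tc_even u : u != 0 -> tc (- u) = tc u.
Proof.
move=> u0; have [t0 ht _ _] := tcP u0; apply: tc_unique => //.
  exact: opp_neq0.
by rewrite scalerN sH_even.
Qed.

Lemma Lam_even u : u != 0 -> Lam (- u) = Lam u.
Proof. by move=> u0; rewrite /fiber_lambda tc_even// scalerN lam_even. Qed.

Lemma slope_odd u v : u != 0 -> slope (- u) v = - slope u v.
Proof.
move=> u0; rewrite /slope tc_even// scalerN dlam_odd ?mulrN//.
by apply: scaled_neq0 => //; exact: tc_gt0.
Qed.

Definition supLam (F : set X) : R := sup (Lam @` F).

Lemma has_sup_Lam (F : set X) : compact F -> F !=set0 -> F `<=` S ->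
  has_sup (Lam @` F).
Proof.
move=> cF F0 FS; apply: compact_has_sup; first exact: image_nonempty.
apply: continuous_compact => //; apply: continuous_in_subspaceT => u.
by rewrite inE => /FS/unit_neq0/Lam_continuous.
Qed.

Lemma Lam_le_sup (F : set X) u : compact F -> F `<=` S -> F u ->
  Lam u <= supLam F.
Proof.
move=> cF FS Fu; apply: sup_upper_bound; last by exists u.
by apply: has_sup_Lam => //; exists u.
Qed.

Lemma supLam_le (F : set X) (L : R) : F !=set0 ->
  (forall u, F u -> Lam u <= L) -> supLam F <= L.
Proof.
by move=> F0 h; apply: ge_sup => [|_ [u Fu <-]]; [exact: image_nonempty|exact: h].
Qed.

(** An odd pseudo-gradient field on a compact symmetric part of the sphere; no
    slope is required where [Lam] is below the level [b]. *)
Lemma odd_descent_field (G : set X) (b e : R) : compact G -> symmetric_set G ->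
    G `<=` S ->
    (forall u, G u -> Lam u < b \/ exists2 v, `|v| <= 1 & e < slope u v) ->
  exists V : X -> X, forall u, G u -> [/\ {for u, continuous V},
    V (- u) = - V u, `|V u| <= 1 & Lam u < b \/ e < slope u (V u)].
Proof.
move=> cG Gs GS Gsl.
pose P (u : X) := [set v : X | `|v| <= 1 /\ (Lam u < b \/ e < slope u v)].
have Pc u : convex (P u).
  move=> x y t /andP[t0 t1] [x1 xP] [y1 yP]; split.
    apply: le_trans (ler_normD _ _) _; rewrite !normrZ (ger0_norm t0).
    rewrite ger0_norm ?subr_ge0//.
    have : t * `|x| <= t by rewrite ler_piMr.
    have : (1 - t) * `|y| <= 1 - t by rewrite ler_piMr// subr_ge0.
    by lra.
  case: xP => [->|xP]; first by left.
  case: yP => [->|yP]; first by left.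
  right; rewrite slopeD !slopeZ.
  have [->|t_neq0] := eqVneq t 0; first by rewrite mul0r add0r subr0 mul1r.
  have t_gt0 : 0 < t by rewrite lt_neqAle eq_sym t_neq0.
  have := ltr_pM2l t_gt0 e (slope u x); rewrite xP => hx.
  have : (1 - t) * e <= (1 - t) * slope u y by rewrite ler_wpM2l ?subr_ge0// ltW.
  by move: hx; move: (slope _ _) (slope _ _) => p q; lra.
have Pl u : G u -> exists v, \forall u' \near u, P u' v.
  move=> Gu; have u0 := unit_neq0 (GS _ Gu).
  have [Lu|[v v1 sv]] := Gsl u Gu.
    exists 0; near=> u'; split; first by rewrite normr0 ler01.
    by left; near: u'; exact: (cvgr_lt _ (Lam_continuous u0) _ Lu).
  exists v; near=> u'; split=> //; right; near: u'.
  have sc : slope u' v @[u' --> u] --> slope u v.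
    by apply: (@cvg_slope _ _ _ (fun x => x) (fun=> v)) => //; exact: cvg_cst.
  exact: (cvgr_gt _ sc _ sv).
have [V HV] := convex_selection cG Pc Pl.
exists (fun u => 2^-1 *: (V u - V (- u))) => u Gu.
have GNu := Gs _ Gu; have u0 := unit_neq0 (GS _ Gu).
have [cu [Vu1 VuP]] := HV u Gu; have [cNu [VNu1 VNuP]] := HV _ GNu.
have PN : P u (- V (- u)).
  split; first by rewrite normrN.
  case: VNuP; rewrite ?Lam_even// => h; first by left.
  right; rewrite -scaleN1r slopeZ mulN1r.
  by move: h; rewrite slope_odd.
have h2 : 0 <= (2^-1 : R) <= 1 by rewrite invr_ge0 ler0n invf_le1 ?ler1n.
have := Pc u _ _ _ h2 (conj Vu1 VuP) PN.
have -> : 1 - (2^-1 : R) = 2^-1 by lra.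
rewrite -scalerDr => -[W1 WP]; split=> //; last first.
  by rewrite opprK -scalerN opprB.
have cNV : V (- u') @[u' --> u] --> V (- u).
  apply: (@cvg_comp _ _ _ (fun x : X => - x) V _ (nbhs (- u))) => //.
  exact: opp_continuous.
apply: cvgZl_tmp; apply: cvgB; [exact: cu|exact: cNV].
Unshelve. all: by end_near. Qed.

(** Compactness turns the local rates of [descent] into a common step; below the
    level [b] continuity of [Lam] suffices. *)
Lemma uniform_descent (G : set X) (V : X -> X) (b e : R) : compact G ->
    G `<=` S -> 0 < e -> b + e / 2 <= supLam G ->
    (forall u, G u -> [/\ {for u, continuous V}, `|V u| <= 1 &
       Lam u < b \/ e < slope u (V u)]) ->
  exists2 s : R, 0 < s & forall u, G u -> u - s *: V u != 0 /\
    Lam (u - s *: V u) <= supLam G - s * e.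
Proof.
move=> cG GS e0 bG HV.
have /compact_near_coveringP/near_covering_withinP cov := cG.
pose Q (s : R) (u : X) := u - s *: V u != 0 /\
    Lam (u - s *: V u) <= supLam G - s * e.
have /(cov _ _ Q) : forall u, G u -> \forall u' \near u & s \near (0 : R)^'+,
    G u' -> Q s u'.
  move=> u Gu; have [cV V1 VP] := HV u Gu; have u0 := unit_neq0 (GS _ Gu).
  have right (r : R) : 0 < r -> \forall s \near (0 : R)^'+, 0 < s < r.
    move=> r0; near=> s; apply/andP; split; near: s.
      exact: nbhs_right_gt.
    exact: nbhs_right_lt.
  case: VP => [Lu|/(descent u0)[r r0 hr]].
    have [r r0 hr] : exists2 r : R, 0 < r & forall z, `|z - u| < r ->
        z != 0 /\ Lam z < b.
      have /nbhs_ballP[r /= r0 hr] : \forall z \near u, z != 0 /\ Lam z < b.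
        near=> z; split; near: z; first exact: near_neq0.
        exact: (cvgr_lt _ (Lam_continuous u0) _ Lu).
      by exists r => // z zu; apply: hr; rewrite -ball_normE /= distrC.
    pose q := Num.min (r / 2) 2^-1.
    have q0 : 0 < q by rewrite lt_min invr_gt0 divr_gt0 /=.
    have [q1 q2] : q <= r / 2 /\ q <= 2^-1 by rewrite /q !ge_min !lexx orbT.
    have r2 : 0 < r / 2 by rewrite divr_gt0.
    exists (ball u (r / 2), [set s | 0 < s < q]).
      by split; [exact: nbhsx_ballx|exact: right].
    move=> [u' s] /= [uu' /andP[s0 sq]] Gu'.
    have [_ V1' _] := HV u' Gu'.
    move: uu'; rewrite -ball_normE /= distrC => uu'.
    have sV : `|s *: V u'| <= s by rewrite normrZ gtr0_norm// ler_piMr// ltW.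
    have [|z0 Lz] := hr (u' - s *: V u').
      by rewrite addrAC (le_lt_trans (ler_normB _ _))//; lra.
    split=> //; have : s * e <= 2^-1 * e by rewrite ler_wpM2r ?(ltW e0)//; lra.
    by lra.
  have [r' r'0 hr'] : exists2 r' : R, 0 < r' & forall z, `|z - u| < r' ->
      `|V z - V u| < r.
    have /cvgrPdist_lt/(_ r r0)/nbhs_ballP[r' /= r'0 h] := cV.
    exists r' => // z zu; rewrite distrC; apply: h.
    by rewrite -ball_normE /= distrC.
  pose q := Num.min r r'.
  have q0 : 0 < q by rewrite lt_min r0.
  have [q1 q2] : q <= r /\ q <= r' by rewrite /q !ge_min !lexx orbT.
  exists (ball u q, [set s | 0 < s < r]).
    by split; [exact: nbhsx_ballx|exact: right].
  move=> [u' s] /= [uu' /andP[s0 sr]] Gu'.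
  move: uu'; rewrite -ball_normE /= distrC => uu'.
  have [h1 h2] := hr u' (V u') s (lt_le_trans uu' q1) (hr' _ (lt_le_trans uu' q2))
    (ltW s0) sr.
  by split=> //; have := Lam_le_sup cG GS Gu'; lra.
move=> h; have : \forall s \near (0 : R)^'+, 0 < s /\ G `<=` Q s.
  by near=> s; split; near: s => //; exact: nbhs_right_gt.
by case/filter_ex => s [s0 Qs]; exists s.
Unshelve. all: by end_near. Qed.

(** Ekeland's principle on the odd maps from a compact symmetric set into the
    sphere, which do not decrease the genus: at an almost minimal map the field
    of [odd_descent_field] cannot exist, so some point of the image at a level
    close to [m] has small slope. *)
Lemma almost_critical (n : nat) (F : set X) (m e : R) : 0 < e ->
    (forall F', genus_family X n F' -> F' !=set0 -> m <= supLam F') ->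
    genus_family X n F -> F !=set0 -> supLam F <= m + e ->
  exists u, [/\ `|u| = 1, Lam u <= m + e, m - e <= Lam u &
    forall x, `|slope u x| <= e * `|x|].
Proof.
move=> e0 hm [cF Fs FS Fg] [x0 Fx0] Fe.
have e3 : 0 < e / 3 by rewrite divr_gt0.
pose T := {g : X -> X | {within F, continuous g} /\
  forall u, F u -> `|g u| = 1 /\ g (- u) = - g u}.
pose p (g : T) : X -> X := sval g.
have pc g : {within F, continuous (p g)} by have [] := svalP g.
have p1 g u : F u -> `|p g u| = 1 by move=> Fu; have [_ h] := svalP g; exact: (h u Fu).1.
have pN g u : F u -> p g (- u) = - p g u.
  by move=> Fu; have [_ h] := svalP g; exact: (h u Fu).2.
have pC g : compact (p g @` F) by apply: continuous_compact.
have pS g : p g @` F `<=` S by move=> _ [u Fu <-]; exact: p1.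
have p0 g : p g @` F !=set0 by exists (p g x0), x0.
have ps g : symmetric_set (p g @` F).
  by move=> _ [u Fu <-]; exists (- u); [exact: Fs|exact: pN].
have pG g : genus_family X n (p g @` F).
  by split=> //; apply: le_trans Fg _; apply: genus_image => // u; exact: pN.
pose phi g := supLam (p g @` F).
have mphi g : m <= phi g by exact: hm.
pose d (g h : T) := sup [set `|p g u - p h u| | u in F].
have dsup g h : has_sup [set `|p g u - p h u| | u in F].
  split; first by exists `|p g x0 - p h x0|, x0.
  exists 2 => _ [u Fu <-]; apply: le_trans (ler_normB _ _) _.
  by rewrite !p1//; lra.
have dle g h u : F u -> `|p g u - p h u| <= d g h.
  by move=> Fu; apply: sup_upper_bound => //; exists u.
have dge g h (r : R) : (forall u, F u -> `|p g u - p h u| <= r) -> d g h <= r.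
  by move=> hr; apply: ge_sup => [|_ [u Fu <-]]; [exact: (dsup g h).1|exact: hr].
have idT : {within F, continuous (@id X)} /\
    forall u : X, F u -> `|u| = 1 /\ (- u) = - u.
  split; last by move=> u /FS.
  by apply: continuous_subspaceT => u; exact: cvg_id.
(* A step [s] costs at most [e / 3 * (2 * s)] in distance and gains [s * e]. *)
have [] := @ekeland R T d phi m (e / 3) (exist _ id idT) e3.
- by move=> g h; apply: le_trans (dle g h x0 Fx0).
- move=> g; apply/eqP; rewrite eq_le; apply/andP; split.
    by apply: dge => u _; rewrite subrr normr0.
  by apply: le_trans (dle g g x0 Fx0).
- by move=> g h; congr sup; apply/seteqP; split=> _ [u Fu <-]; exists u => //;
    rewrite distrC.
- move=> g h k; apply: dge => u Fu.
  rewrite -(subrKA (p h u) (p g u)); apply: le_trans (ler_normD _ _) _.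
  by apply: lerD; exact: dle.
- exact: mphi.
- move=> s sC.
  have /choice[l Hl] : forall u, exists l : X, F u -> p (s k) u @[k --> \oo] --> l.
    move=> u; have [Fu|nFu] := pselect (F u); last by exists 0.
    have [|l hl] := @cauchyseq_cvg R X (fun k => p (s k) u); last by exists l.
    move=> r /sC[N hN]; exists N => i j Ni Nj; apply: le_lt_trans (hN i j Ni Nj).
    exact: dle.
  have unif (r : R) : 0 < r -> exists N, forall k, (N <= k)%N -> forall u, F u ->
      `|p (s k) u - l u| <= r.
    move=> r0; have r2 : 0 < r / 2 by rewrite divr_gt0.
    have [N hN] := sC _ r2; exists N => k Nk u Fu.
    have [N' hN'] := (cvgseqP _ _).1 (Hl u Fu) _ r2.
    have h1 := hN' _ (leq_maxr N N').
    have h2 := le_lt_trans (dle _ _ u Fu) (hN k _ Nk (leq_maxl N N')).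
    rewrite -(subrKA (p (s (maxn N N')) u)).
    by apply: le_trans (ler_normD _ _) _; lra.
  have lT : {within F, continuous l} /\ forall u, F u -> `|l u| = 1 /\ l (- u) = - l u.
    split.
      apply/subspace_continuousP => u Fu; apply/cvgrPdist_lt => r r0.
      have r3 : 0 < r / 3 by rewrite divr_gt0.
      have [N hN] := unif _ r3; have h1 := hN N (leqnn _) u Fu.
      have /subspace_continuousP/(_ u Fu)/cvgrPdist_lt/(_ _ r3) := pc (s N).
      rewrite !near_withinE; apply: filterS => v hv Fv.
      have h2 := hN N (leqnn _) v Fv; have h3 := hv Fv.
      have -> : l u - l v = (p (s N) u - p (s N) v) - (p (s N) u - l u)
          + (p (s N) v - l v).
        by rewrite opprB (addrC (p (s N) u - _)) !subrKA.
      have := ler_normD ((p (s N) u - p (s N) v) - (p (s N) u - l u))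
        (p (s N) v - l v).
      have := ler_normB (p (s N) u - p (s N) v) (p (s N) u - l u).
      lra.
    move=> u Fu; have hu := Hl u Fu; split.
      have n1 : `|p (s k) u| @[k --> \oo] --> `|l u| by exact: cvg_norm.
      have n2 : `|p (s k) u| @[k --> \oo] --> (1 : R).
        have -> : (fun k => `|p (s k) u|) = cst 1 by apply/funext => k; exact: p1.
        exact: cvg_cst.
      exact: (cvg_unique _ n1 n2).
    have n1 : p (s k) (- u) @[k --> \oo] --> - l u.
      have -> : (fun k => p (s k) (- u)) = (fun k => - p (s k) u).
        by apply/funext => k; exact: pN.
      exact: cvgN.
    exact: (cvg_unique _ (Hl _ (Fs _ Fu)) n1).
  exists (exist _ l lT) => r r0; have r2 : 0 < r / 2 by rewrite divr_gt0.
  have [N hN] := unif _ r2; exists N => k Nk.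
  have : d (s k) (exist _ l lT) <= r / 2 by apply: dge => u Fu; exact: hN.
  by lra.
- move=> s g L sg [N hN]; apply: supLam_le => // _ [u Fu <-].
  apply/ler_addgt0Pr => r r0.
  have su : p (s k) u @[k --> \oo] --> p g u.
    apply/cvgseqP => r' /sg[N' hN']; exists N' => k /hN'; apply: le_lt_trans.
    exact: dle.
  have Ls : Lam (p (s k) u) @[k --> \oo] --> Lam (p g u).
    by apply: (cvg_comp _ _ su); apply: Lam_continuous; apply: unit_neq0; exact: p1.
  have [N' hN'] := (cvgseqP _ _).1 Ls _ r0.
  have := hN' _ (leq_maxr N N'); have := hN _ (leq_maxl N N').
  have : Lam (p (s (maxn N N')) u) <= phi (s (maxn N N')).
    by apply: Lam_le_sup => //; exists u.
  by rewrite ltr_norml; lra.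
move=> g [gF gmin]; pose G := p g @` F.
have gFe : phi g <= m + e.
  by apply: le_trans Fe; move: gF; rewrite {2}/phi /p /= image_id.
apply: contrapT => /forallNP nu.
have [|V HV] := @odd_descent_field G (m - e / 2) e (pC g) (ps g) (pS g).
  move=> u Gu; have [|Lu] := ltP (Lam u) (m - e / 2); first by left.
  right; apply: contrapT => /forall2NP nv; apply: (nu u).
  have u1 : `|u| = 1 by exact: pS Gu.
  split=> //.
  - by apply: le_trans gFe; apply: Lam_le_sup.
  - by lra.
  - apply: slope_bound => v v1; have [//|/negP] := nv v.
    by rewrite -leNgt.
have [||s s0 hs] := @uniform_descent G V (m - e / 2) e (pC g) (pS g) e0.
- by have := mphi g; rewrite /phi -/G; lra.
- by move=> u /HV[].
have GF u : F u -> G (p g u) by move=> Fu; exists u.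
pose g' x := p g x - s *: V (p g x); pose h x := `|g' x|^-1 *: g' x.
have hT : {within F, continuous h} /\ forall u, F u -> `|h u| = 1 /\ h (- u) = - h u.
  split; last first.
    move=> u Fu; have [g'0 _] := hs _ (GF u Fu).
    split; first exact: sphere_proj_norm.
    have g'N : g' (- u) = - g' u.
      have [_ VN _ _] := HV _ (GF u Fu).
      by rewrite /g' pN// VN scalerN -opprD.
    by rewrite /h g'N normrN scalerN.
  apply/subspace_continuousP => u Fu.
  have gc : p g x @[x --> within F (nbhs u)] --> p g u.
    by have /subspace_continuousP := pc g; apply.
  have [cV _ _ _] := HV _ (GF u Fu); have [g'0 _] := hs _ (GF u Fu).
  have g'c : g' x @[x --> within F (nbhs u)] --> g' u.
    apply: cvgB => //; apply: cvgZl_tmp.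
    exact: (cvg_comp _ _ gc cV).
  exact: (cvg_comp _ _ g'c (sphere_proj_continuous g'0)).
have := gmin (exist _ h hT).
have : phi (exist _ h hT) <= phi g - s * e.
  apply: supLam_le => // _ [u Fu <-]; have [g'0 Lg'] := hs _ (GF u Fu).
  by rewrite /p /= /h Lam_scale// invr_gt0 normr_gt0.
have : e / 3 * d g (exist _ h hT) <= e / 3 * (2 * s).
  rewrite ler_pM2l//; apply: dge => u Fu; have [g'0 _] := hs _ (GF u Fu).
  have [_ _ V1 _] := HV _ (GF u Fu).
  by apply: sphere_step => //; [exact: p1|exact: ltW].
have := mulr_gt0 s0 e0.
move: (phi _) (phi g) (_ * d _ _) => x y z; lra.
Qed.

Lemma genus_family_neq0 (n : nat) (F : set X) : genus_family X n.+1 F -> F !=set0.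
Proof.
move=> [_ _ _ Fg]; apply/set0P/eqP => F0.
have : (genus F <= 0%:R%:E)%E.
  apply: (@genus_le R X F 0 (fun=> 0)).
    by apply: continuous_subspaceT => u; exact: cvg_cst.
  by rewrite F0.
by move=> /(le_trans Fg); rewrite lee_fin ler_nat.
Qed.

(** The minimax level as a real number, indexed from the genus [n.+1]. *)
Definition minmax (n : nat) : R := inf [set supLam F | F in genus_family X n.+1].

Lemma has_inf_minmax n : has_inf [set supLam F | F in genus_family X n.+1].
Proof.
have [F0 F0n] := exists_genus_family n infX; split; first by exists (supLam F0), F0.
have [m hm] := Lam_bounded_below; exists m => _ [F Fn <-].
have [u Fu] := genus_family_neq0 Fn; have [cF _ FS _] := Fn.
by apply: le_trans (Lam_le_sup cF FS Fu); apply: hm; exact: FS.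
Qed.

Lemma minmaxE n : (minmax n)%:E = minimax I1 I2 c n.+1.
Proof.
rewrite /minmax -ereal_inf_EFin; last 2 first.
- exact: (has_inf_minmax n).2.
- exact: (has_inf_minmax n).1.
congr ereal_inf; rewrite image_comp; apply/eq_imagel => F Fn /=.
have F0 := genus_family_neq0 Fn; have [cF _ FS _] := Fn.
have [h1 h2] := has_sup_Lam cF F0 FS.
by rewrite -ereal_sup_EFin// image_comp.
Qed.

Lemma minmax_nondecreasing : {homo minmax : m n / (m <= n)%N >-> m <= n}.
Proof.
move=> m n mn; apply: lb_le_inf; first exact: (has_inf_minmax n).1.
move=> _ [F [cF Fs FS Fg] <-]; apply: ge_inf; first exact: (has_inf_minmax m).2.
exists F => //; split => //; apply: le_trans Fg.
by rewrite lee_fin ler_nat.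
Qed.

(** The functionals of [I2_separating] map a sublevel set of [Lam] oddly into a
    punctured Euclidean space, which bounds its genus. *)
Lemma minmax_unbounded (M : R) : exists n, M < minmax n.
Proof.
have [d d0 hd] := I2_sublevel (M + 1); have [ws hws] := I2_separating d0.
exists (size ws); apply: (@lt_le_trans _ _ (M + 1)); first by rewrite ltrDl.
apply: lb_le_inf; first exact: (has_inf_minmax _).1.
move=> _ [F [cF Fs FS Fg] <-]; rewrite leNgt; apply/negP => FM.
have Lu u : F u -> Lam u <= M + 1.
  by move=> Fu; apply: ltW; apply: le_lt_trans FM; exact: Lam_le_sup.
have : (genus F <= (size ws)%:R%:E)%E.
  apply: (@genus_le R X F _ (fun u => \row_(i < size ws) 'd I2 (nth 0 ws i) u)).
    apply: continuous_subspaceT; apply: row_continuous => i.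
    by apply: diff_continuous; exact: C1_diff.
  move=> u Fu; split.
    by apply/rowP => i; rewrite !mxE diff_opp.
  have [w ww wu] := hws u (FS _ Fu) (hd _ (FS _ Fu) (Lu u Fu)).
  have iw : (index w ws < size ws)%N by rewrite index_mem.
  apply: contraNneq wu => /rowP/(_ (Ordinal iw)); rewrite !mxE /= nth_index// => ->.
  by [].
by move=> /(le_trans Fg); rewrite lee_fin ler_nat ltnn.
Qed.

Lemma minmax_critical n : exists2 w, w != 0 /\ (forall x, slope w x = 0) &
  Lam w = minmax n.
Proof.
have har0 k : 0 < @harmonic R k by rewrite invr_gt0.
have mle F : genus_family X n.+1 F -> F !=set0 -> minmax n <= supLam F.
  by move=> Fn _; apply: ge_inf; [exact: (has_inf_minmax n).2|exists F].
have /choice[u Hu] : forall k, exists u, [/\ `|u| = 1,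
    Lam u <= minmax n + @harmonic R k, minmax n - @harmonic R k <= Lam u &
    forall x, `|slope u x| <= @harmonic R k * `|x|].
  move=> k; have [_ [F Fn <-] FL] := inf_adherent (har0 k) (has_inf_minmax n).
  exact: (almost_critical (har0 k) mle Fn (genus_family_neq0 Fn) (ltW FL)).
have [|||| w [w1 Lw sw]] := @palais_smale_harmonic u (minmax n).
- by move=> k; have [] := Hu k.
- by move=> k; have [] := Hu k.
- by move=> k; have [] := Hu k.
- by move=> k x; have [_ _ _] := Hu k; apply.
by exists w => //; split=> //; exact: unit_neq0.
Qed.

Lemma minmax_critical_value n : critical_value lam (minmax n).
Proof.
have [w [w0 sw] Lw] := minmax_critical n.
by exists (tc w *: w); [exact: critical_of_slope|exact: Lw].
Qed.

Lemma critical_opp u : critical_point lam u -> critical_point lam (- u).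
Proof.
move=> [u0 [_ du]]; split; first exact: opp_neq0.
split; first by apply: lam_diff; exact: opp_neq0.
by move=> v; rewrite dlam_odd// du oppr0.
Qed.

(** Finitely many pairs would carry finitely many values, as [lam] is even. *)
Lemma infinite_critical_pairs :
  infinite_set [set [set u; - u] | u in critical_point lam].
Proof.
move=> fin; pose f (A : set X) : R := lam (get A).
have fE u : f [set u; - u] = lam u.
  have : [set u; - u] (get [set u; - u]) by apply: (@getPex _ [set u; - u]); exists u; left.
  by rewrite /f => -[->|->] //; exact: lam_even.
have := finite_image f fin; set B := f @` _ => finB.
have [M hM] : has_ubound B.
  have [B0|/eqP/set0P B0] := pselect (B = set0); first by rewrite B0; exists 0.
  by have [] := compact_has_sup B0 (finite_compact finB).
have [n Mn] := minmax_unbounded M; have [u cu Lu] := minmax_critical_value n.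
have : B (minmax n).
  by exists [set u; - u]; [exists u|rewrite fE].
by move=> /hM; rewrite leNgt Mn.
Qed.

End Even.

Lemma Nehari_min w : `|w| = 1 -> (forall u, `|u| = 1 -> Lam w <= Lam u) ->
  lbound [set lam u | u in Nehari lam] (Lam w).
Proof.
by move=> w1 hw _ [u /Nehari_fibre[v v1 <-] <-]; exact: hw.
Qed.

(** Every critical point lies in the Nehari set, so the three minima agree. *)
Lemma fibre_main :
  [/\ (forall u : X, u != 0 -> exists! t : R, fiber_critical lam u t),
      (exists lam1 : R,
         [/\ is_min [set Lam u | u in S] lam1,
             is_min [set lam u | u in Nehari lam] lam1 &
             is_min (critical_value lam) lam1]) &
      ((forall u, I1 (- u) = I1 u) -> (forall u, I2 (- u) = I2 u) ->
       (exists l : nat -> R,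
          [/\ (forall n, (l n)%:E = minimax I1 I2 c n.+1),
              (forall n, critical_value lam (l n)),
              {homo l : m n / (m <= n)%N >-> m <= n} &
              ~ has_ubound (range l)]) /\
       (forall u, critical_point lam u -> critical_point lam (- u)) /\
       infinite_set [set [set u; - u] | u in critical_point lam])].
Proof.
split; first exact: exists_unique_critical.
- have [w [w1 sw hw]] := ground_state.
  have cw := critical_of_slope (unit_neq0 w1) sw.
  exists (Lam w); split; split.
  + by exists w.
  + by move=> _ [u u1 <-]; exact: hw.
  + by exists (tc w *: w) => //; exact: critical_Nehari.
  + exact: Nehari_min.
  + by exists (tc w *: w).
  + move=> _ [u cu <-]; apply: (Nehari_min w1 hw).
    by exists u => //; exact: critical_Nehari.
- move=> I1e I2e; split; last first.
    by split; [exact: critical_opp|exact: infinite_critical_pairs].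
  exists minmax; split.
  + exact: minmaxE.
  + exact: minmax_critical_value.
  + exact: minmax_nondecreasing.
  + move=> [M hM]; have [n Mn] := minmax_unbounded M.
    by have := hM (minmax n); rewrite leNgt Mn => /(_ (ex_intro2 _ _ n I erefl)).
Qed.

End Fibre.

(** * Reduction to the sign of c *)

Lemma limf_esup_small (R : realType) (X : normedModType R) (K : X -> R)
    (alpha e : R) :
    (limf_esup (fun u => (K u / `|u| `^ alpha)%:E) (norm_infty X) <= 0)%E ->
  0 < e -> exists T : R, forall u : X, T < `|u| -> K u <= e * `|u| `^ alpha.
Proof.
move=> h e0; have : (limf_esup (fun u => (K u / `|u| `^ alpha)%:E)
    (norm_infty X) < e%:E)%E by apply: le_lt_trans h _; rewrite lte_fin.
move=> /ereal_inf_lt[_ [V [T _ TV] <-] hV]; exists (Num.max T 0) => u.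
rewrite gt_max => /andP[Tu u0].
rewrite -ler_pdivrMr ?powR_gt0// -lee_fin; apply: le_trans (ltW hV).
by apply: ereal_sup_ubound; exists u => //; exact: TV.
Qed.

Theorem theorem2p3 (R : realType) (X : completeNormedModType R)
    (infX : infinite_dimensional X) (ucX : uniformly_convex X)
    (normC1 : C1_on [set u : X | u != 0] (fun u : X => `|u|))
    (c : R) (c_neq0 : c != 0) (I1 I2 : X -> R)
    (I1_C1 : C1 I1) (I2_C1 : C1 I2) (I1_0 : I1 0 = 0) (I2_0 : I2 0 = 0)
    (I2_gt0 : forall u : X, u != 0 -> 0 < I2 u)
    (alpha : R) (alpha_gt1 : 1 < alpha) (I2_hom : homogeneous alpha I2)
    (dI2_cc : completely_continuous (fun u => 'd I2 u : X -> R))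
    (hF1 : 0 < c -> F1 alpha I1) (hF2 : c < 0 -> F2 alpha I1)
    (hF3 : F3 alpha I1)
    (H_lsc : 0 < c -> weakly_lsc (Hfun alpha I1))
    (H_usc : c < 0 -> weakly_usc (Hfun alpha I1)) :
  [/\ (forall u : X, u != 0 ->
         exists! t : R, fiber_critical (lambda I1 I2 c) u t),
      (exists lam1 : R,
         [/\ is_min [set fiber_lambda I1 I2 c u | u in unit_sphere X] lam1,
             is_min [set lambda I1 I2 c u | u in Nehari (lambda I1 I2 c)] lam1 &
             is_min (critical_value (lambda I1 I2 c)) lam1]) &
      (* lam n is the minimax value of index n + 1 *)
      ((forall u, I1 (- u) = I1 u) -> (forall u, I2 (- u) = I2 u) ->
       (exists lam : nat -> R,
          [/\ (forall n, (lam n)%:E = minimax I1 I2 c n.+1),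
              (forall n, critical_value (lambda I1 I2 c) (lam n)),
              {homo lam : m n / (m <= n)%N >-> m <= n} &
              ~ has_ubound (range lam)]) /\
       (forall u, critical_point (lambda I1 I2 c) u ->
                  critical_point (lambda I1 I2 c) (- u)) /\
       infinite_set [set [set u; - u]
                    | u in critical_point (lambda I1 I2 c)])].
Proof.
have [J [K [J_C1 K_C1 I1E dK_cc [hJ hK]]]] := hF3.
have [c1 [c2 [beta [eta [[c1_gt0 c2_gt0 ab eta_gt1] [Jc Jm]]]]]] := hJ.
have alpha_gt0 : 0 < alpha by exact: lt_trans alpha_gt1.
have sHc u : sH c alpha I1 u = Num.sg c * Hfun alpha I1 u by [].
have uni (u : X) : u != 0 -> exists s : R, [/\ 0 <= s,
    {in `]0, s[ &, {homo (fun t => sH c alpha I1 (t *: u)) : x y / x < y}} &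
    {in `]s, +oo[ &, {homo (fun t => sH c alpha I1 (t *: u)) : x y /~ x < y}}].
  move=> u0; have [c_lt0|c_gt0|c0] := ltgtP c 0; last by rewrite c0 eqxx in c_neq0.
    have [s [s0 dec inc]] := (hF2 c_lt0).1 u u0; exists s; split=> //.
      move=> x y xs ys xy; rewrite !sHc ltr0_sg// !mulN1r ltrN2; exact: dec.
    by move=> x y xs ys xy; rewrite !sHc ltr0_sg// !mulN1r ltrN2; exact: inc.
  have [s [s0 inc dec]] := (hF1 c_gt0).1 u u0; exists s; split=> //.
    by move=> x y xs ys xy; rewrite !sHc gtr0_sg// !mul1r; exact: inc.
  by move=> x y xs ys xy; rewrite !sHc gtr0_sg// !mul1r; exact: dec.
have div (A : set X) : weakly_compact A -> ~ A 0 ->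
    forall M : R, \forall t \near +oo, forall u, A u -> sH c alpha I1 (t *: u) < M.
  move=> cA A0 M; have [c_lt0|c_gt0|c0] := ltgtP c 0; last by rewrite c0 eqxx in c_neq0.
    have := (hF2 c_lt0).2 A cA A0 (- M); apply: filterS => t h u Au.
    by rewrite sHc ltr0_sg// mulN1r ltrNl; exact: h.
  have := (hF1 c_gt0).2 A cA A0 M; apply: filterS => t h u Au.
  by rewrite sHc gtr0_sg// mul1r; exact: h.
apply: (fibre_main c_neq0 alpha_gt0 I1_C1 I2_C1 I1_0 I2_gt0 I2_hom uni div ucX
  normC1 I2_0 dI2_cc J_C1 K_C1 I1E dK_cc c1_gt0 c2_gt0 ab eta_gt1 Jc Jm) => //.
by move=> c_lt0 e e0; exact: limf_esup_small (hK (hF2 c_lt0)) e0.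
Qed.
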